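(* Suppose that $0<p<\infty$ and that $w$ is a weight on the unit disc $\mathbb{D}$ which is a Bekoll\'e-Bonami weight for some exponent $q\in(1,\infty)$. Then the operator taking $\delta_b f'$ to $f-f(0)$, for $f$ analytic on $\mathbb{D}$, is bounded with respect to $\|\cdot\|_{L^p(w\,dA)}$.
   Context: $\mathbb{D}=\{z\in\mathbb{C}:|z|<1\}$, $dA$ is area measure, and $\delta_b(z)=1-|z|$. A weight is a measurable function $w:\mathbb{D}\to[0,\infty)$ that is positive a.e. For $1<q<\infty$, $w$ is a Bekoll\'e-Bonami weight for the exponent $q$ if there is a constant $0<C<\infty$ such that for every disc $B\subset\mathbb{C}$ whose closure intersects the unit circle, $$\left(\frac1{|B|}\int_{B\cap\mathbb{D}} w\,dA\right)\left(\frac1{|B|}\int_{B\cap\mathbb{D}} w^{-1/(q-1)}\,dA\right)^{q-1}\le C ,$$ where $|B|$ is the area of $B$. For measurable $g$ on $\mathbb{D}$, $\|g\|_{L^p(w\,dA)}=\left(\int_{\mathbb{D}}|g|^p\,w\,dA\right)^{1/p}\in[0,\infty]$. An operator $T$ (defined on a given class of functions) is bounded with respect to $\|\cdot\|$ if for each $D>0$ there is a constant $D'>0$ such that $\|Tg\|\le D$ whenever $g$ is in the class and $\|g\|\le D'$; for operators commuting with positive scalar multiplication and $\|\cdot\|=\|\cdot\|_{L^p(w\,dA)}$ this is equivalent to the existence of a constant $C$ with $\|Tg\|\le C\|g\|$ for all $g$ in the class with $\|g\|<\infty$. Here the class is $\{\delta_b f': f \text{ analytic on }\mathbb{D}\}$.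 *)

(* Defs.v *)
From HB Require Import structures.
From mathcomp Require Import all_boot all_order all_algebra.
From mathcomp Require Import complex.
From mathcomp Require Import all_classical all_reals all_analysis measurable_realfun.

Set Implicit Arguments.
Unset Strict Implicit.
Unset Printing Implicit Defensive.

Import Order.TTheory GRing.Theory Num.Theory.
Import numFieldNormedType.Exports.

Local Open Scope classical_set_scope.
Local Open Scope ring_scope.
Local Open Scope complex_scope.

(* The topology and normed module structure of [R[i]] over itself are those of
   any numeric field. *)
HB.instance Definition _ (R : realType) := PseudoPointedMetric.copy R[i] R[i]^o.
HB.instance Definition _ (R : realType) := NormedModule.copy R[i] R[i]^o.

Section Defs.
Context {R : realType}.

(* The norm `|z| of [R[i]] is itself an element of [R[i]]; [cabs z] is the
   modulus as an element of [R]. *)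
Definition cabs (z : R[i]) : R := Normc.normc z.

Definition disc (c : R[i]) (r : R) : set R[i] := [set z | cabs (z - c) < r].

Definition unit_disc : set R[i] := disc 0 1.

Definition unit_circle : set R[i] := [set z | cabs z = 1].

Definition delta_b (z : R[i]) : R := 1 - cabs z.

(* Area is the product Lebesgue measure on R * R, transported along
   (x, y) |-> x + i y: sets of complex numbers are measured, and functions of
   a complex variable integrated, in real coordinates. *)
Definition cplx (p : R * R) : R[i] := p.1 +i* p.2.

Definition dA := (@lebesgue_measure R \x @lebesgue_measure R)%E.

Definition area (A : set R[i]) : \bar R := dA (cplx @^-1` A).

Definition area_integral (A : set R[i]) (g : R[i] -> R) : \bar R :=
  (\int[dA]_(p in cplx @^-1` A) (g (cplx p))%:E)%E.

(* Lebesgue (rather than just Borel) measurability on A: preimages of Borel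
   sets belong to the completion of the product Borel sigma-algebra.  For such
   a nonnegative g, [area_integral A g], a supremum over Borel simple functions
   below g, is the usual Lebesgue integral, since g coincides with a Borel
   function outside a Borel null set. *)
Definition measurable_on (A : set R[i]) (g : R[i] -> R) : Prop :=
  forall Y : set R, measurable Y ->
    completed_algebra_gen dA (cplx @^-1` (A `&` g @^-1` Y)).

(* Only the values of w on the unit disc are relevant. *)
Definition weight (w : R[i] -> R) : Prop :=
  [/\ measurable_on unit_disc w,
      forall z, unit_disc z -> 0 <= w z &
      {ae dA, forall p, unit_disc (cplx p) -> 0 < w (cplx p)}].

(* The value of [w `^ (- (q - 1)^-1)] where w vanishes (0, by the convention
   of [powR]) is irrelevant for weights, which are positive a.e.; likewise, if
   [B `&` unit_disc] is nonempty then both integrals are positive, so that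
   a product 0 * +oo occurs only if it is empty and both integrals are 0. *)
Definition bekolle_bonami (q : R) (w : R[i] -> R) : Prop :=
  exists2 C : R, 0 < C &
    forall (c : R[i]) (r : R), 0 < r ->
      closure (disc c r) `&` unit_circle !=set0 ->
      let B := disc c r in
      (((area B)^-1 * area_integral (B `&` unit_disc) w) *
       ((area B)^-1 * area_integral (B `&` unit_disc)
                        (fun z => w z `^ (- (q - 1)^-1))%R) `^ (q - 1)
       <= C%:E)%E.

Definition weighted_Lp_norm (p : R) (w : R[i] -> R) (g : R[i] -> R[i]) :
    \bar R :=
  ((area_integral unit_disc (fun z => cabs (g z) `^ p * w z)%R) `^ p^-1)%E.

(* Complex differentiability at every point of A: the scalar field in
   [derivable] is [R[i]]. *)
Definition analytic_on (A : set R[i]) (f : R[i] -> R[i]) : Prop :=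
  forall z, A z -> derivable f z 1.

(* An operator is given by its graph: [T g h] means that g is in the class on
   which the operator is defined and that its image is h. *)
Definition bounded_operator (norm : (R[i] -> R[i]) -> \bar R)
    (T : (R[i] -> R[i]) -> (R[i] -> R[i]) -> Prop) : Prop :=
  forall D : R, 0 < D -> exists2 D' : R, 0 < D' &
    forall g h, T g h -> (norm g <= D'%:E)%E -> (norm h <= D%:E)%E.

(* The operator delta_b f' |-> f - f(0).  Functions on the unit disc are
   represented by functions on [R[i]] whose values elsewhere are arbitrary, so
   g and h are only constrained on the disc; on it g determines f'
   and hence, the disc being connected, f - f(0). *)
Definition primitive_operator (g h : R[i] -> R[i]) : Prop :=
  exists f : R[i] -> R[i],
    [/\ analytic_on unit_disc f,
        forall z, unit_disc z -> g z = (delta_b z)%:C * derive1 f z &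
        forall z, unit_disc z -> h z = f z - f 0].

End Defs.

(* Main.v *)
(* Let g = delta_b f', h = f - f(0), and let t be the distance to the circle.
   Cauchy's theorem gives a mean value property of |f'| on squares which, together
   with the Bekolle-Bonami condition, yields a reverse Hoelder estimate: the value
   of (t |f'|)^p at a point, times the weight W of a disc of radius comparable to t
   around it, is bounded by the integral of |g|^p w over a similar disc contained
   in the unit disc. Hence, for every eta > 0, |h|^p grows between two consecutive
   dyadic levels of a radius by at most
     (eta K (integral of |h|^p w) + K_eta (integral of |g|^p w)) / W,
   both integrals being over discs of that size. Summing over the levels bounds
   |h|^p by a sum of positive kernels applied to eta K |h|^p w + K_eta |g|^p w; each
   kernel has mass at most one against w, and at most four of them see a given
   point. So the integral of |h|^p w is at most
     4 (eta K (integral of |h|^p w) + K_eta (integral of |g|^p w)).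
   With 8 eta K = 1 the first term is absorbed; this is done on discs |z| < r < 1,
   where the integral of |h|^p w is finite, and r tends to 1. *)

Require Import Defs.
From HB Require Import structures.
From mathcomp Require Import all_boot all_order all_algebra.
From mathcomp Require Import complex.
From mathcomp Require Import all_classical all_reals all_analysis measurable_realfun.
From mathcomp Require Import ring lra.

Set Implicit Arguments.
Unset Strict Implicit.
Unset Printing Implicit Defensive.

Import Order.TTheory GRing.Theory Num.Theory.
Import numFieldNormedType.Exports.

Local Open Scope classical_set_scope.
Local Open Scope ring_scope.
Local Open Scope complex_scope.

(** * Complex derivatives and line integrals *)

(** Small and large p meet different obstacles. For p > 1 the power |h|^p is not subadditive:
    crossing one level costs a factor 1 + eta, and over infinitely many levels such factors are
    unbounded. So the loss eta |h|^p is not carried along as a factor; at each level it is replaced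
    by eta times a weighted mean of |h|^p, an additive term. For p < q Hoelder's inequality does not
    control the mean of |f'| by that of |f'|^p w. The reverse Hoelder estimate is therefore proved
    at a point where |f'|, multiplied by a power of the distance to the complement of the disc, is
    almost maximal; around it |f'| is at most a constant times its value there, which stands in for
    subharmonicity of powers of |f'|. The Bekolle-Bonami condition only sees discs that reach the
    circle. It is used on discs of radius 2t about points at distance 3t/4 from the circle, and
    leaves the distribution of w inside smaller discs open. That the disc of radius t/4 about the
    same point carries a fixed share of the weight is the reverse Hoelder estimate again, for the
    constant function 1. *)

Section ComplexAbs.
Context {R : realType}.
Implicit Types (z a b : R[i]) (f : R[i] -> R[i]).

Lemma cabs_ge0 z : 0 <= cabs z.
Proof. by case: z => x y; exact: sqrtr_ge0. Qed.

Lemma cabsM a b : cabs (a * b) = cabs a * cabs b.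
Proof. exact: Normc.normcM. Qed.

Lemma cabsV a : cabs a^-1 = (cabs a)^-1.
Proof. exact: Normc.normcV. Qed.

Lemma cabsN a : cabs (- a) = cabs a.
Proof. exact: complex.normcN. Qed.

Lemma cabsD a b : cabs (a + b) <= cabs a + cabs b.
Proof. exact: complex.le_normcD. Qed.

Lemma cabsB a b : cabs (a - b) = cabs (b - a).
Proof. by rewrite -cabsN opprB. Qed.

Lemma cabs_dist a b c : cabs (a - c) <= cabs (a - b) + cabs (b - c).
Proof. by rewrite (le_trans _ (cabsD _ _))// addrA subrK. Qed.

Lemma cabs0 : cabs (0 : R[i]) = 0.
Proof. exact: Normc.normc0. Qed.

Lemma cabs1 : cabs (1 : R[i]) = 1.
Proof. exact: Normc.normc1. Qed.

Lemma cabs_eq0 z : (cabs z == 0) = (z == 0).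
Proof.
by apply/eqP/eqP => [/Normc.eq0_normc//|->]; exact: cabs0.
Qed.

Lemma cabs_gt0 z : (0 < cabs z) = (z != 0).
Proof. by rewrite lt0r cabs_eq0 cabs_ge0 andbT. Qed.

Lemma cabs_real (x : R) : cabs x%:C = `|x|.
Proof. by rewrite /cabs /= expr0n /= addr0 sqrtr_sqr. Qed.

Lemma cabs_sqr z : cabs z ^+ 2 = complex.Re z ^+ 2 + complex.Im z ^+ 2.
Proof. by case: z => x y; rewrite /cabs /= sqr_sqrtr ?addr_ge0 ?sqr_ge0. Qed.

Lemma Re_le_cabs z : `|complex.Re z| <= cabs z.
Proof.
rewrite -(ler_pXn2r (_ : (0 < 2)%N))// ?nnegrE ?cabs_ge0//.
by rewrite cabs_sqr real_normK ?num_real// lerDl sqr_ge0.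
Qed.

Lemma Im_le_cabs z : `|complex.Im z| <= cabs z.
Proof.
rewrite -(ler_pXn2r (_ : (0 < 2)%N))// ?nnegrE ?cabs_ge0//.
by rewrite cabs_sqr real_normK ?num_real// lerDr sqr_ge0.
Qed.

Lemma cabs_le_ReIm z : cabs z <= `|complex.Re z| + `|complex.Im z|.
Proof.
rewrite -(ler_pXn2r (_ : (0 < 2)%N))// ?nnegrE ?cabs_ge0 ?addr_ge0//.
rewrite cabs_sqr sqrrD !real_normK ?num_real// addrAC.
by rewrite lerDl mulrn_wge0 ?mulr_ge0.
Qed.

(** Complex differentiability with real epsilon and delta, multiplied out so that h = 0 is allowed
    and no quotient has to be formed. *)
Definition cdiff f z l := forall eps : R, 0 < eps -> exists2 d : R, 0 < d &
  forall h, cabs h < d -> cabs (f (z + h) - f z - l * h) <= eps * cabs h.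

Lemma normC_cabs z : `|z| = (cabs z)%:C.
Proof. by rewrite complex.normc_def; case: z. Qed.

Lemma derivable_cdiff f z : derivable f z 1 -> cdiff f z (derive1 f z).
Proof.
move=> df e e0; rewrite derive1E.
have /cvgrPdist_le/(_ e%:C) := df.
rewrite ltcR => /(_ e0) [/= d /= d0 H].
have dC : d = (complex.Re d)%:C by rewrite RRe_real// gtr0_real.
exists (complex.Re d); first by move: d0; rewrite dC ltcR.
move=> h hd; have [->|h0] := eqVneq h 0.
  by rewrite addr0 subrr mulr0 subrr cabs0 mulr0.
have := H h; rewrite /ball_ /= sub0r normrN normC_cabs dC ltcR => /(_ hd h0).
rewrite normC_cabs lecR => Hh.
have -> : f (z + h) - f z - 'D_1 f z * h =
    - ((lim ((fun h => h^-1 *: ((f \o shift z) (h *: 1) - f z)) @ 0^')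
     - h^-1 *: (f (h%:A + z) - f z)) * h).
  rewrite -/(derive f z 1) mulrBl /GRing.scale/= [h * 1]mulr1.
  by rewrite [h^-1 * _ * _]mulrAC mulVf// mul1r opprB (addrC h z).
by rewrite cabsN cabsM ler_wpM2r// cabs_ge0.
Qed.

End ComplexAbs.

(** * Compactness by repeated quadrisection of a rectangle *)

Section Cousin.
Context {R : realType}.

(** A form of Cousin's lemma. If P failed on the initial rectangle it would fail on a nested
    sequence of quarters; these shrink to a point, and the local hypothesis at that point
    contradicts the failure. It serves both for Goursat's theorem and for the boundedness of f on
    compact discs. *)
Lemma quadrisection_induction (P : R -> R -> R -> R -> Prop) (x0 y0 w0 h0 : R) :
    0 <= w0 -> 0 <= h0 ->
    (forall x y w h, 0 <= w -> 0 <= h ->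
       P x y (w / 2) (h / 2) -> P (x + w / 2) y (w / 2) (h / 2) ->
       P x (y + h / 2) (w / 2) (h / 2) ->
       P (x + w / 2) (y + h / 2) (w / 2) (h / 2) -> P x y w h) ->
    (forall x y, x0 <= x <= x0 + w0 -> y0 <= y <= y0 + h0 ->
       exists2 d, 0 < d & forall x' y' w h, 0 <= w -> 0 <= h ->
         x' <= x <= x' + w -> y' <= y <= y' + h -> w + h < d -> P x' y' w h) ->
  P x0 y0 w0 h0.
Proof.
move=> w00 h00 quad loc; apply: contrapT => nP.
pose W n : R := w0 / 2 ^+ n; pose H n : R := h0 / 2 ^+ n.
have WS n : W n.+1 = W n / 2 by rewrite /W exprSr invfM mulrA.
have HS n : H n.+1 = H n / 2 by rewrite /H exprSr invfM mulrA.
have W0 n : 0 <= W n by rewrite divr_ge0// exprn_ge0.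
have H0 n : 0 <= H n by rewrite divr_ge0// exprn_ge0.
(* The failure of P stands as a premise, so a successor exists for every rectangle and [choice]
   applies; [uP] then propagates the failure from the initial rectangle. *)
have step (nq : nat * (R * R)) : exists q' : R * R,
    (~ P nq.2.1 nq.2.2 (W nq.1) (H nq.1) ->
     ~ P q'.1 q'.2 (W nq.1.+1) (H nq.1.+1)) /\
    ((nq.2.1 <= q'.1 <= nq.2.1 + W nq.1.+1) /\
     (nq.2.2 <= q'.2 <= nq.2.2 + H nq.1.+1)).
  case: nq => n [x y] /=.
  have wn := W0 n.+1; have hn := H0 n.+1.
  have aux a b : (~ P x y (W n) (H n) -> ~ P (x + a) (y + b) (W n.+1) (H n.+1)) ->
      0 <= a <= W n.+1 -> 0 <= b <= H n.+1 ->
      exists q' : R * R, (~ P x y (W n) (H n) ->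
        ~ P q'.1 q'.2 (W n.+1) (H n.+1)) /\
       ((x <= q'.1 <= x + W n.+1) /\ (y <= q'.2 <= y + H n.+1)).
    by move=> h1 h2 h3; exists (x + a, y + b) => /=; split=> //; lra.
  have [PQ|PQ] := pselect (P x y (W n) (H n)).
    by apply: (aux 0 0) => //; lra.
  have [P1|P1] := pselect (P x y (W n.+1) (H n.+1)); last first.
    by apply: (aux 0 0); rewrite ?addr0; [|lra|lra].
  have [P2|P2] := pselect (P (x + W n.+1) y (W n.+1) (H n.+1)); last first.
    by apply: (aux (W n.+1) 0); rewrite ?addr0; [|lra|lra].
  have [P3|P3] := pselect (P x (y + H n.+1) (W n.+1) (H n.+1)); last first.
    by apply: (aux 0 (H n.+1)); rewrite ?addr0; [|lra|lra].
  apply: (aux (W n.+1) (H n.+1)); [|lra|lra].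
  move=> _ P4; apply: PQ; rewrite WS HS in P1 P2 P3 P4; exact: quad.
have [next nextP] := choice step.
pose u := fix u n : R * R := if n is m.+1 then next (m, u m) else (x0, y0).
have uP n : ~ P (u n).1 (u n).2 (W n) (H n).
  elim: n => [|n IH] /=; first by rewrite /W /H expr0 !divr1.
  by have [+ _] := nextP (n, u n); apply.
have ux n : (u n).1 <= (u n.+1).1 /\ (u n.+1).1 + W n.+1 <= (u n).1 + W n.
  by have [_ [/= h1 _]] := nextP (n, u n); rewrite WS in h1 *; split; lra.
have uy n : (u n).2 <= (u n.+1).2 /\ (u n.+1).2 + H n.+1 <= (u n).2 + H n.
  by have [_ [/= _ h1]] := nextP (n, u n); rewrite HS in h1 *; split; lra.
(* Left ends increase and right ends decrease, so the supremum of the left ends lies in all the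
   intervals. *)
have nested (v L : nat -> R) : (forall n, 0 <= L n) ->
    (forall n, v n <= v n.+1 /\ v n.+1 + L n.+1 <= v n + L n) ->
    exists X, forall n, v n <= X <= v n + L n.
  move=> L0 vL.
  have inc m n : (m <= n)%N -> v m <= v n /\ v n + L n <= v m + L m.
    elim: n => [|n IH]; first by rewrite leqn0 => /eqP ->.
    rewrite leq_eqVlt => /orP[/eqP->//|/IH[h1 h2]].
    by have [] := vL n; split; lra.
  have bd m n : v m <= v n + L n.
    have [mn|nm] := leqP m n.
      by have [] := inc _ _ mn; have := L0 n; lra.
    by have [] := inc _ _ (ltnW nm); have := L0 m; lra.
  have sV : has_sup (range v).
    by split; [exists (v 0); exists 0|exists (v 0 + L 0) => _ [n _ <-]].
  exists (sup (range v)) => n; apply/andP; split.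
    by apply: ub_le_sup; [exact: sV.2|exists n].
  by apply: ge_sup; [exact: sV.1|move=> _ [m _ <-]].
have [X XP] := nested _ _ W0 ux; have [Y YP] := nested _ _ H0 uy.
have := XP 0; have := YP 0; rewrite /= /W /H expr0 !divr1 => Y0 X0.
have [d d0 Hd] := loc _ _ X0 Y0.
have [n nP'] : exists n, (w0 + h0) / 2 ^+ n < d.
  have cv : (w0 + h0) *: ((2^-1 : R) ^+ n) @[n --> \oo] --> (w0 + h0) *: (0:R).
    by apply: cvgZr => //; apply: cvg_expr; rewrite ger0_norm; lra.
  rewrite scaler0 in cv; move/cvgrPdist_lt: cv => /(_ d d0)[N _ /(_ N)] /=.
  rewrite leqnn => /(_ isT); rewrite sub0r normrN ger0_norm; last first.
    by rewrite mulr_ge0 ?addr_ge0// exprn_ge0.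
  by exists N; rewrite -exprVn.
apply: (uP n); apply: Hd => //.
by rewrite /W /H -mulrDl.
Qed.

End Cousin.

Section LineIntegral.
Context {R : realType}.
Local Notation mu := (@lebesgue_measure R).
Local Notation re := (@complex.Re R).
Local Notation im := (@complex.Im R).
Implicit Types (phi psi : R -> R[i]) (a b c : R).

(** The point s is not confined to [a, b]: continuity is two-sided at the end points too, and no
    one-sided limits occur. *)
Definition path_continuous a b phi := forall t, a <= t <= b ->
  forall e : R, 0 < e -> exists2 d : R, 0 < d &
    forall s, `|s - t| < d -> cabs (phi s - phi t) <= e.

Definition line_integral a b phi : R[i] :=
  (\int[mu]_(x in `[a, b]) re (phi x)) +i* (\int[mu]_(x in `[a, b]) im (phi x)).

(** Here, and in the similar lemmas below, [g] stands for the real or the imaginary part, of which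
    only additivity and the bound by the modulus are used. *)
Lemma path_continuous_part a b phi (g : R[i] -> R) :
  (forall z z', g z - g z' = g (z - z')) -> (forall z, `|g z| <= cabs z) ->
  path_continuous a b phi -> {within `[a, b], continuous (fun x => g (phi x))}.
Proof.
move=> gB gle cphi; apply: continuous_in_subspaceT => t.
rewrite inE /= in_itv /= => tab.
apply/cvgrPdist_le => e e0; have [d d0 H] := cphi t tab e e0.
exists d => //= s; rewrite /ball_ /= distrC => /H hs.
by rewrite distrC gB (le_trans (gle _)).
Qed.

Lemma ReB (z z' : R[i]) : re z - re z' = re (z - z').
Proof. by case: z z' => ? ? []. Qed.

Lemma ImB (z z' : R[i]) : im z - im z' = im (z - z').
Proof. by case: z z' => ? ? []. Qed.

Lemma Re_path_continuous a b phi : path_continuous a b phi ->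
  {within `[a, b], continuous (fun x => re (phi x))}.
Proof. by apply: path_continuous_part; [exact: ReB|exact: Re_le_cabs]. Qed.

Lemma Im_path_continuous a b phi : path_continuous a b phi ->
  {within `[a, b], continuous (fun x => im (phi x))}.
Proof. by apply: path_continuous_part; [exact: ImB|exact: Im_le_cabs]. Qed.

Lemma Re_path_integrable a b phi : path_continuous a b phi ->
  mu.-integrable `[a, b] (EFin \o (fun x => re (phi x))).
Proof.
move=> h; apply: continuous_compact_integrable; first exact: segment_compact.
exact: Re_path_continuous.
Qed.

Lemma Im_path_integrable a b phi : path_continuous a b phi ->
  mu.-integrable `[a, b] (EFin \o (fun x => im (phi x))).
Proof.
move=> h; apply: continuous_compact_integrable; first exact: segment_compact.
exact: Im_path_continuous.
Qed.

Lemma path_continuousS a b a' b' phi : a <= a' -> b' <= b ->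
  path_continuous a b phi -> path_continuous a' b' phi.
Proof. by move=> h1 h2 h t /andP[h3 h4]; apply: h; apply/andP; split; lra. Qed.

Lemma path_continuousD a b phi psi : path_continuous a b phi ->
  path_continuous a b psi -> path_continuous a b (fun x => phi x + psi x).
Proof.
move=> h1 h2 t tab e e0.
have e20 : 0 < e / 2 by lra.
have [d1 d10 H1] := h1 t tab _ e20; have [d2 d20 H2] := h2 t tab _ e20.
exists (Num.min d1 d2); first by rewrite lt_min d10 d20.
move=> s; rewrite lt_min => /andP[/H1 ? /H2 ?].
by rewrite opprD addrACA (le_trans (cabsD _ _))//; lra.
Qed.

Lemma path_continuous_cst a b (c : R[i]) : path_continuous a b (fun=> c).
Proof.
by move=> t _ e e0; exists 1 => // s _; rewrite subrr cabs0 ltW.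
Qed.

Lemma path_continuous_id a b : path_continuous a b (fun x => x%:C).
Proof.
move=> t _ e e0; exists e => // s /ltW.
have -> : s%:C - t%:C = (s - t)%:C by rewrite rmorphB.
by rewrite cabs_real.
Qed.

Lemma path_continuousZ a b phi (c : R[i]) : path_continuous a b phi ->
  path_continuous a b (fun x => c * phi x).
Proof.
move=> h t tab e e0; have c1 : 0 < cabs c + 1 by have := cabs_ge0 c; lra.
have ec : 0 < e / (cabs c + 1) by rewrite divr_gt0.
have [d d0 H] := h t tab _ ec; exists d => // s /H.
rewrite ler_pdivlMr// => hs; rewrite -mulrBr cabsM (le_trans _ hs)//.
by rewrite mulrC ler_wpM2l ?cabs_ge0// lerDl.
Qed.

Lemma path_continuousB a b phi psi : path_continuous a b phi ->
  path_continuous a b psi -> path_continuous a b (fun x => phi x - psi x).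
Proof.
move=> h1 h2; apply: path_continuousD => //.
have := path_continuousZ (-1) h2.
by congr path_continuous; apply/funext => x; rewrite mulN1r.
Qed.

Definition ccont (f : R[i] -> R[i]) (z : R[i]) := forall e : R, 0 < e ->
  exists2 d : R, 0 < d & forall h, cabs h < d -> cabs (f (z + h) - f z) <= e.

Lemma ccont_cst (c z : R[i]) : ccont (fun=> c) z.
Proof. by move=> e e0; exists 1 => // h _; rewrite subrr cabs0 ltW. Qed.

Lemma ccont_id (z : R[i]) : ccont id z.
Proof. by move=> e e0; exists e => // h /ltW; rewrite addrAC subrr add0r. Qed.

Lemma ccontB (f g : R[i] -> R[i]) z : ccont f z -> ccont g z ->
  ccont (fun x => f x - g x) z.
Proof.
move=> h1 h2 e e0; have e20 : 0 < e / 2 by lra.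
have [d1 d10 H1] := h1 _ e20; have [d2 d20 H2] := h2 _ e20.
exists (Num.min d1 d2); first by rewrite lt_min d10 d20.
move=> h; rewrite lt_min => /andP[/H1 k1 /H2 k2].
have -> : f (z + h) - g (z + h) - (f z - g z) =
  (f (z + h) - f z) - (g (z + h) - g z) by ring.
by rewrite (le_trans (cabsD _ _))// cabsN; lra.
Qed.

Lemma ccontM (phi psi : R[i] -> R[i]) t : ccont phi t ->
  ccont psi t -> ccont (fun x => phi x * psi x) t.
Proof.
move=> h1 h2 e e0.
pose M := cabs (phi t) + cabs (psi t) + 1.
have M1 : 1 <= M by rewrite lerDr addr_ge0 ?cabs_ge0.
pose e' := Num.min 1 (e / (2 * M)).
have e'0 : 0 < e' by rewrite lt_min ltr01 divr_gt0//; lra.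
have e'1 : e' <= 1 by rewrite ge_min lexx.
have e'2 : e' * (2 * M) <= e by rewrite -ler_pdivlMr ?ge_min ?lexx ?orbT//; lra.
have [d1 d10 H1] := h1 _ e'0; have [d2 d20 H2] := h2 _ e'0.
exists (Num.min d1 d2); first by rewrite lt_min d10 d20.
move=> s; rewrite lt_min => /andP[/H1 k1 /H2 k2].
have -> : phi (t + s) * psi (t + s) - phi t * psi t =
  (phi (t + s) - phi t) * (psi (t + s) - psi t) +
  ((phi (t + s) - phi t) * psi t + phi t * (psi (t + s) - psi t)) by ring.
apply: (le_trans (cabsD _ _)); rewrite cabsM.
apply: (le_trans (lerD (lexx _) (cabsD _ _))); rewrite !cabsM.
have := ler_pM (cabs_ge0 _) (cabs_ge0 _) k1 k2.
have := ler_wpM2r (cabs_ge0 (psi t)) k1.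
have := ler_wpM2l (cabs_ge0 (phi t)) k2.
have : e' * e' <= e' by rewrite ler_piMr// ltW.
rewrite /M in e'2 *; have := cabs_ge0 (phi t); have := cabs_ge0 (psi t).
move: (cabs (phi t)) (cabs (psi t)) e'2 => A B; nra.
Qed.

Lemma ccontV (phi : R[i] -> R[i]) t : ccont phi t ->
  phi t != 0 ->
  ccont (fun x => (phi x)^-1) t.
Proof.
move=> h1 nt e e0.
have m0 : 0 < cabs (phi t) by rewrite cabs_gt0.
pose m := cabs (phi t).
pose e' := Num.min (m / 2) (e * m ^+ 2 / 2).
have e'0 : 0 < e' by rewrite lt_min !divr_gt0 ?mulr_gt0 ?exprn_gt0.
have e'1 : e' <= m / 2 by rewrite ge_min lexx.
have e'2 : e' <= e * m ^+ 2 / 2 by rewrite ge_min lexx orbT.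
have [d d0 H] := h1 _ e'0; exists d => // s /H hs.
have ms : m / 2 <= cabs (phi (t + s)).
  by have := cabs_dist (phi t) (phi (t + s)) 0; rewrite !subr0 cabsB -/m; lra.
have ns : phi (t + s) != 0 by rewrite -cabs_gt0; rewrite /m in ms; lra.
have -> : (phi (t + s))^-1 - (phi t)^-1 = - (phi (t + s) - phi t) / (phi (t + s) * phi t).
  by field; rewrite ns nt.
rewrite cabsM cabsN cabsV cabsM ler_pdivrMr ?mulr_gt0 ?cabs_gt0// -/m.
apply: (le_trans hs); apply: (le_trans e'2).
have em : 0 <= e * m by rewrite mulr_ge0 ?ltW.
by have := ler_wpM2l em ms; rewrite expr2; lra.
Qed.

Lemma cdiff_ccont (g : R[i] -> R[i]) z l : cdiff g z l -> ccont g z.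
Proof.
move=> hl e e0; have [d d0 H] := hl 1 ltr01.
have l1 : 0 < 1 + cabs l by have := cabs_ge0 l; lra.
exists (Num.min d (e / (1 + cabs l))); first by rewrite lt_min d0 divr_gt0.
move=> h; rewrite lt_min => /andP[hd]; rewrite ltr_pdivlMr// => hl1.
have := H _ hd; rewrite mul1r => hh.
have -> : g (z + h) - g z = (g (z + h) - g z - l * h) + l * h by ring.
by rewrite (le_trans (cabsD _ _))// cabsM; lra.
Qed.

Lemma ccont_path_continuous (g : R[i] -> R[i]) (z v : R[i]) a b : cabs v <= 1 ->
  (forall t, a <= t <= b -> ccont g (z + t%:C * v)) ->
  path_continuous a b (fun t => g (z + t%:C * v)).
Proof.
move=> v1 hg t /hg hl e e0; have [d d0 H] := hl e e0.
exists d => // s sd.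
have -> : z + s%:C * v = (z + t%:C * v) + (s - t)%:C * v by rewrite rmorphB/=; ring.
apply: H; rewrite cabsM cabs_real (le_lt_trans _ sd)//.
by rewrite ler_piMr.
Qed.

Lemma line_integralD a b phi psi : path_continuous a b phi ->
  path_continuous a b psi ->
  line_integral a b (fun x => phi x + psi x) =
  line_integral a b phi + line_integral a b psi.
Proof.
move=> h1 h2; rewrite /line_integral; simpc.
rewrite -!RintegralD//; try exact: Re_path_integrable; try exact: Im_path_integrable.
by congr (_ +i* _); apply: eq_Rintegral => x _; case: (phi x) (psi x) => ? ? [].
Qed.

Lemma line_integralZ a b phi (c : R[i]) : path_continuous a b phi ->
  line_integral a b (fun x => c * phi x) = c * line_integral a b phi.
Proof.
move=> h1; rewrite /line_integral; case: c => u v; simpc.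
have iR := Re_path_integrable h1; have iI := Im_path_integrable h1.
rewrite -!RintegralZl//.
have sc k (f : R -> R) : mu.-integrable `[a, b] (EFin \o f) ->
    mu.-integrable `[a, b] (EFin \o (fun x => k * f x)).
  by move=> fi; apply: (@integrableZl _ _ _ mu _ _ k (EFin \o f)).
rewrite -RintegralB//; [|exact: sc..].
rewrite -RintegralD//; [|exact: sc..].
congr (_ +i* _); apply: eq_Rintegral => x _; case: (phi x) => ? ? //=.
Qed.

Lemma line_integralB a b phi psi : path_continuous a b phi ->
  path_continuous a b psi ->
  line_integral a b (fun x => phi x - psi x) =
  line_integral a b phi - line_integral a b psi.
Proof.
move=> h1 h2; rewrite -[in RHS]mulN1r -line_integralZ// -line_integralD//.
  by congr line_integral; apply/funext => x; rewrite mulN1r.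
exact: path_continuousZ.
Qed.

Lemma line_integral_split a b c phi : a <= b -> b <= c ->
  path_continuous a c phi ->
  line_integral a c phi = line_integral a b phi + line_integral b c phi.
Proof.
move=> ab bc h; rewrite /line_integral; simpc.
have iR := Re_path_integrable h; have iI := Im_path_integrable h.
have sub : `]b, c] `<=` `[a, c].
  by move=> x; rewrite /= !in_itv /= => /andP[h1 h2]; apply/andP; split; lra.
have split (f : R -> R) : mu.-integrable `[a, c] (EFin \o f) ->
   \int[mu]_(x in `[a, c]) f x =
   \int[mu]_(x in `[a, b]) f x + \int[mu]_(x in `[b, c]) f x.
  move=> fi; have := @Rintegral_itvB _ f (BLeft a) (BRight c) b fi.
  rewrite !bnd_simp => /(_ ab bc); rewrite Rintegral_itv_obnd_cbnd; last first.
    exact: integrableS fi.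
  by move=> <-; rewrite addrC subrK.
by congr (_ +i* _); exact: split.
Qed.

Lemma itv_measure a b : a <= b -> mu `[a, b] = (b - a)%:E.
Proof.
rewrite le_eqVlt lebesgue_measure_itv/= lte_fin => /orP[/eqP->|->].
  by rewrite ltxx subrr.
by rewrite -EFinB.
Qed.

Lemma line_integral_cst a b (c : R[i]) : a <= b ->
  line_integral a b (fun=> c) = (b - a)%:C * c.
Proof.
move=> ab; rewrite /line_integral !Rintegral_cst//= itv_measure//=.
by case: c => u v; simpc; rewrite mulrC (mulrC v).
Qed.

Lemma eq_line_integral a b phi psi : (forall t, a <= t <= b -> phi t = psi t) ->
  line_integral a b phi = line_integral a b psi.
Proof.
move=> h; congr (_ +i* _); apply: eq_Rintegral => x; rewrite inE /= in_itv /= => xab;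
 by rewrite h.
Qed.

Lemma measurable_cabs_path a b phi : path_continuous a b phi ->
  measurable_fun `[a, b] (fun x => cabs (phi x)).
Proof.
move=> h; apply: subspace_continuous_measurable_fun => //.
apply: continuous_in_subspaceT => t.
rewrite inE /= in_itv /= => tab.
apply/cvgrPdist_le => e e0; have [d d0 H] := h t tab e e0.
exists d => //= s; rewrite /ball_ /= distrC => /H hs; rewrite distrC.
have := cabs_dist (phi s) (phi t) 0; have := cabs_dist (phi t) (phi s) 0.
by rewrite !subr0 (cabsB (phi t)) ler_norml => ? ?; apply/andP; split; lra.
Qed.

(** The factor 2 comes from bounding the real and the imaginary part separately, each by the
    integral of the modulus. *)
Lemma cabs_line_integral a b phi : path_continuous a b phi ->
  ((cabs (line_integral a b phi))%:E <=
   2%:E * \int[mu]_(x in `[a, b]) (cabs (phi x))%:E)%E.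
Proof.
move=> h; have iR := Re_path_integrable h; have iI := Im_path_integrable h.
have mc := measurable_cabs_path h.
have aux (f : R -> R) : mu.-integrable `[a, b] (EFin \o f) ->
    (forall x, `|f x| <= cabs (phi x)) ->
    (`|\int[mu]_(x in `[a, b]) f x|%:E <=
       \int[mu]_(x in `[a, b]) (cabs (phi x))%:E)%E.
  move=> fi fle; rewrite EFin_normr_Rintegral//.
  apply: (le_trans (le_abse_integral _ _ _)) => //.
    exact: measurable_int fi.
  apply: ge0_le_integral => //.
  - by apply: measurableT_comp => //; exact: measurable_int fi.
  - exact/measurable_EFinP.
  - by move=> x _; rewrite lee_fin.
apply: le_trans (_ : (_ <= `|re (line_integral a b phi)|%:E +
  `|im (line_integral a b phi)|%:E)%E) _.
  by rewrite -EFinD lee_fin cabs_le_ReIm.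
rewrite (_ : 2%:E = 1 + 1)%E; last by rewrite -EFinD.
rewrite ge0_muleDl// mul1e; apply: leeD => /=.
  by apply: aux => // x; exact: Re_le_cabs.
by apply: aux => // x; exact: Im_le_cabs.
Qed.

Lemma cabs_line_integral_le a b phi M : a <= b -> path_continuous a b phi ->
  (forall t, a <= t <= b -> cabs (phi t) <= M) ->
  cabs (line_integral a b phi) <= 2 * M * (b - a).
Proof.
move=> ab h hM; rewrite -lee_fin; apply: (le_trans (cabs_line_integral h)).
have M0 : 0 <= M by rewrite (le_trans (cabs_ge0 (phi a)))// hM// lexx.
rewrite -mulrA EFinM; apply: lee_wpmul2l; first by rewrite lee_fin.
apply: (@le_trans _ _ (\int[mu]_(x in `[a, b]) (cst M%:E x))%E).
  apply: ge0_le_integral => //.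
  - by move=> x _; rewrite lee_fin cabs_ge0.
  - apply/measurable_EFinP. exact: measurable_cabs_path.
by rewrite integral_cst//= itv_measure.
Qed.

End LineIntegral.

(** * Cauchy's theorem on rectangles *)

Section RectangleIntegral.
Context {R : realType}.
Implicit Types (g : R[i] -> R[i]) (x y w h : R).

(** The counterclockwise contour integral: bottom minus top, plus i times right minus left, since
    [line_integral] integrates against the real parameter. *)
Definition rect_integral g x0 x1 y0 y1 : R[i] :=
  line_integral x0 x1 (fun x => g (x +i* y0)) -
  line_integral x0 x1 (fun x => g (x +i* y1)) +
  'i * (line_integral y0 y1 (fun y => g (x1 +i* y)) -
        line_integral y0 y1 (fun y => g (x0 +i* y))).

Definition holomorphic_rect g x0 x1 y0 y1 := forall x y,
  x0 <= x <= x1 -> y0 <= y <= y1 -> exists l, cdiff g (x +i* y) l.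

Definition continuous_rect g x0 x1 y0 y1 :=
  (forall y, y0 <= y <= y1 -> path_continuous x0 x1 (fun x => g (x +i* y))) /\
  (forall x, x0 <= x <= x1 -> path_continuous y0 y1 (fun y => g (x +i* y))).

Lemma cabs_i : cabs ('i : R[i]) = 1.
Proof. by rewrite /cabs /= expr0n add0r expr1n sqrtr1. Qed.

Lemma horizontal_path_continuous g x0 x1 y :
  (forall x, x0 <= x <= x1 -> ccont g (x +i* y)) ->
  path_continuous x0 x1 (fun x => g (x +i* y)).
Proof.
move=> hg.
have E x : x +i* y = (0 +i* y) + x%:C * 1 by simpc; rewrite ?addr0.
under eq_fun do rewrite E.
apply: ccont_path_continuous; first by rewrite cabs1.
by move=> t /hg; rewrite E.
Qed.

Lemma vertical_path_continuous g x y0 y1 :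
  (forall y, y0 <= y <= y1 -> ccont g (x +i* y)) ->
  path_continuous y0 y1 (fun y => g (x +i* y)).
Proof.
move=> hg.
have E y : x +i* y = x%:C + y%:C * 'i by simpc.
under eq_fun do rewrite E.
apply: ccont_path_continuous; first by rewrite cabs_i.
by move=> t /hg; rewrite E.
Qed.

Lemma ccont_continuous_rect g x0 x1 y0 y1 :
  (forall x y, x0 <= x <= x1 -> y0 <= y <= y1 -> ccont g (x +i* y)) ->
  continuous_rect g x0 x1 y0 y1.
Proof.
move=> hg; split=> [y yP|x xP].
- by apply: horizontal_path_continuous => x xP; exact: hg.
- by apply: vertical_path_continuous => y yP; exact: hg.
Qed.

Lemma holomorphic_continuous_rect g x0 x1 y0 y1 :
  holomorphic_rect g x0 x1 y0 y1 -> continuous_rect g x0 x1 y0 y1.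
Proof.
move=> hg; apply: ccont_continuous_rect => x y xP yP.
by have [l /cdiff_ccont] := hg x y xP yP.
Qed.

(** Linearity of the contour integral is needed for kernels such as 1 / (ze - z), which are
    continuous on the four sides but not inside. *)
Definition boundary_continuous g x0 x1 y0 y1 :=
  [/\ path_continuous x0 x1 (fun x => g (x +i* y0)),
      path_continuous x0 x1 (fun x => g (x +i* y1)),
      path_continuous y0 y1 (fun y => g (x0 +i* y)) &
      path_continuous y0 y1 (fun y => g (x1 +i* y))].

Definition rect_boundary x0 x1 y0 y1 : set R[i] :=
  [set z | (x0 <= complex.Re z <= x1 /\
             (complex.Im z = y0 \/ complex.Im z = y1)) \/
           (y0 <= complex.Im z <= y1 /\
             (complex.Re z = x0 \/ complex.Re z = x1))].

Lemma ccont_boundary_continuous g x0 x1 y0 y1 :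
  (forall z, rect_boundary x0 x1 y0 y1 z -> ccont g z) ->
  boundary_continuous g x0 x1 y0 y1.
Proof.
move=> hg; split; [apply: horizontal_path_continuous|
  apply: horizontal_path_continuous|apply: vertical_path_continuous|
  apply: vertical_path_continuous] => t tP; apply: hg.
- by left; split=> //; left.
- by left; split=> //; right.
- by right; split=> //; left.
- by right; split=> //; right.
Qed.

Lemma eq_rect_integral g1 g2 x0 x1 y0 y1 :
  (forall z, rect_boundary x0 x1 y0 y1 z -> g1 z = g2 z) ->
  rect_integral g1 x0 x1 y0 y1 = rect_integral g2 x0 x1 y0 y1.
Proof.
move=> E; rewrite /rect_integral; congr (_ - _ + 'i * (_ - _));
  apply: eq_line_integral => t tP; apply: E.
- by left; split=> //; left.
- by left; split=> //; right.
- by right; split=> //; right.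
- by right; split=> //; left.
Qed.

Lemma continuous_rect_boundary g x0 x1 y0 y1 : x0 <= x1 -> y0 <= y1 ->
  continuous_rect g x0 x1 y0 y1 -> boundary_continuous g x0 x1 y0 y1.
Proof.
by move=> hx hy [h v]; split; [apply: h|apply: h|apply: v|apply: v];
  rewrite lexx ?hx ?hy.
Qed.

Lemma continuous_rectS g x0 x1 y0 y1 x0' x1' y0' y1' :
  x0 <= x0' -> x1' <= x1 -> y0 <= y0' -> y1' <= y1 ->
  continuous_rect g x0 x1 y0 y1 -> continuous_rect g x0' x1' y0' y1'.
Proof.
move=> a b c d [h v]; split=> [y|x] /andP[h1 h2].
- by apply: path_continuousS (h y _); rewrite //; lra.
- by apply: path_continuousS (v x _); rewrite //; lra.
Qed.

Lemma rect_integral_splitx g x0 x1 x2 y0 y1 : x0 <= x1 -> x1 <= x2 ->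
  y0 <= y1 -> continuous_rect g x0 x2 y0 y1 ->
  rect_integral g x0 x2 y0 y1 =
  rect_integral g x0 x1 y0 y1 + rect_integral g x1 x2 y0 y1.
Proof.
move=> h1 h2 h3 [h v]; rewrite /rect_integral.
rewrite !(@line_integral_split _ x0 x1 x2)//; [ring|apply: h; lra..].
Qed.

Lemma rect_integral_splity g x0 x1 y0 y1 y2 : y0 <= y1 -> y1 <= y2 ->
  x0 <= x1 -> continuous_rect g x0 x1 y0 y2 ->
  rect_integral g x0 x1 y0 y2 =
  rect_integral g x0 x1 y0 y1 + rect_integral g x0 x1 y1 y2.
Proof.
move=> h1 h2 h3 [h v]; rewrite /rect_integral.
rewrite !(@line_integral_split _ y0 y1 y2)//; [ring|apply: v; lra..].
Qed.

Lemma boundary_continuousB g1 g2 x0 x1 y0 y1 :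
  boundary_continuous g1 x0 x1 y0 y1 -> boundary_continuous g2 x0 x1 y0 y1 ->
  boundary_continuous (fun z => g1 z - g2 z) x0 x1 y0 y1.
Proof. by move=> [? ? ? ?] [? ? ? ?]; split; exact: path_continuousB. Qed.

Lemma boundary_continuousZ g (c : R[i]) x0 x1 y0 y1 :
  boundary_continuous g x0 x1 y0 y1 ->
  boundary_continuous (fun z => c * g z) x0 x1 y0 y1.
Proof. by move=> [? ? ? ?]; split; exact: path_continuousZ. Qed.

Lemma rect_integralB g1 g2 x0 x1 y0 y1 :
  boundary_continuous g1 x0 x1 y0 y1 -> boundary_continuous g2 x0 x1 y0 y1 ->
  rect_integral (fun z => g1 z - g2 z) x0 x1 y0 y1 =
  rect_integral g1 x0 x1 y0 y1 - rect_integral g2 x0 x1 y0 y1.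
Proof.
by move=> [? ? ? ?] [? ? ? ?]; rewrite /rect_integral !line_integralB//; ring.
Qed.

Lemma rect_integralZ g (c : R[i]) x0 x1 y0 y1 :
  boundary_continuous g x0 x1 y0 y1 ->
  rect_integral (fun z => c * g z) x0 x1 y0 y1 = c * rect_integral g x0 x1 y0 y1.
Proof.
by move=> [? ? ? ?]; rewrite /rect_integral !line_integralZ//; ring.
Qed.

Lemma affine_continuous_rect (A l : R[i]) x0 x1 y0 y1 :
  continuous_rect (fun z => A + l * z) x0 x1 y0 y1.
Proof.
split=> [y _|x _].
- have E x : A + l * (x +i* y) = (A + l * (0 +i* y)) + l * x%:C.
    by rewrite -addrA -mulrDr; simpc; rewrite ?add0r ?addr0.
  under eq_fun do rewrite E.
  apply: path_continuousD; first exact: path_continuous_cst.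
  apply: path_continuousZ; exact: path_continuous_id.
- have E y : A + l * (x +i* y) = (A + l * x%:C) + (l * 'i) * y%:C.
    by rewrite -addrA -mulrA -mulrDr; simpc.
  under eq_fun do rewrite E.
  apply: path_continuousD; first exact: path_continuous_cst.
  apply: path_continuousZ; exact: path_continuous_id.
Qed.

Lemma rect_integral_affine (A l : R[i]) x0 x1 y0 y1 : x0 <= x1 -> y0 <= y1 ->
  rect_integral (fun z => A + l * z) x0 x1 y0 y1 = 0.
Proof.
move=> hx hy; rewrite /rect_integral.
have E x y : A + l * (x +i* y) = (A + l * (0 +i* y)) + l * x%:C.
  by rewrite -addrA -mulrDr; simpc; rewrite ?add0r ?addr0.
have E' x y : A + l * (x +i* y) = (A + l * x%:C) + (l * 'i) * y%:C.
  by rewrite -addrA -mulrA -mulrDr; simpc.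
have H y : line_integral x0 x1 (fun x => A + l * (x +i* y)) =
    (x1 - x0)%:C * (A + l * ('i * y%:C)) +
    l * line_integral x0 x1 (fun x => x%:C).
  under eq_fun do rewrite E.
  rewrite line_integralD; [|exact: path_continuous_cst|
    apply: path_continuousZ; exact: path_continuous_id].
  rewrite line_integral_cst// line_integralZ//; last exact: path_continuous_id.
  by congr (_ * (_ + _ * _) + _); simpc.
have V x : line_integral y0 y1 (fun y => A + l * (x +i* y)) =
    (y1 - y0)%:C * (A + l * x%:C) +
    (l * 'i) * line_integral y0 y1 (fun y => y%:C).
  under eq_fun do rewrite E'.
  rewrite line_integralD; [|exact: path_continuous_cst|
    apply: path_continuousZ; exact: path_continuous_id].
  by rewrite line_integral_cst// line_integralZ//; exact: path_continuous_id.
rewrite !H !V !rmorphB/=; ring.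
Qed.

Lemma cabs_rect_integral_le g x0 x1 y0 y1 M : x0 <= x1 -> y0 <= y1 ->
  boundary_continuous g x0 x1 y0 y1 ->
  (forall z, rect_boundary x0 x1 y0 y1 z -> cabs (g z) <= M) ->
  cabs (rect_integral g x0 x1 y0 y1) <= 4 * M * ((x1 - x0) + (y1 - y0)).
Proof.
move=> hx hy [h1 h2 h3 h4] hM; rewrite /rect_integral.
apply: (le_trans (cabsD _ _)); rewrite cabsM cabs_i mul1r.
apply: (le_trans (lerD (cabsD _ _) (cabsD _ _))); rewrite !cabsN.
have := @cabs_line_integral_le _ _ _ _ M hx h1 (fun x xP =>
  hM (x +i* y0) (or_introl (conj xP (or_introl erefl)))).
have := @cabs_line_integral_le _ _ _ _ M hx h2 (fun x xP =>
  hM (x +i* y1) (or_introl (conj xP (or_intror erefl)))).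
have := @cabs_line_integral_le _ _ _ _ M hy h3 (fun y yP =>
  hM (x0 +i* y) (or_intror (conj yP (or_introl erefl)))).
have := @cabs_line_integral_le _ _ _ _ M hy h4 (fun y yP =>
  hM (x1 +i* y) (or_intror (conj yP (or_intror erefl)))).
lra.
Qed.

Lemma rect_boundary_sub x0 x1 y0 y1 z : x0 <= x1 -> y0 <= y1 ->
  rect_boundary x0 x1 y0 y1 z ->
  x0 <= complex.Re z <= x1 /\ y0 <= complex.Im z <= y1.
Proof. by move=> hx hy [[? []->]|[? []->]]; rewrite lexx ?hx ?hy. Qed.

(** Subtracting the affine approximation at p does not change the integral, because affine functions
    integrate to 0. What remains is at most e (w + h) on the boundary. *)
Lemma rect_integral_cdiff g (p : R[i]) l e d x y w h : 0 <= w -> 0 <= h ->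
  0 <= e -> continuous_rect g x (x + w) y (y + h) ->
  (forall k, cabs k < d -> cabs (g (p + k) - g p - l * k) <= e * cabs k) ->
  x <= complex.Re p <= x + w -> y <= complex.Im p <= y + h -> w + h < d ->
  cabs (rect_integral g x (x + w) y (y + h)) <= 8 * e * (w ^+ 2 + h ^+ 2).
Proof.
move=> w0 h0 e0 cg gp xp yp whd.
have hx : x <= x + w by lra.
have hy : y <= y + h by lra.
have cA := continuous_rect_boundary hx hy
  (affine_continuous_rect (g p - l * p) l x (x + w) y (y + h)).
have {}cg := continuous_rect_boundary hx hy cg.
have := rect_integralB cg cA.
rewrite rect_integral_affine// subr0 => <-.
have M : forall z, rect_boundary x (x + w) y (y + h) z ->
    cabs (g z - (g p - l * p + l * z)) <= e * (w + h).
  move=> [x' y'] /(rect_boundary_sub hx hy)/= [x'P y'P].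
  have k0 : cabs ((x' +i* y') - p) <= w + h.
    apply: (le_trans (cabs_le_ReIm _)); case: p xp yp {gp cA} => px py /= xp yp.
    by apply: lerD; rewrite ler_norml; lra.
  have := gp _ (le_lt_trans k0 whd); rewrite [p + _]addrC subrK => gk.
  have -> : g (x' +i* y') - (g p - l * p + l * (x' +i* y')) =
    g (x' +i* y') - g p - l * (x' +i* y' - p) by ring.
  by rewrite (le_trans gk)// ler_wpM2l.
apply: (le_trans (cabs_rect_integral_le hx hy _ M)).
  exact: boundary_continuousB.
(* This gives (w + h)^2 <= 2 (w^2 + h^2), the passage to a bound that is a sum of squares. *)
have : 0 <= e * (w - h) ^+ 2 by rewrite mulr_ge0// sqr_ge0.
nra.
Qed.

(** Goursat's argument: differentiability bounds the integral over small rectangles by e times a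
    quadratic expression in the sides, quadrisection carries the bound to the whole rectangle, and e
    is arbitrary. *)
Lemma goursat g x0 x1 y0 y1 : x0 <= x1 -> y0 <= y1 ->
  holomorphic_rect g x0 x1 y0 y1 -> rect_integral g x0 x1 y0 y1 = 0.
Proof.
move=> hx hy hg; have cg := holomorphic_continuous_rect hg.
apply/eqP; rewrite -cabs_eq0 eq_le cabs_ge0 andbT.
have [-> ->] : x1 = x0 + (x1 - x0) /\ y1 = y0 + (y1 - y0) by split; ring.
set w0 := x1 - x0; set h0 := y1 - y0.
suff S e : 0 < e -> cabs (rect_integral g x0 (x0 + w0) y0 (y0 + h0)) <=
    8 * e * (w0 ^+ 2 + h0 ^+ 2).
  apply/ler_addgt0Pl => e e0; rewrite addr0.
  have D0 : 0 < 8 * (w0 ^+ 2 + h0 ^+ 2) + 1.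
    by have := sqr_ge0 w0; have := sqr_ge0 h0; lra.
  apply: (le_trans (S (e / (8 * (w0 ^+ 2 + h0 ^+ 2) + 1)) _)).
    by rewrite divr_gt0.
  move: (w0 ^+ 2 + h0 ^+ 2) D0 => q D0.
  have -> : 8 * (e / (8 * q + 1)) * q = e * (8 * q) / (8 * q + 1) by ring.
  by rewrite ler_pdivrMr// ler_pM2l// lerDl.
move=> e0.
(* The bound is quadratic in the sides, so the bounds for the four quarters add up exactly to that
   for the rectangle. Containment in the original rectangle is part of P because the local
   hypothesis of the induction ranges over all small rectangles around a point. *)
pose P x y w h := x0 <= x -> x + w <= x1 -> y0 <= y -> y + h <= y1 ->
  cabs (rect_integral g x (x + w) y (y + h)) <= 8 * e * (w ^+ 2 + h ^+ 2).
suff : P x0 y0 w0 h0 by apply; rewrite ?lexx// /w0 /h0; lra.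
apply: (@quadrisection_induction _ P); rewrite ?subr_ge0//.
- move=> x y w h w0' h0' P1 P2 P3 P4 Q1 Q2 Q3 Q4.
  have c : continuous_rect g x (x + w) y (y + h).
    exact: continuous_rectS cg.
  rewrite (@rect_integral_splitx _ x (x + w / 2)) //; try lra.
  rewrite (@rect_integral_splity _ x (x + w / 2) y (y + h / 2)); try lra; last first.
    by apply: continuous_rectS c; lra.
  rewrite (@rect_integral_splity _ (x + w / 2) (x + w) y (y + h / 2)); try lra; last first.
    by apply: continuous_rectS c; lra.
  have Ex : x + w = x + w / 2 + w / 2 by lra.
  have Ey : y + h = y + h / 2 + h / 2 by lra.
  have := P1 ltac:(lra) ltac:(lra) ltac:(lra) ltac:(lra).
  have := P2 ltac:(lra) ltac:(lra) ltac:(lra) ltac:(lra).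
  have := P3 ltac:(lra) ltac:(lra) ltac:(lra) ltac:(lra).
  have := P4 ltac:(lra) ltac:(lra) ltac:(lra) ltac:(lra).
  rewrite -Ex -Ey => k4 k3 k2 k1.
  apply: (le_trans (cabsD _ _)).
  apply: (le_trans (lerD (cabsD _ _) (cabsD _ _))).
  by rewrite !expr_div_n in k1 k2 k3 k4; lra.
- move=> x y; rewrite /w0 /h0 => xP yP.
  have [l hl] := hg x y ltac:(lra) ltac:(lra).
  have [d d0 Hd] := hl e e0; exists d => // x' y' w h w0' h0' x'P y'P whd Q1 Q2 Q3 Q4.
  apply: (rect_integral_cdiff w0' h0' (ltW e0) _ Hd) => //.
  exact: continuous_rectS cg.
Qed.

End RectangleIntegral.

Section Cauchy.
Context {R : realType}.
Implicit Types (f g : R[i] -> R[i]) (x y : R) (a z l : R[i]).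
Local Notation re := (@complex.Re R).
Local Notation im := (@complex.Im R).

Definition divided_difference f a l z : R[i] :=
  if z == a then l else (f z - f a) / (z - a).

Lemma cdiff_divided_difference f a la z l : cdiff f z l -> z != a ->
  cdiff (divided_difference f a la) z ((l - (f z - f a) / (z - a)) / (z - a)).
Proof.
move=> fz za e e0.
have D0 : z - a != 0 by rewrite subr_eq0.
set D := z - a in D0 *; set F := f z - f a.
have mD : 0 < cabs D by rewrite cabs_gt0.
set m := cabs D in mD *.
(* K bounds the coefficients of the two remainders of order h^2, with |D + h| >= m / 2 in the
   denominators; the remainder of f itself contributes (e m / 4) (2 / m) = e / 2. *)
pose K := 2 * cabs l / m ^+ 2 + 2 * cabs F / m ^+ 3.
have K0 : 0 <= K.
  by rewrite addr_ge0// divr_ge0 ?mulr_ge0 ?cabs_ge0// exprn_ge0// ltW.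
have em : 0 < e * m / 4 by rewrite divr_gt0// mulr_gt0.
have [d d0 H] := fz _ em.
have eK : 0 < e / (2 * (K + 1)) by rewrite divr_gt0//; lra.
exists (Num.min d (Num.min (m / 2) (e / (2 * (K + 1))))).
  by rewrite !lt_min d0 eK divr_gt0.
move=> h; rewrite !lt_min => /and3P[/H {}H h1 h2].
have D'0 : m / 2 <= cabs (D + h).
  have := cabs_dist (D + h) h 0; rewrite !subr0.
  by have := cabs_dist D (D + h) 0; rewrite !subr0 opprD addrA subrr sub0r cabsN -/m; lra.
have nD' : D + h != 0 by rewrite -cabs_gt0; lra.
have nza : z + h != a.
  by apply: contra nD' => /eqP E; rewrite /D addrAC E subrr.
rewrite /divided_difference (negPf za) (negPf nza).
have -> : z + h - a = D + h by rewrite /D addrAC.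
rewrite -/D -/F.
have -> : (f (z + h) - f a) / (D + h) - F / D - (l - F / D) / D * h =
  (f (z + h) - f z - l * h) / (D + h)
    - (l * (h * h) / (D * (D + h)) - F * (h * h) / (D * D * (D + h))).
  have -> : f (z + h) - f a = (f (z + h) - f z - l * h) + l * h + F by rewrite /F; ring.
  by field; rewrite D0 nD'.
have hh := cabs_ge0 h.
have iD' : (cabs (D + h))^-1 <= 2 / m.
  by rewrite -[2 / m]invf_div lef_pV2 ?posrE ?divr_gt0//; lra.
have iD'0 : 0 <= (cabs (D + h))^-1 by rewrite invr_ge0 cabs_ge0.
apply: (le_trans (cabsD _ _)); rewrite cabsN.
apply: (le_trans (lerD (lexx _) (cabsD _ _))); rewrite cabsN !cabsM !cabsV !cabsM -/m.
have T1 : cabs (f (z + h) - f z - l * h) / cabs (D + h) <= e / 2 * cabs h.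
  apply: (le_trans (ler_pM (cabs_ge0 _) iD'0 H iD')).
  suff -> : e * m / 4 * cabs h * (2 / m) = e / 2 * cabs h by [].
  by field; rewrite gt_eqF.
have T2 (A B : R) : 0 <= A -> 0 < B ->
    A * (cabs h * cabs h) / (B * cabs (D + h)) <= 2 * A / (B * m) * cabs h * cabs h.
  move=> A0 B0.
  have -> : A * (cabs h * cabs h) / (B * cabs (D + h)) =
      A * (cabs h * cabs h) / B * (cabs (D + h))^-1 by rewrite invfM; ring.
  have -> : 2 * A / (B * m) * cabs h * cabs h = A * (cabs h * cabs h) / B * (2 / m).
    by field; rewrite !gt_eqF.
  by rewrite ler_wpM2l// divr_ge0 ?mulr_ge0// ltW.
have T2a := T2 _ _ (cabs_ge0 l) mD.
have T2b := T2 _ _ (cabs_ge0 F) (mulr_gt0 mD mD).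
have KE : 2 * cabs l / (m * m) * cabs h * cabs h +
    2 * cabs F / (m * m * m) * cabs h * cabs h = K * cabs h * cabs h.
  by rewrite /K; field; rewrite gt_eqF.
have : K * cabs h <= e / 2.
  move: h2; rewrite ltr_pdivlMr; last lra.
  by have := mulr_ge0 K0 hh; nra.
by move=> /(ler_wpM2r hh); lra.
Qed.

Lemma ccont_divided_difference f a l : cdiff f a l ->
  ccont (divided_difference f a l) a.
Proof.
move=> fa e e0; have [d d0 H] := fa e e0; exists d => // h /H {}H.
rewrite /divided_difference eqxx; case: eqP => [_|/eqP ha].
  by rewrite subrr cabs0 ltW.
rewrite addrAC subrr add0r.
have h0 : h != 0 by apply: contra ha => /eqP ->; rewrite addr0.
have -> : (f (a + h) - f a) / h - l = (f (a + h) - f a - l * h) / h.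
  by field.
by rewrite cabsM cabsV ler_pdivrMr// cabs_gt0.
Qed.

Lemma ccont_divided_difference_holo f a l z lz : cdiff f a l -> cdiff f z lz ->
  ccont (divided_difference f a l) z.
Proof.
move=> fa fz; have [->|za] := eqVneq z a; first exact: ccont_divided_difference.
exact: cdiff_ccont (cdiff_divided_difference _ fz za).
Qed.

(** The divided difference is differentiable except at a, where it is continuous. Goursat's theorem
    removes everything but a square of half-side e about a; there the integrand is at most M, so the
    integral is at most 4 M (2e + 2e), which tends to 0 with e. *)
Lemma cauchy_divided_difference f a l x0 x1 y0 y1 :
  x0 < re a < x1 -> y0 < im a < y1 -> holomorphic_rect f x0 x1 y0 y1 ->
  cdiff f a l -> rect_integral (divided_difference f a l) x0 x1 y0 y1 = 0.
Proof.
move=> xa ya hf fa; set g := divided_difference f a l.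
have cg : continuous_rect g x0 x1 y0 y1.
  apply: ccont_continuous_rect => x y xP yP; have [lz fz] := hf x y xP yP.
  exact: ccont_divided_difference_holo fa fz.
have hg x y : x0 <= x <= x1 -> y0 <= y <= y1 -> x +i* y != a ->
    exists l', cdiff g (x +i* y) l'.
  move=> xP yP na; have [lz fz] := hf x y xP yP.
  by eexists; exact: cdiff_divided_difference fz na.
have nre x y : x != re a -> x +i* y != a.
  by apply: contra => /eqP <-.
have nim x y : y != im a -> x +i* y != a.
  by apply: contra => /eqP <-.
have [d d0 H] := ccont_divided_difference fa ltr01.
pose M := cabs l + 1.
have M0 : 0 < M by have := cabs_ge0 l; rewrite /M; lra.
have small e : 0 < e -> x0 < re a - e -> re a + e < x1 -> y0 < im a - e ->
    im a + e < y1 -> 2 * e < d -> cabs (rect_integral g x0 x1 y0 y1) <= 16 * M * e.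
  move=> e0 h1 h2 h3 h4 h5.
  rewrite (@rect_integral_splitx _ g x0 (re a - e)); try lra; last exact: cg.
  rewrite (@goursat _ g x0 (re a - e) y0 y1); try lra; last first.
    by move=> x y xP yP; apply: hg; rewrite ?nre ?lt_eqF//; lra.
  rewrite add0r (@rect_integral_splitx _ g (re a - e) (re a + e)); try lra; last first.
    by apply: continuous_rectS cg; lra.
  rewrite (@goursat _ g (re a + e) x1 y0 y1); try lra; last first.
    by move=> x y xP yP; apply: hg; rewrite ?nre ?gt_eqF//; lra.
  rewrite addr0 (@rect_integral_splity _ g _ _ y0 (im a - e)); try lra; last first.
    by apply: continuous_rectS cg; lra.
  rewrite (@goursat _ g _ _ y0 (im a - e)); try lra; last first.
    by move=> x y xP yP; apply: hg; rewrite ?nim ?lt_eqF//; lra.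
  rewrite add0r (@rect_integral_splity _ g _ _ (im a - e) (im a + e)); try lra; last first.
    by apply: continuous_rectS cg; lra.
  rewrite (@goursat _ g _ _ (im a + e) y1); try lra; last first.
    by move=> x y xP yP; apply: hg; rewrite ?nim ?gt_eqF//; lra.
  rewrite addr0.
  have hx : re a - e <= re a + e by lra.
  have hy : im a - e <= im a + e by lra.
  apply: (le_trans (@cabs_rect_integral_le _ _ _ _ _ _ M _ _ _ _)) => //.
  - by apply: continuous_rect_boundary => //; apply: continuous_rectS cg; lra.
  - move=> z /(rect_boundary_sub hx hy)[zx zy].
    have := H (z - a); rewrite [a + _]addrC subrK /g {2}/divided_difference eqxx.
    have k : cabs (z - a) < d.
      apply: (le_lt_trans (cabs_le_ReIm _)).
      rewrite -ReB -ImB; apply: le_lt_trans h5.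
      by rewrite mulrC mulr_natr mulr2n lerD// ler_norml; lra.
    move=> /(_ k) k'; have := cabs_dist (divided_difference f a l z) l 0.
    by rewrite !subr0 /M; lra.
  - by have := mulr_ge0 (ltW M0) (ltW e0); nra.
apply/eqP; rewrite -cabs_eq0 eq_le cabs_ge0 andbT leNgt; apply/negP => I0.
set I := cabs _ in small I0.
pose e0 := Num.min (Num.min (re a - x0) (x1 - re a))
  (Num.min (Num.min (im a - y0) (y1 - im a)) (Num.min d (I / (16 * M)))).
have e00 : 0 < e0.
  rewrite /e0 !lt_min d0 divr_gt0 ?mulr_gt0// !subr_gt0.
  by move: xa ya => /andP[-> ->] /andP[-> ->].
have : e0 <= e0 by [].
rewrite {2}/e0 !le_min => /and3P[/andP[k1 k2] /andP[k3 k4] /andP[k5]].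
rewrite ler_pdivlMr ?mulr_gt0// => k6.
have e20 : 0 < e0 / 4 by lra.
by have := small _ e20 ltac:(lra) ltac:(lra) ltac:(lra) ltac:(lra) ltac:(lra); nra.
Qed.

End Cauchy.

(** * Winding integral and Lipschitz bound from Cauchy's formula *)

Section CauchyEstimates.
Context {R : realType}.
Implicit Types (f g : R[i] -> R[i]) (x y : R) (a z l : R[i]).
Local Notation re := (@complex.Re R).
Local Notation im := (@complex.Im R).
Local Notation mu := (@lebesgue_measure R).

Lemma Rintegral_itv_ge (a b : R) (f : R -> R) m : a <= b ->
  mu.-integrable `[a, b] (EFin \o f) -> (forall t, a <= t <= b -> m <= f t) ->
  m * (b - a) <= \int[mu]_(t in `[a, b]) f t.
Proof.
move=> ab fi fm.
have -> : m * (b - a) = \int[mu]_(t in `[a, b]) m.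
  by rewrite Rintegral_cst//= itv_measure.
apply: le_Rintegral => //.
apply: continuous_compact_integrable; first exact: segment_compact.
by move=> ?; exact: cvg_cst.
Qed.

Lemma Re_line_integral_ge (a b : R) (phi : R -> R[i]) m : a <= b ->
  path_continuous a b phi -> (forall t, a <= t <= b -> m <= re (phi t)) ->
  m * (b - a) <= re (line_integral a b phi).
Proof.
by move=> ab cphi fm; apply: Rintegral_itv_ge => //; exact: Re_path_integrable.
Qed.

Lemma Im_line_integral_ge (a b : R) (phi : R -> R[i]) m : a <= b ->
  path_continuous a b phi -> (forall t, a <= t <= b -> m <= im (phi t)) ->
  m * (b - a) <= im (line_integral a b phi).
Proof.
by move=> ab cphi fm; apply: Rintegral_itv_ge => //; exact: Im_path_integrable.
Qed.

(** Each side may move independently in a strip of width r / 2. This freedom is what later turns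
    integrals over sides into integrals over area. *)
Definition rect_around z r x0 x1 y0 y1 :=
  [/\ r / 2 <= re z - x0 <= r, r / 2 <= x1 - re z <= r,
      r / 2 <= im z - y0 <= r & r / 2 <= y1 - im z <= r].

Lemma cabs_ge_ReIm (z : R[i]) m : (m <= `|re z|) || (m <= `|im z|) -> m <= cabs z.
Proof.
by case/orP => h; [apply: le_trans (Re_le_cabs z)|apply: le_trans (Im_le_cabs z)].
Qed.

Lemma rect_around_boundary z r x0 x1 y0 y1 ze : 0 < r ->
  rect_around z r x0 x1 y0 y1 -> rect_boundary x0 x1 y0 y1 ze ->
  r / 2 <= cabs (ze - z) /\ `|re ze - re z| <= r /\ `|im ze - im z| <= r.
Proof.
move=> r0 [h1 h2 h3 h4] hz; split; last first.
  have [] := rect_boundary_sub _ _ hz; try lra.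
  by move=> zx zy; rewrite !ler_norml; split; lra.
apply: cabs_ge_ReIm; rewrite -ReB -ImB.
case: hz => -[_ []->]; apply/orP; [right|right|left|left]; rewrite ler_normr; apply/orP;
  solve [left; lra|right; lra].
Qed.

Lemma rect_around_inv_continuous z r x0 x1 y0 y1 : 0 < r ->
  rect_around z r x0 x1 y0 y1 ->
  boundary_continuous (fun ze => (ze - z)^-1) x0 x1 y0 y1.
Proof.
move=> r0 hz; apply: ccont_boundary_continuous => ze /(rect_around_boundary r0 hz)[h _].
apply: (@ccontV _ (fun ze => ze - z)); last by rewrite -cabs_gt0; lra.
by apply: ccontB; [exact: ccont_id|exact: ccont_cst].
Qed.

Lemma invc_coord (u v : R) : (u +i* v)^-1 =
  (u / (u ^+ 2 + v ^+ 2)) +i* (- v / (u ^+ 2 + v ^+ 2)).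
Proof. by rewrite /GRing.inv /= mulNr. Qed.

Lemma Im_rect_integral g x0 x1 y0 y1 : im (rect_integral g x0 x1 y0 y1) =
  im (line_integral x0 x1 (fun x => g (x +i* y0))) -
  im (line_integral x0 x1 (fun x => g (x +i* y1))) +
  (re (line_integral y0 y1 (fun y => g (x1 +i* y))) -
   re (line_integral y0 y1 (fun y => g (x0 +i* y)))).
Proof. by rewrite /rect_integral /= mul0r add0r mul1r. Qed.

Lemma Re_opp1 (c : R[i]) : re (-1 * c) = - re c.
Proof. by rewrite mulN1r; case: c. Qed.

Lemma Im_opp1 (c : R[i]) : im (-1 * c) = - im c.
Proof. by rewrite mulN1r; case: c. Qed.

(* The integral is 2 pi i; a lower bound of its modulus suffices here, and avoids
   its evaluation. *)
Lemma winding_ge1 z r x0 x1 y0 y1 : 0 < r -> rect_around z r x0 x1 y0 y1 ->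
  1 <= cabs (rect_integral (fun ze => (ze - z)^-1) x0 x1 y0 y1).
Proof.
move=> r0 hz; have [c1 c2 c3 c4] := rect_around_inv_continuous r0 hz.
apply: cabs_ge_ReIm; apply/orP; right; rewrite ler_normr; apply/orP; left.
case: hz => h1 h2 h3 h4.
set a := re z in h1 h2; set b := im z in h3 h4.
have E x y : ((x +i* y) - z)^-1 =
    ((x - a) / ((x - a) ^+ 2 + (y - b) ^+ 2)) +i*
    (- (y - b) / ((x - a) ^+ 2 + (y - b) ^+ 2)).
  by rewrite -invc_coord /a /b; congr (_^-1); case: (z) => ? ?; simpc.
(* On each side the component of 1 / (ze - z) that matters has constant sign and modulus at least (r
   / 2) / (2 r^2) = 1 / (4 r). Each side is at least r long, so each of the four contributes 1 /
   4. *)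
have bd u v : r / 2 <= u <= r -> `|v| <= r ->
    1 / (4 * r) <= u / (u ^+ 2 + v ^+ 2) /\ 1 / (4 * r) <= u / (v ^+ 2 + u ^+ 2).
  move=> ur vr; rewrite [v ^+ 2 + _]addrC.
  suff : 1 / (4 * r) <= u / (u ^+ 2 + v ^+ 2) by split.
  have u2 : u ^+ 2 <= r ^+ 2 by nra.
  have v2 : v ^+ 2 <= r ^+ 2.
    by rewrite -(real_normK (num_real v)) lerXn2r ?nnegrE// ltW.
  have v20 := sqr_ge0 v.
  have u20 : 0 < u ^+ 2 by rewrite exprn_gt0//; lra.
  rewrite ler_pdivrMr; last lra.
  rewrite mulrAC ler_pdivlMr; last lra.
  by rewrite mul1r; nra.
have mr : 0 <= 1 / (4 * r) by rewrite divr_ge0//; lra.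
have lenx : r <= x1 - x0 by lra.
have leny : r <= y1 - y0 by lra.
have quarter L : r <= L -> 1 / 4 <= 1 / (4 * r) * L.
  by move=> rL; rewrite mulrAC ler_pdivlMr; lra.
have k1 : 1 / 4 <= im (line_integral x0 x1 (fun x => ((x +i* y0) - z)^-1)).
  apply: le_trans (Im_line_integral_ge _ c1 (m := 1 / (4 * r)) _); [exact: quarter|lra|].
  move=> t tP; rewrite E /= opprB -[(y0 - b) ^+ 2]sqrrN opprB.
  by apply: (bd _ _ _ _).2; rewrite ?ler_norml; lra.
have k2 : 1 / 4 <= im (line_integral x0 x1 (fun x => -1 * ((x +i* y1) - z)^-1)).
  apply: le_trans (Im_line_integral_ge _ _ (m := 1 / (4 * r)) _); [exact: quarter|lra| |].
    exact: path_continuousZ.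
  move=> t tP; rewrite E /= !mulN1r !oppr0 mul0r addr0 mulNr opprK.
  by apply: (bd _ _ _ _).2; rewrite ?ler_norml; lra.
have k3 : 1 / 4 <= re (line_integral y0 y1 (fun y => -1 * ((x0 +i* y) - z)^-1)).
  apply: le_trans (Re_line_integral_ge _ _ (m := 1 / (4 * r)) _); [exact: quarter|lra| |].
    exact: path_continuousZ.
  move=> t tP; rewrite E /= !mulN1r !oppr0 mul0r subr0 -mulNr opprB.
  rewrite -[(x0 - a) ^+ 2]sqrrN opprB.
  by apply: (bd _ _ _ _).1; rewrite ?ler_norml; lra.
have k4 : 1 / 4 <= re (line_integral y0 y1 (fun y => ((x1 +i* y) - z)^-1)).
  apply: le_trans (Re_line_integral_ge _ c4 (m := 1 / (4 * r)) _); [exact: quarter|lra|].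
  move=> t tP; rewrite E /=.
  by apply: (bd _ _ _ _).1; rewrite ?ler_norml; lra.
rewrite line_integralZ// Im_opp1 in k2; rewrite line_integralZ// Re_opp1 in k3.
rewrite Im_rect_integral; lra.
Qed.

Definition holomorphic_square f z r :=
  holomorphic_rect f (re z - r) (re z + r) (im z - r) (im z + r).

Lemma holomorphic_square_center f z r : 0 < r -> holomorphic_square f z r ->
  exists l, cdiff f z l.
Proof.
by case: z => a b r0 /(_ a b) /=; apply; lra.
Qed.

Lemma square_boundary_around z r : 0 < r ->
  rect_around z r (re z - r) (re z + r) (im z - r) (im z + r).
Proof. by move=> r0; split; lra. Qed.

(* The Cauchy integrals of [f] at [a] and at [z], both written with the winding
   integral around [z]: subtracting the vanishing integrals of the two divided
   differences leaves a kernel with the factor [a - z]. *)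
Lemma lipschitz_of_bounded f z r M a : 0 < r -> holomorphic_square f z r ->
  (forall ze, `|re ze - re z| <= r -> `|im ze - im z| <= r -> cabs (f ze) <= M) ->
  cabs (a - z) <= r / 4 -> cabs (f a - f z) <= 256 * M / r * cabs (a - z).
Proof.
move=> r0 hf fM az.
have [rea ima] : `|re a - re z| <= r / 4 /\ `|im a - im z| <= r / 4.
  by rewrite ReB ImB; split; apply: le_trans az; [exact: Re_le_cabs|exact: Im_le_cabs].
have fin ze : `|re ze - re z| <= r -> `|im ze - im z| <= r -> exists l, cdiff f ze l.
  by case: ze => x y /=; rewrite !ler_norml => ? ?; apply: hf; lra.
have [la fa] := fin a ltac:(lra) ltac:(lra).
have [lz fz] := holomorphic_square_center r0 hf.
rewrite !ler_norml in rea ima.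
have Ia := cauchy_divided_difference _ _ hf fa.
have Iz := cauchy_divided_difference _ _ hf fz.
have {}Ia := Ia ltac:(lra) ltac:(lra).
have {}Iz := Iz ltac:(lra) ltac:(lra).
have az' := square_boundary_around z r0.
have W1 := winding_ge1 r0 az'.
have cW := rect_around_inv_continuous r0 az'.
set x0 := re z - r in Ia Iz az' W1 cW *; set x1 := re z + r in Ia Iz az' W1 cW *.
set y0 := im z - r in Ia Iz az' W1 cW *; set y1 := im z + r in Ia Iz az' W1 cW *.
have bnd ze : rect_boundary x0 x1 y0 y1 ze ->
    [/\ r / 2 <= cabs (ze - z), r / 4 <= cabs (ze - a), cabs (f ze) <= M & ccont f ze].
  move=> /(rect_around_boundary r0 az')[h1 [h2 h3]]; split => //.
  - by have := cabs_dist ze a z; lra.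
  - exact: fM.
  - by have [l /cdiff_ccont] := fin _ h2 h3.
pose G ze := (f ze - f a) * ((ze - a) * (ze - z))^-1.
have nz ze : rect_boundary x0 x1 y0 y1 ze -> ze - a != 0 /\ ze - z != 0.
  by move=> /bnd[h1 h2 _ _]; rewrite -!cabs_gt0; split; lra.
have cG : boundary_continuous G x0 x1 y0 y1.
  apply: ccont_boundary_continuous => ze hz; have [_ _ _ cf] := bnd ze hz.
  have [n1 n2] := nz ze hz.
  apply: ccontM; first by apply: ccontB => //; exact: ccont_cst.
  apply: (@ccontV _ (fun ze => (ze - a) * (ze - z))); last by rewrite mulf_neq0.
  by apply: ccontM; apply: ccontB; (exact: ccont_id || exact: ccont_cst).
have cq b lb : cdiff f b lb ->
    boundary_continuous (divided_difference f b lb) x0 x1 y0 y1.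
  move=> fb; apply: ccont_boundary_continuous => ze hz.
  have [h1 [h2 h3]] := rect_around_boundary r0 az' hz.
  by have [l fl] := fin _ h2 h3; exact: ccont_divided_difference_holo fb fl.
have key : (f z - f a) * rect_integral (fun ze => (ze - z)^-1) x0 x1 y0 y1 =
    (z - a) * rect_integral G x0 x1 y0 y1.
  apply/eqP; rewrite -subr_eq0 -!rect_integralZ//.
  rewrite -rect_integralB; [|exact: boundary_continuousZ..].
  have := rect_integralB (cq _ _ fa) (cq _ _ fz).
  rewrite Ia Iz subrr => I0; rewrite -[X in _ == X]I0; apply/eqP.
  apply: eq_rect_integral => ze hz; have [n1 n2] := nz ze hz.
  rewrite /divided_difference.
  rewrite -subr_eq0 (negPf n1) -subr_eq0 (negPf n2) /G.
  by field; rewrite n1 n2.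
have M0 : 0 <= M by apply: le_trans (fM z _ _); rewrite ?cabs_ge0// subrr normr0 ltW.
(* On the boundary the numerator is at most 2 M and the distances to a and z are at least r / 4 and
   r / 2. With sides of length 2 r the contour bound becomes 4 (16 M / r^2) (4 r) = 256 M / r. *)
have GM ze : rect_boundary x0 x1 y0 y1 ze -> cabs (G ze) <= 16 * M / r ^+ 2.
  move=> /bnd[h1 h2 h3 _]; rewrite /G cabsM cabsV cabsM.
  have d1 : cabs (f ze - f a) <= 2 * M.
    rewrite (le_trans (cabsD _ _))// cabsN.
    by have := fM a ltac:(rewrite ler_norml; lra) ltac:(rewrite ler_norml; lra); lra.
  have d2 : r ^+ 2 / 8 <= cabs (ze - a) * cabs (ze - z) by nra.
  have d3 : 0 < r ^+ 2 by rewrite exprn_gt0.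
  rewrite ler_pdivrMr; last lra.
  apply: (le_trans d1); rewrite mulrAC ler_pdivlMr//.
  by have := ler_wpM2l M0 d2; lra.
have IG := cabs_rect_integral_le (ltac:(rewrite /x0 /x1; lra) : x0 <= x1)
  (ltac:(rewrite /y0 /y1; lra) : y0 <= y1) cG GM.
have {}IG : cabs (rect_integral G x0 x1 y0 y1) <= 256 * M / r.
  apply: (le_trans IG); rewrite /x0 /x1 /y0 /y1 le_eqVlt; apply/orP; left; apply/eqP.
  by field; rewrite gt_eqF.
rewrite cabsB; have := congr1 cabs key; rewrite !cabsM => {}key.
have h1 : cabs (f z - f a) <= cabs (z - a) * cabs (rect_integral G x0 x1 y0 y1).
  by rewrite -key ler_peMr// cabs_ge0.
apply: (le_trans h1); rewrite mulrC (cabsB z); apply: ler_wpM2r => //.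
exact: cabs_ge0.
Qed.

End CauchyEstimates.

(** * Local estimates for analytic functions *)

Section L1Estimate.
Context {R : realType}.
Implicit Types (f g : R[i] -> R[i]).
Local Notation re := (@complex.Re R).
Local Notation im := (@complex.Im R).
Local Notation mu := (@lebesgue_measure R).

Definition square (z : R[i]) (r : R) : set (R * R) :=
  `[re z - r, re z + r] `*` `[im z - r, im z + r].

Lemma measurable_square z r : measurable (square z r).
Proof. exact: measurableX. Qed.

Lemma squareP z r p : square z r p <->
  `|re (cplx p) - re z| <= r /\ `|im (cplx p) - im z| <= r.
Proof.
rewrite /square /= !in_itv /= !ler_distl.
by split=> -[/andP[? ?] /andP[? ?]]; split; apply/andP; split; lra.
Qed.

Lemma le_line_integral a b (phi : R -> R[i]) (K : R -> \bar R) c : 0 <= c ->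
  path_continuous a b phi -> measurable_fun setT K -> (forall t, 0 <= K t)%E ->
  (forall t, a <= t <= b -> ((cabs (phi t))%:E <= c%:E * K t)%E) ->
  ((cabs (line_integral a b phi))%:E <= (2 * c)%:E * \int[mu]_t K t)%E.
Proof.
move=> c0 cphi mK K0 hK; apply: (le_trans (cabs_line_integral cphi)).
rewrite EFinM -muleA; apply: lee_wpmul2l; first by rewrite lee_fin.
rewrite -ge0_integralZl//=.
rewrite integral_mkcond; apply: ge0_le_integral => //.
- by move=> t _; rewrite patchE; case: ifP => //; rewrite lee_fin cabs_ge0.
- apply/(measurable_restrictT _ _).1 => //.
  by apply/measurable_EFinP; exact: measurable_cabs_path.
- exact: measurable_funeM.
- move=> t _; rewrite patchE; case: ifPn => [|_]; last by rewrite mule_ge0.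
  by rewrite inE /= in_itv /=; exact: hK.
Qed.

(** Averaging c <= h x + K over x in [a, b] replaces the slice h x by its mean. The cases K = +oo
    and c <= k are set apart because K has to be subtracted and the difference integrated as a
    nonnegative constant. *)
Lemma strip_average (a b c : R) (h : R -> \bar R) (K T : \bar R) : a < b ->
  measurable_fun setT h -> (forall x, 0 <= h x)%E ->
  (\int[mu]_x h x <= T)%E -> (0 <= K)%E ->
  (forall x, a <= x <= b -> (c%:E <= h x + K)%E) ->
  (c%:E <= ((b - a)^-1)%:E * T + K)%E.
Proof.
move=> ab mh h0 hT K0 hK.
have L0 : 0 < b - a by lra.
have T0 : (0 <= T)%E by apply: le_trans hT; apply: integral_ge0.
have A0 : (0 <= ((b - a)^-1)%:E * T)%E by rewrite mule_ge0// lee_fin invr_ge0 ltW.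
case: K K0 hK => [k| |//] K0 hK; last first.
  by rewrite addey ?leey// -ltNye (lt_le_trans _ A0).
have [ck|ck] := leP c k.
  apply: (@le_trans _ _ k%:E); first by rewrite lee_fin.
  by rewrite leeDr// mule_ge0// lee_fin invr_ge0 ltW.
rewrite -leeBlDr// -EFinB muleC lee_pdivlMr//.
apply: le_trans hT.
apply: (@le_trans _ _ (\int[mu]_(x in `[a, b]) h x)%E); last first.
  by apply: ge0_subset_integral.
have -> : ((c - k)%:E * (b - a)%:E)%E = (\int[mu]_(x in `[a, b]) (cst (c - k)%:E x))%E.
  by rewrite integral_cst//= itv_measure// ltW.
apply: ge0_le_integral => //.
- by move=> x _ /=; rewrite lee_fin; lra.
- exact: measurable_funTS.
- by move=> x; rewrite /= in_itv /= => /hK; rewrite EFinB leeBlDr.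
Qed.

Lemma dA_tonelli1 (G : R * R -> \bar R) : measurable_fun setT G ->
  (forall p, 0 <= G p)%E ->
  (\int[dA]_p G p = \int[mu]_x \int[mu]_y G (x, y))%E.
Proof. by move=> mG G0; rewrite /dA (@fubini_tonelli1 _ _ _ _ R mu mu G). Qed.

Lemma dA_tonelli2 (G : R * R -> \bar R) : measurable_fun setT G ->
  (forall p, 0 <= G p)%E ->
  (\int[dA]_p G p = \int[mu]_y \int[mu]_x G (x, y))%E.
Proof. by move=> mG G0; rewrite /dA (@fubini_tonelli2 _ _ _ _ R mu mu G). Qed.

(** A mean value inequality without circles: Cauchy's formula holds on every rectangle with sides in
    the four strips about z, and averaging over the positions of the four sides gives an integral
    over the square. *)
Lemma cabs_le_square_average f z r : 0 < r -> holomorphic_square f z r ->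
  measurable_fun (square z r) (fun p => cabs (f (cplx p))) ->
  ((cabs (f z))%:E <=
   (32 / r ^+ 2)%:E * \int[dA]_(p in square z r) (cabs (f (cplx p)))%:E)%E.
Proof.
move=> r0 hf mf.
pose G := (fun p => (cabs (f (cplx p)))%:E) \_ (square z r).
have mG : measurable_fun setT G.
  apply/(measurable_restrictT _ _).1; first exact: measurable_square.
  exact/measurable_EFinP.
have G0 p : (0 <= G p)%E.
  by rewrite /G patchE; case: ifP => //; rewrite lee_fin cabs_ge0.
have GE p : square z r p -> G p = (cabs (f (cplx p)))%:E.
  by move=> h; rewrite /G patchE mem_set.
rewrite integral_mkcond -/G; set T := (\int[dA]_p G p)%E.
pose h x := (\int[mu]_y G (x, y))%E.
pose k y := (\int[mu]_x G (x, y))%E.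
have hT : (\int[mu]_x h x <= T)%E.
  by rewrite /T dA_tonelli1.
have kT : (\int[mu]_y k y <= T)%E.
  by rewrite /T dA_tonelli2.
have mh : measurable_fun setT h.
  exact: (@measurable_fun_fubini_tonelli_F _ _ _ _ R mu G).
have mk : measurable_fun setT k.
  exact: (@measurable_fun_fubini_tonelli_G _ _ _ _ R mu G).
have h0 x : (0 <= h x)%E by apply: integral_ge0.
have k0 y : (0 <= k y)%E by apply: integral_ge0.
have [lz fz] := holomorphic_square_center r0 hf.
(* Cauchy's formula, with the winding integral at least 1. On the boundary 1 / |ze - z| <= 2 / r,
   and the line integral bound doubles this to 4 / r, whence the r / 4 on the left. [h] and [k] are
   the vertical and horizontal slices of |f| over the square. *)
have bound x0 x1 y0 y1 : rect_around z r x0 x1 y0 y1 ->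
    ((cabs (f z) * (r / 4))%:E <= h x0 + (h x1 + (k y0 + k y1)))%E.
  move=> hz.
  have hz' := hz; case: hz' => r1 r2 r3 r4.
  have fin ze : `|re ze - re z| <= r -> `|im ze - im z| <= r -> exists l, cdiff f ze l.
    by case: ze => x y /=; rewrite !ler_norml => ? ?; apply: hf; lra.
  have cW := rect_around_inv_continuous r0 hz.
  have I0 := @cauchy_divided_difference _ f z lz x0 x1 y0 y1 _ _ _ fz.
  have {}I0 : rect_integral (divided_difference f z lz) x0 x1 y0 y1 = 0.
    by apply: I0; [lra|lra|move=> x y xP yP; apply: hf; lra].
  pose g ze := f ze * (ze - z)^-1.
  have cg : boundary_continuous g x0 x1 y0 y1.
    apply: ccont_boundary_continuous => ze /(rect_around_boundary r0 hz)[n1 [n2 n3]].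
    apply: ccontM; first by have [l /cdiff_ccont] := fin _ n2 n3.
    apply: (@ccontV _ (fun ze => ze - z)); last by rewrite -cabs_gt0; lra.
    by apply: ccontB; [exact: ccont_id|exact: ccont_cst].
  have key : f z * rect_integral (fun ze => (ze - z)^-1) x0 x1 y0 y1 =
      rect_integral g x0 x1 y0 y1.
    apply/esym/eqP; rewrite -subr_eq0 -rect_integralZ// -rect_integralB//; last first.
      exact: boundary_continuousZ.
    apply/eqP; rewrite -[RHS]I0; apply: eq_rect_integral => ze.
    move=> /(rect_around_boundary r0 hz)[n1 _].
    rewrite /divided_difference -subr_eq0 ifF; first by rewrite /g mulrBl.
    by apply/negbTE; rewrite -cabs_gt0; lra.
  have W1 := winding_ge1 r0 hz.
  have fI : cabs (f z) <= cabs (rect_integral g x0 x1 y0 y1).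
    by rewrite -key cabsM ler_peMr// cabs_ge0.
  have gb ze : rect_boundary x0 x1 y0 y1 ze ->
      ((cabs (g ze))%:E <= (2 / r)%:E * (cabs (f ze))%:E)%E.
    move=> /(rect_around_boundary r0 hz)[n1 _]; rewrite -EFinM lee_fin /g cabsM cabsV.
    rewrite mulrC ler_wpM2r ?cabs_ge0// -[2 / r]invf_div lef_pV2 ?posrE ?divr_gt0//; lra.
  have r20 : 0 <= 2 / r by rewrite divr_ge0// ltW.
  have mG1 x : measurable_fun setT (fun y => G (x, y)) by exact: measurableT_comp.
  have mG2 y : measurable_fun setT (fun x => G (x, y)) by exact: measurableT_comp.
  have sq x y : re z - r <= x <= re z + r -> im z - r <= y <= im z + r ->
      G (x, y) = (cabs (f (x +i* y)))%:E.
    by move=> ? ?; rewrite GE//; split; rewrite /= in_itv.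
  have [c1 c2 c3 c4] := cg.
  have s1 : ((cabs (line_integral x0 x1 (fun x => g (x +i* y0))))%:E <=
      (2 * (2 / r))%:E * k y0)%E.
    apply: le_line_integral => // t tP; rewrite sq; [|lra|lra].
    by apply: gb; left; split=> //; left.
  have s2 : ((cabs (line_integral x0 x1 (fun x => g (x +i* y1))))%:E <=
      (2 * (2 / r))%:E * k y1)%E.
    apply: le_line_integral => // t tP; rewrite sq; [|lra|lra].
    by apply: gb; left; split=> //; right.
  have s3 : ((cabs (line_integral y0 y1 (fun y => g (x0 +i* y))))%:E <=
      (2 * (2 / r))%:E * h x0)%E.
    apply: le_line_integral => // t tP; rewrite sq; [|lra|lra].
    by apply: gb; right; split=> //; left.
  have s4 : ((cabs (line_integral y0 y1 (fun y => g (x1 +i* y))))%:E <=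
      (2 * (2 / r))%:E * h x1)%E.
    apply: le_line_integral => // t tP; rewrite sq; [|lra|lra].
    by apply: gb; right; split=> //; right.
  have r40 : (0 <= (r / 4)%:E)%E by rewrite lee_fin; lra.
  have sc (A : R) (B : \bar R) : (A%:E <= (2 * (2 / r))%:E * B)%E -> ((A * (r / 4))%:E <= B)%E.
    move=> AB; rewrite EFinM muleC.
    apply: (le_trans (lee_wpmul2l r40 AB)); rewrite muleA -EFinM.
    by rewrite (_ : r / 4 * _ = 1) ?mul1e//; field; rewrite gt_eqF.
  have {s1 s2 s3 s4}[s1 s2 s3 s4] := And4 (sc _ _ s1) (sc _ _ s2) (sc _ _ s3) (sc _ _ s4).
  apply: le_trans (leeD s3 (leeD s4 (leeD s1 s2))).
  rewrite -!EFinD lee_fin -!mulrDl ler_wpM2r//.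
  apply: (le_trans fI); rewrite /rect_integral.
  apply: (le_trans (cabsD _ _)); rewrite cabsM cabs_i mul1r.
  apply: (le_trans (lerD (cabsD _ _) (cabsD _ _))); rewrite !cabsN; lra.
have T0 : (0 <= T)%E by apply: integral_ge0.
set c := cabs (f z) * (r / 4) in bound.
pose A := (((r / 2)^-1)%:E * T)%E.
have A0 : (0 <= A)%E by rewrite mule_ge0// lee_fin invr_ge0; lra.
(* One side is averaged at a time while the others stay fixed. After four rounds |f z| r / 4 <= 4 A
   = (8 / r) T, that is, the constant 32 / r^2. *)
have avg u v (hh : R -> \bar R) (K : \bar R) : v - u = r / 2 -> measurable_fun setT hh ->
    (forall x, 0 <= hh x)%E -> (\int[mu]_x hh x <= T)%E -> (0 <= K)%E ->
    (forall x, u <= x <= v -> (c%:E <= hh x + K)%E) -> (c%:E <= A + K)%E.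
  move=> uv; rewrite /A -uv; apply: strip_average.
  by rewrite -subr_gt0 uv; lra.
have b1 x1 y0 y1 : r / 2 <= x1 - re z <= r -> r / 2 <= im z - y0 <= r ->
    r / 2 <= y1 - im z <= r -> (c%:E <= A + (h x1 + (k y0 + k y1)))%E.
  move=> H1 H2 H3; apply: (@avg (re z - r) (re z - r / 2) h) => //; first by field.
    exact: adde_ge0 (h0 _) (adde_ge0 (k0 _) (k0 _)).
  by move=> x xP; apply: bound; split => //; lra.
have b2 y0 y1 : r / 2 <= im z - y0 <= r ->
    r / 2 <= y1 - im z <= r -> (c%:E <= A + (A + (k y0 + k y1)))%E.
  move=> H2 H3; apply: (@avg (re z + r / 2) (re z + r) h) => //; first by field.
    exact: adde_ge0 A0 (adde_ge0 (k0 _) (k0 _)).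
  by move=> x xP; rewrite addeCA; apply: b1 => //; lra.
have b3 y1 : r / 2 <= y1 - im z <= r -> (c%:E <= A + (A + (A + k y1)))%E.
  move=> H3; apply: (@avg (im z - r) (im z - r / 2) k) => //; first by field.
    exact: adde_ge0 A0 (adde_ge0 A0 (k0 _)).
  move=> y yP; rewrite addeCA [X in (_ <= _ + X)%E]addeCA; apply: b2 => //; lra.
have b4 : (c%:E <= A + (A + (A + A)))%E.
  apply: (@avg (im z + r / 2) (im z + r) k) => //; first by field.
    exact: adde_ge0 A0 (adde_ge0 A0 A0).
  move=> y yP; rewrite addeC -!addeA; apply: b3; lra.
have {}b4 : (c%:E <= (8 / r)%:E * T)%E.
  have dist (u v : R) : 0 <= u -> 0 <= v ->
      (u%:E * T + v%:E * T = (u + v)%:E * T)%E.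
    by move=> u0 v0; rewrite EFinD ge0_muleDl.
  have i0 : 0 <= (r / 2)^-1 by rewrite invr_ge0; lra.
  apply: (le_trans b4); rewrite /A !dist ?addr_ge0//.
  suff -> : (r / 2)^-1 + ((r / 2)^-1 + ((r / 2)^-1 + (r / 2)^-1)) = 8 / r by [].
  by field; rewrite gt_eqF.
have r4 : (0 <= (4 / r)%:E)%E by rewrite lee_fin divr_ge0// ltW.
have := lee_wpmul2l r4 b4; rewrite muleA -!EFinM.
rewrite (_ : 4 / r * c = cabs (f z)); last by rewrite /c; field; rewrite gt_eqF.
by rewrite (_ : 4 / r * (8 / r) = 32 / r ^+ 2)//; field; rewrite gt_eqF.
Qed.

End L1Estimate.

(** * Borel measurability in real coordinates *)

Section Measurability.
Context {R : realType}.
Implicit Types (f g : R[i] -> R[i]).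
Local Notation re := (@complex.Re R).
Local Notation im := (@complex.Im R).

(** An open set is the union of the rational boxes that it contains; boxes not contained in U are
    replaced by the empty set, so that the union runs over all quadruples of rationals. *)
Lemma open_box_measurable (U : set (R * R)) :
  (forall p, U p -> exists2 d : R, 0 < d & forall p' : R * R,
     `|p'.1 - p.1| < d -> `|p'.2 - p.2| < d -> U p') ->
  measurable U.
Proof.
move=> oU.
pose B (a b c e : rat) : set (R * R) :=
  `]ratr a, ratr b[%classic `*` `]ratr c, ratr e[%classic.
pose S a b c e := if `[< B a b c e `<=` U >] then B a b c e else set0.
suff -> : U = \bigcup_a \bigcup_b \bigcup_c \bigcup_e S a b c e.
  do 4 (apply: bigcupT_measurable_rat => ?).
  by rewrite /S; case: ifP => // _; exact: measurableX.
apply/seteqP; split=> [p Up|p [a _ [b _ [c _ [e _]]]]]; last first.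
  by rewrite /S; case: ifP => // /asboolP; exact.
have [d d0 H] := oU p Up.
have [a] : exists q, (ratr q : R) \in `](p.1 - d), p.1[ by apply: rat_in_itvoo; lra.
have [b] : exists q, (ratr q : R) \in `]p.1, (p.1 + d)[ by apply: rat_in_itvoo; lra.
have [c] : exists q, (ratr q : R) \in `](p.2 - d), p.2[ by apply: rat_in_itvoo; lra.
have [e] : exists q, (ratr q : R) \in `]p.2, (p.2 + d)[ by apply: rat_in_itvoo; lra.
rewrite !in_itv /= => he hc hb ha.
exists a => //; exists b => //; exists c => //; exists e => //.
rewrite /S; case: ifPn => [_|/asboolPn]; first by split; rewrite /= in_itv /=; lra.
case=> p' [] /=; rewrite !in_itv /= => h1 h2.
by apply: H; rewrite ltr_norml; lra.
Qed.

(** The points around which phi stays above a form an open set, whatever phi does off D, and inside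
    D this set is exactly the superlevel set. *)
Lemma measurable_fun_ccont (D : set (R * R)) (phi : R * R -> R) :
  (forall p, D p -> forall e : R, 0 < e -> exists2 d : R, 0 < d &
    forall p' : R * R, `|p'.1 - p.1| < d -> `|p'.2 - p.2| < d -> `|phi p' - phi p| <= e) ->
  measurable_fun D phi.
Proof.
move=> cphi mD; apply: (measurability _ (RGenOInfty.measurableE R)) => //.
move=> /= _ [_ [a ->] <-]; rewrite preimage_itvoy.
pose U : set (R * R) := [set p | exists2 d : R, 0 < d & forall p' : R * R,
  `|p'.1 - p.1| < d -> `|p'.2 - p.2| < d -> a < phi p'].
have -> : D `&` [set x | a < phi x] = D `&` U.
  apply/seteqP; split=> p [Dp] /=; last first.
    by move=> [d d0 H]; split => //; apply: H; rewrite subrr normr0.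
  move=> ap; split => //; have ea : 0 < (phi p - a) / 2 by lra.
  have [d d0 H] := cphi p Dp _ ea; exists d => // p' h1 h2.
  by have := H p' h1 h2; rewrite ler_norml; lra.
apply: measurableI => //; apply: open_box_measurable => p [d d0 H].
exists (d / 2); first lra.
move=> q q1 q2; exists (d / 2); first lra.
move=> p' h1 h2; apply: H.
  by have := ler_distD q.1 p'.1 p.1; lra.
by have := ler_distD q.2 p'.2 p.2; lra.
Qed.

Lemma ccont_measurable (D : set (R * R)) (g : R[i] -> R) f :
  (forall z z', g z - g z' = g (z - z')) -> (forall z, `|g z| <= cabs z) ->
  (forall p, D p -> ccont f (cplx p)) ->
  measurable_fun D (fun p => g (f (cplx p))).
Proof.
move=> gB gle cf; apply: measurable_fun_ccont => p /cf cfp e e0.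
have [d d0 H] := cfp e e0; exists (d / 2); first lra.
move=> p' h1 h2; rewrite gB (le_trans (gle _))//.
have := H (cplx p' - cplx p); rewrite [cplx p + _]addrC subrK; apply.
apply: (le_lt_trans (cabs_le_ReIm _)).
by rewrite /cplx -ReB -ImB /=; lra.
Qed.

Lemma measurable_cabs (di : measure_display) (T : measurableType di)
  (D : set T) (F : T -> R[i]) :
  measurable_fun D (fun p => re (F p)) -> measurable_fun D (fun p => im (F p)) ->
  measurable_fun D (fun p => cabs (F p)).
Proof.
move=> mr mi.
have -> : (fun p => cabs (F p)) =
    (fun p => (Num.sqrt : R -> R) (re (F p) ^+ 2 + im (F p) ^+ 2)).
  by apply/funext => p; case: (F p).
apply: measurableT_comp.
  by apply: continuous_measurable_fun; exact: sqrt_continuous.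
by apply: measurable_funD; exact: measurable_funX.
Qed.

Lemma ccont_measurable_cabs (D : set (R * R)) f :
  (forall p, D p -> ccont f (cplx p)) ->
  measurable_fun D (fun p => cabs (f (cplx p))).
Proof.
move=> cf; apply: (measurable_cabs (F := fun p => f (cplx p))).
- by apply: ccont_measurable => //; [exact: ReB|exact: Re_le_cabs].
- by apply: ccont_measurable => //; [exact: ImB|exact: Im_le_cabs].
Qed.

Lemma measurable_fun_disc (D : set (R * R)) (c : R[i]) :
  measurable_fun D (fun p => cabs (cplx p - c)).
Proof.
apply: (@ccont_measurable_cabs D (fun z => z - c)) => p _.
by apply: ccontB; [exact: ccont_id|exact: ccont_cst].
Qed.

Lemma measurable_disc (c : R[i]) (r : R) : measurable (cplx @^-1` disc c r).
Proof.
have := @measurable_fun_disc setT c measurableT `]-oo, r[%classic (measurable_itv _).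
rewrite setTI; congr (measurable _); apply/seteqP; split=> p /=;
  by rewrite /disc /= in_itv /=.
Qed.

End Measurability.

(** * Regularity and mean value inequality for the derivative *)

Section Derivative.
Context {R : realType}.
Implicit Types (f F g : R[i] -> R[i]).
Local Notation re := (@complex.Re R).
Local Notation im := (@complex.Im R).

Lemma cdiff_is_derive_part (g : R[i] -> R) f F (a v : R[i]) (t : R) :
  (forall z z', g z - g z' = g (z - z')) -> (forall z, `|g z| <= cabs z) ->
  (forall (x : R) z, g (x%:C * z) = x * g z) ->
  cdiff f (a + t%:C * v) (F (a + t%:C * v)) ->
  is_derive t 1 (fun s => g (f (a + s%:C * v))) (g (F (a + t%:C * v) * v)).
Proof.
move=> gB gle gZ ft.
suff H : (fun h : R => h^-1 *: (((fun s => g (f (a + s%:C * v))) \o shift t) (h *: 1) -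
    g (f (a + t%:C * v)))) @ 0^' --> g (F (a + t%:C * v) * v).
  by split; [apply/cvg_ex; exists (g (F (a + t%:C * v) * v))|exact: cvg_lim].
apply/cvgrPdist_le => e e0.
have v1 : 0 < cabs v + 1 by have := cabs_ge0 v; lra.
have ev : 0 < e / (cabs v + 1) by rewrite divr_gt0.
have [d d0 H] := ft _ ev.
exists (d / (cabs v + 1)); first by rewrite /= divr_gt0.
move=> h; rewrite /ball_ /= sub0r normrN => hd h0.
have hv : cabs (h%:C * v) < d.
  rewrite cabsM cabs_real; move: hd; rewrite ltr_pdivlMr//; apply: le_lt_trans.
  by rewrite ler_wpM2l// lerDl.
have := H _ hv.
have -> : a + t%:C * v + h%:C * v = a + (h *: 1 + t)%:C * v.
  by rewrite /GRing.scale/= mulr1 rmorphD/=; ring.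
move=> {}H; rewrite distrC.
have -> : h^-1 *: (g (f (a + (h *: 1 + t)%:C * v)) - g (f (a + t%:C * v))) -
    g (F (a + t%:C * v) * v) = h^-1 * g (f (a + (h *: 1 + t)%:C * v) -
    f (a + t%:C * v) - F (a + t%:C * v) * (h%:C * v)).
  rewrite -(gB _ (_ * _)) -gB mulrCA gZ /GRing.scale /=.
  by field.
rewrite normrM normfV ler_pdivrMl ?normr_gt0//.
apply: (le_trans (gle _)); apply: (le_trans H).
rewrite cabsM cabs_real mulrCA ler_wpM2l// mulrAC ler_pdivrMr//.
by rewrite mulrDr mulr1 lerDl ltW.
Qed.

Lemma mean_value_part (g : R[i] -> R) f F (a b : R[i]) (M : R) :
  (forall z z', g z - g z' = g (z - z')) -> (forall z, `|g z| <= cabs z) ->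
  (forall (x : R) z, g (x%:C * z) = x * g z) ->
  (forall t : R, 0 <= t <= 1 -> cdiff f (a + t%:C * (b - a)) (F (a + t%:C * (b - a))) /\
     cabs (F (a + t%:C * (b - a))) <= M) ->
  `|g (f b - f a)| <= M * cabs (b - a).
Proof.
move=> gB gle gZ H; set v := b - a in H *.
pose phi s := g (f (a + s%:C * v)).
have dphi (t : R) : 0 <= t <= 1 -> is_derive t 1 phi (g (F (a + t%:C * v) * v)).
  by move=> /H[H1 _]; exact: (cdiff_is_derive_part gB gle gZ H1).
have [||c cP E] := @MVT_segment R phi (fun t => g (F (a + t%:C * v) * v)) 0 1 ler01.
- by move=> x; rewrite in_itv /= => xP; apply: dphi; lra.
- apply: derivable_within_continuous => x; rewrite in_itv /= => /dphi h.
  exact: ex_derive.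
move: cP; rewrite in_itv /= => /H[_ Fc].
have -> : g (f b - f a) = phi 1 - phi 0.
  rewrite /phi rmorph1 rmorph0 mul1r mul0r addr0 -gB.
  by rewrite [a + v]addrC subrK.
by rewrite E subr0 mulr1 (le_trans (gle _))// cabsM ler_wpM2r// cabs_ge0.
Qed.

Lemma mean_value_inequality f F (a b : R[i]) (M : R) :
  (forall t : R, 0 <= t <= 1 -> cdiff f (a + t%:C * (b - a)) (F (a + t%:C * (b - a))) /\
     cabs (F (a + t%:C * (b - a))) <= M) ->
  cabs (f b - f a) <= 2 * M * cabs (b - a).
Proof.
move=> H; apply: (le_trans (cabs_le_ReIm _)).
rewrite -mulrA mulrC mulr_natr mulr2n lerD//; apply: mean_value_part H.
- exact: ReB.
- exact: Re_le_cabs.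
- by move=> x [u v] /=; rewrite mul0r subr0.
- exact: ImB.
- exact: Im_le_cabs.
- by move=> x [u v] /=; rewrite mul0r addr0.
Qed.

Lemma cdiffB f (l : R[i]) g (m : R[i]) z : cdiff f z l -> cdiff g z m ->
  cdiff (fun x => f x - g x) z (l - m).
Proof.
move=> h1 h2 e e0; have e20 : 0 < e / 2 by lra.
have [d1 d10 H1] := h1 _ e20; have [d2 d20 H2] := h2 _ e20.
exists (Num.min d1 d2); first by rewrite lt_min d10 d20.
move=> h; rewrite lt_min => /andP[/H1 k1 /H2 k2].
have -> : f (z + h) - g (z + h) - (f z - g z) - (l - m) * h =
  (f (z + h) - f z - l * h) - (g (z + h) - g z - m * h) by ring.
by rewrite (le_trans (cabsD _ _))// cabsN; lra.
Qed.

Lemma cdiffZ f (l : R[i]) c z : cdiff f z l -> cdiff (fun x => c * f x) z (c * l).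
Proof.
move=> h e e0; have c1 : 0 < cabs c + 1 by have := cabs_ge0 c; lra.
have ec : 0 < e / (cabs c + 1) by rewrite divr_gt0.
have [d d0 H] := h _ ec; exists d => // k /H{}H.
have -> : c * f (z + k) - c * f z - c * l * k = c * (f (z + k) - f z - l * k) by ring.
rewrite cabsM; have := ler_wpM2l (cabs_ge0 c) H.
move/le_trans; apply; rewrite mulrA ler_wpM2r ?cabs_ge0//.
by rewrite mulrCA ger_pMr// ler_pdivrMr// mul1r lerDl.
Qed.

Lemma cdiff_shift f (l : R[i]) h z : cdiff f (z + h) l -> cdiff (fun x => f (x + h)) z l.
Proof.
move=> H e e0; have [d d0 {}H] := H e e0; exists d => // k /H.
by rewrite (addrAC z h k).
Qed.

Lemma cdiff_id z : cdiff (fun x : R[i] => x) z 1.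
Proof.
move=> e e0; exists 1 => // h _.
have -> : z + h - z - 1 * h = 0 by ring.
by rewrite cabs0 mulr_ge0 ?cabs_ge0// ltW.
Qed.

Lemma unit_discE (z : R[i]) : unit_disc z = (cabs z < 1) :> Prop.
Proof. by rewrite /unit_disc /disc /= subr0. Qed.

Lemma dA_square (z : R[i]) (r : R) : 0 <= r ->
  dA (square z r) = ((2 * r) * (2 * r))%:E.
Proof.
move=> r0; rewrite /dA /square product_measure1E//.
transitivity (@lebesgue_measure R `[(re z - r)%R, (re z + r)%R] *
  @lebesgue_measure R `[(im z - r)%R, (im z + r)%R])%E; first by [].
have h (c : R) : c - r <= c + r by lra.
rewrite !itv_measure//.
by rewrite -EFinM; congr (_%:E); ring.
Qed.

Section OnDisc.
Variables (f F : R[i] -> R[i]).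
Hypothesis fF : forall z, cabs z < 1 -> cdiff f z (F z).

Lemma square_in_disc (z ze : R[i]) (s : R) :
  `|re ze - re z| <= s -> `|im ze - im z| <= s -> cabs ze <= cabs z + 2 * s.
Proof.
move=> h1 h2; have := cabs_dist ze z 0; rewrite !subr0.
by have := cabs_le_ReIm (ze - z); rewrite -ReB -ImB; lra.
Qed.

Lemma holomorphic_square_disc z s : cabs z + 2 * s < 1 -> holomorphic_square f z s.
Proof.
move=> zs x y xP yP; exists (F (x +i* y)); apply: fF; apply: le_lt_trans zs.
by apply: square_in_disc => /=; rewrite ler_norml; lra.
Qed.

(** Quadrisection instead of a covering argument: bounds on the quarters add up to a bound on the
    rectangle, and continuity gives the bound locally. *)
Lemma bounded_on_disc rho : rho < 1 ->
  exists2 M, 0 < M & forall z, cabs z <= rho -> cabs (f z) <= M.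
Proof.
move=> rho1.
pose P x y w h := exists2 M, 0 < M & forall z, cabs z <= rho ->
  x <= re z <= x + w -> y <= im z <= y + h -> cabs (f z) <= M.
suff : P (-1) (-1) 2 2.
  move=> [M M0 H]; exists M => // z zr; apply: H => //.
    by have := Re_le_cabs z; rewrite ler_norml; lra.
  by have := Im_le_cabs z; rewrite ler_norml; lra.
apply: (@quadrisection_induction _ P); rewrite ?ler0n//.
- move=> x y w h w0 h0 [M1 M10 H1] [M2 M20 H2] [M3 M30 H3] [M4 M40 H4].
  exists (M1 + M2 + (M3 + M4)); first lra.
  move=> z zr xP yP.
  have [hx|hx] := leP (re z) (x + w / 2); have [hy|hy] := leP (im z) (y + h / 2).
  - by have := H1 z zr ltac:(lra) ltac:(lra); lra.
  - by have := H3 z zr ltac:(lra) ltac:(lra); lra.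
  - by have := H2 z zr ltac:(lra) ltac:(lra); lra.
  - by have := H4 z zr ltac:(lra) ltac:(lra); lra.
- move=> x y _ _; have close x' y' w h d z : 0 <= w -> 0 <= h ->
      x' <= x <= x' + w -> y' <= y <= y' + h ->
      w + h < d -> x' <= re z <= x' + w -> y' <= im z <= y' + h -> cabs (z - (x +i* y)) < d.
    move=> w0 h0 ? ? whd ? ?; apply: le_lt_trans whd; apply: (le_trans (cabs_le_ReIm _)).
    by rewrite -ReB -ImB /=; apply: lerD; rewrite ler_norml; lra.
  have [zr|zr] := leP (cabs (x +i* y)) rho.
    have [d d0 H] := cdiff_ccont (fF (le_lt_trans zr rho1)) ltr01.
    exists d => // x' y' w h w0 h0 xP yP whd.
    exists (cabs (f (x +i* y)) + 1); first by have := cabs_ge0 (f (x +i* y)); lra.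
    move=> z _ zx zy; have := H _ (close _ _ _ _ _ _ w0 h0 xP yP whd zx zy).
    rewrite [_ + (z - _)]addrC subrK => k; have := cabs_dist (f z) (f (x +i* y)) 0.
    by rewrite !subr0; lra.
  (* Around a point outside the closed disc, small rectangles miss the disc and any bound holds
     vacuously. *)
  exists (cabs (x +i* y) - rho); first lra.
  move=> x' y' w h w0 h0 xP yP whd; exists 1 => // z zr' zx zy.
  have := close _ _ _ _ _ _ w0 h0 xP yP whd zx zy.
  by have := cabs_dist (x +i* y) z 0; rewrite !subr0 cabsB; lra.
Qed.

(** F is shown to be bounded and Lipschitz before anything is known about its differentiability.
    Since f is locally Lipschitz, its difference quotients with step h are bounded by L. For fixed h
    such a quotient is itself holomorphic, so [lipschitz_of_bounded] makes it Lipschitz with a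
    constant independent of h, and h tends to 0. *)
Lemma derivative_regular rho : 0 <= rho -> rho < 1 ->
  exists C e : R, [/\ 0 < C, 0 < e & forall z, cabs z <= rho ->
    cabs (F z) <= C /\ forall a, cabs (a - z) <= e ->
    cabs (F a - F z) <= C * cabs (a - z)].
Proof.
(* The radius (1 + rho) / 2 is rho + 8 s: enough room for a square of half-side s about z, a
   translation by h, and another square about the translated point. *)
move=> rho0 rho1; pose s := (1 - rho) / 16.
have s0 : 0 < s by rewrite /s; lra.
have [M M0 HM] := bounded_on_disc (ltac:(lra) : (1 + rho) / 2 < 1).
pose L := 256 * M / s.
have L0 : 0 < L by rewrite divr_gt0// mulr_gt0.
have lip z a : cabs z <= rho + 4 * s -> cabs (a - z) <= s / 4 ->
    cabs (f a - f z) <= L * cabs (a - z).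
  move=> zr az; apply: lipschitz_of_bounded az => //.
    by apply: holomorphic_square_disc; rewrite /s in zr *; lra.
  move=> ze h1 h2; apply: HM; have := square_in_disc h1 h2.
  by rewrite /s in zr *; lra.
have dq z h : h != 0 -> cabs h <= s / 4 -> cabs z <= rho + 4 * s ->
    cabs ((f (z + h) - f z) / h) <= L.
  move=> h0 hs zr; rewrite cabsM cabsV ler_pdivrMr ?cabs_gt0//.
  have := lip z (z + h) zr; rewrite addrAC subrr add0r; exact.
have limF z e : cabs z < 1 -> 0 < e -> exists2 d, 0 < d & forall h, h != 0 ->
    cabs h < d -> cabs ((f (z + h) - f z) / h - F z) <= e.
  move=> z1 e0; have [d d0 H] := fF z1 e0; exists d => // h h0 /H.
  have -> : (f (z + h) - f z) / h - F z = (f (z + h) - f z - F z * h) / h by field.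
  by rewrite cabsM cabsV ler_pdivrMr ?cabs_gt0.
have small d : 0 < d -> exists h : R[i], [/\ h != 0, cabs h < d & cabs h <= s / 4].
  move=> d0; exists (Num.min (d / 2) (s / 4))%:C.
  have m0 : 0 < Num.min (d / 2) (s / 4) by rewrite lt_min; apply/andP; split; lra.
  rewrite -cabs_gt0 cabs_real gtr0_norm//; split => //.
    by rewrite gt_min; apply/orP; left; lra.
  by rewrite ge_min lexx orbT.
exists (L + 256 * L / s), (s / 4).
have L1 : 0 < 256 * L / s by rewrite divr_gt0// mulr_gt0.
split; [lra|lra|move=> z zr].
have z1 : cabs z < 1 by lra.
split.
  apply/ler_addgt0Pr => e e0; have [d d0 H] := limF z e z1 e0.
  have [h [h0 hd hs]] := small d d0.
  have := H h h0 hd; have := dq z h h0 hs ltac:(lra).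
  have := cabs_dist (F z) ((f (z + h) - f z) / h) 0; rewrite !subr0 cabsB; lra.
move=> a az.
have a1 : cabs a < 1.
  by have := cabs_dist a z 0; rewrite !subr0 /s in az *; lra.
apply/ler_addgt0Pr => e e0.
have e20 : 0 < e / 2 by lra.
have [d1 d10 H1] := limF z _ z1 e20; have [d2 d20 H2] := limF a _ a1 e20.
have [h [h0 hd hs]] := small (Num.min d1 d2) ltac:(by rewrite lt_min d10 d20).
move: hd; rewrite lt_min => /andP[/(H1 _ h0) k1 /(H2 _ h0) k2].
pose q x := h^-1 * (f (x + h) - f x).
have k3 : cabs (q a - q z) <= 256 * L / s * cabs (a - z).
  apply: lipschitz_of_bounded az => //.
    move=> x y xP yP; have xy : cabs (x +i* y) <= cabs z + 2 * s.
      by apply: square_in_disc => /=; rewrite ler_norml; lra.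
    exists (h^-1 * (F ((x +i* y) + h) - F (x +i* y))).
    apply: cdiffZ; apply: cdiffB; [apply: cdiff_shift|]; apply: fF; last first.
      by rewrite /s in xy *; lra.
    by apply: (le_lt_trans (cabsD _ _)); rewrite /s in xy hs *; lra.
  move=> ze h1 h2; rewrite /q mulrC; apply: dq => //.
  by have := square_in_disc h1 h2; lra.
rewrite /q ![h^-1 * _]mulrC in k3.
have -> : F a - F z = ((f (a + h) - f a) / h - (f (z + h) - f z) / h) +
   (((f (z + h) - f z) / h - F z) - ((f (a + h) - f a) / h - F a)) by ring.
apply: (le_trans (cabsD _ _)).
have := cabsD ((f (z + h) - f z) / h - F z) (- ((f (a + h) - f a) / h - F a)).
rewrite cabsN => k4; have := mulr_ge0 (ltW L0) (cabs_ge0 (a - z)).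
by rewrite [(L + _) * _]mulrDl; lra.
Qed.

Lemma derivative_ccont z : cabs z < 1 -> ccont F z.
Proof.
move=> z1; have [C [e [C0 e0 H]]] := derivative_regular (cabs_ge0 z) z1.
have [_ {}H] := H z (lexx _).
move=> d d0; exists (Num.min e (d / C)); first by rewrite lt_min e0 divr_gt0.
move=> h; rewrite lt_min => /andP[he hd].
have := H (z + h); rewrite addrAC subrr add0r => /(_ (ltW he)) /le_trans; apply.
by rewrite mulrC -ler_pdivlMr// ltW.
Qed.

Lemma derivative_le_square_average z r : 0 < r -> cabs z + 2 * r < 1 ->
  ((cabs (F z))%:E <=
   (32 / r ^+ 2)%:E * \int[dA]_(p in square z r) (cabs (F (cplx p)))%:E)%E.
Proof.
move=> r0 zr.
have sqd p : square z r p -> cabs (cplx p) <= cabs z + 2 * r.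
  by move=> /squareP[h1 h2]; exact: square_in_disc.
have z0 := cabs_ge0 z.
have [C [e [C0 e0 H]]] := derivative_regular (ltac:(lra) : 0 <= cabs z + 2 * r) zr.
have cz : cabs z <= cabs z + 2 * r by lra.
have mF : measurable_fun (square z r) (fun p => cabs (F (cplx p))).
  apply: ccont_measurable_cabs => p /sqd h; apply: derivative_ccont.
  exact: le_lt_trans zr.
set T := (\int[dA]_(p in _) _)%E.
have T0 : (0 <= T)%E by apply: integral_ge0 => p _; rewrite lee_fin cabs_ge0.
have msq := measurable_square z r.
have c32 : 0 < 32 / r ^+ 2 by rewrite divr_gt0// exprn_gt0.
have area : dA (square z r) = ((2 * r) * (2 * r))%:E.
  by apply: dA_square; exact: ltW.
(* The bound is taken to the limit from difference quotients, which spares the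
   differentiability of F. *)
have close h : 0 < h -> h <= e -> cabs z + 2 * r + h < 1 -> forall ze : R[i],
   cabs ze <= cabs z + 2 * r -> cabs (h%:C^-1 * (f (ze + h%:C) - f ze) - F ze) <= 2 * C * h.
  move=> h0 he hz ze zer; have hC : h%:C != 0 by rewrite -cabs_gt0 cabs_real normr_gt0 gt_eqF.
  have := @mean_value_inequality (fun x => f x - F ze * x) (fun x => F x - F ze)
    ze (ze + h%:C) (C * h).
  have -> : ze + h%:C - ze = h%:C by ring.
  rewrite cabs_real gtr0_norm// => k.
  have -> : h%:C^-1 * (f (ze + h%:C) - f ze) - F ze =
    h%:C^-1 * (f (ze + h%:C) - F ze * (ze + h%:C) - (f ze - F ze * ze)) by field.
  rewrite cabsM cabsV cabs_real gtr0_norm// mulrC ler_pdivrMr//.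
  have : 2 * (C * h) * h = 2 * C * h * h by ring.
  move=> <-; apply: k => t /andP[t0 t1].
  have th : cabs (ze + t%:C * h%:C - ze) <= h.
    rewrite addrAC subrr add0r cabsM !cabs_real ger0_norm// gtr0_norm//.
    by rewrite ler_piMl// ltW.
  split.
    rewrite -[F ze in X in cdiff _ _ X]mulr1; apply: cdiffB.
      apply: fF; have := cabs_dist (ze + t%:C * h%:C) ze 0; rewrite !subr0; lra.
    exact/cdiffZ/cdiff_id.
  have [_ Hz] := H ze zer.
  apply: (le_trans (Hz _ (le_trans th he))).
  by rewrite ler_pM2l.
(* The quotient q differs from F by at most 2 C h. Integrated over an area 4 r^2 and multiplied by
   32 / r^2 this error gives 256 C h, and the error at z adds 2 C h. *)
have bound h : 0 < h -> h <= e -> cabs z + 2 * r + h < 1 ->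
   ((cabs (F z))%:E <= (32 / r ^+ 2)%:E * T + (258 * C * h)%:E)%E.
  move=> h0 he hz; pose q ze := h%:C^-1 * (f (ze + h%:C) - f ze).
  have dq ze : cabs ze <= cabs z + 2 * r -> cdiff q ze (h%:C^-1 * (F (ze + h%:C) - F ze)).
    move=> zer; apply: cdiffZ; apply: cdiffB; [apply: cdiff_shift|]; apply: fF; last lra.
    by apply: (le_lt_trans (cabsD _ _)); rewrite cabs_real gtr0_norm//; lra.
  have hq : holomorphic_square q z r.
    move=> x y xP yP; eexists; apply: dq.
    by apply: square_in_disc => /=; rewrite ler_norml; lra.
  have mq : measurable_fun (square z r) (fun p => cabs (q (cplx p))).
    by apply: ccont_measurable_cabs => p /sqd /dq /cdiff_ccont.
  have Iq := cabs_le_square_average r0 hq mq.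
  have k1 : (\int[dA]_(p in square z r) (cabs (q (cplx p)))%:E <=
      T + (2 * C * h * ((2 * r) * (2 * r)))%:E)%E.
    apply: (@le_trans _ _ (\int[dA]_(p in square z r)
      ((cabs (F (cplx p)))%:E + (2 * C * h)%:E))%E).
      apply: ge0_le_integral => //.
      - by move=> p _; rewrite lee_fin cabs_ge0.
      - exact/measurable_EFinP.
      - by apply: emeasurable_funD => //; exact/measurable_EFinP.
      - move=> p /sqd /(close h h0 he hz) k; rewrite -EFinD lee_fin.
        by have := cabs_dist (q (cplx p)) (F (cplx p)) 0; rewrite !subr0 /q; lra.
    rewrite ge0_integralD//; last 3 first.
    - by move=> p _; rewrite lee_fin cabs_ge0.
    - exact/measurable_EFinP.
    - by move=> p _; rewrite lee_fin !mulr_ge0// ltW.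
    rewrite integral_cst//.
    rewrite [X in (_ + _ * X <= _)%E](_ : _ = (2 * r * (2 * r))%:E); last exact: area.
    by rewrite -EFinM.
  have k2 := close h h0 he hz z cz.
  apply: (@le_trans _ _ ((cabs (q z))%:E + (2 * C * h)%:E)%E).
    rewrite -EFinD lee_fin; have := cabs_dist (F z) (q z) 0; rewrite !subr0 cabsB /q; lra.
  apply: (le_trans (leeD (le_trans Iq (lee_wpmul2l _ k1)) (lexx _))).
    by rewrite lee_fin ltW.
  rewrite ge0_muleDr//; last by rewrite lee_fin !mulr_ge0// ltW.
  rewrite -addeA leeD2l// -EFinM -EFinD lee_fin le_eqVlt; apply/orP; left; apply/eqP.
  by field; rewrite gt_eqF.
have [Tfin|Toy] := boolP (T \is a fin_num); last first.
  have -> : T = +oo%E by move: T0 Toy; case: (T).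
  by rewrite gt0_muley ?leey// lte_fin.
move: bound; rewrite -(fineK Tfin) -EFinM lee_fin => bound.
apply/ler_addgt0Pr => d d0.
pose h := Num.min e (Num.min ((1 - (cabs z + 2 * r)) / 2) (d / (258 * C))).
have h0 : 0 < h by rewrite !lt_min e0 !divr_gt0 ?mulr_gt0//; lra.
have : h <= h by [].
rewrite {2}/h !le_min => /and3P[k1 k2]; rewrite ler_pdivlMr ?mulr_gt0// => k3.
by have := bound h h0 k1 ltac:(lra); rewrite -EFinD lee_fin; lra.
Qed.

End OnDisc.
End Derivative.

(** * Reverse Hoelder inequality for the derivative *)

Section ReverseHolder.
Context {R : realType}.
Implicit Types (a r p q t : R).

Lemma powR_le (k u w : R) : 0 <= k -> 0 <= u -> u <= w -> u `^ k <= w `^ k.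
Proof.
move=> k0 u0 uw; apply: ge0_ler_powR; rewrite ?nnegrE//.
exact: le_trans uw.
Qed.

(* A pointwise substitute for Hoelder's inequality: a value t > e a satisfies
   1 <= (t / (e a))^p, and 1 <= X + X^(-s) for every X > 0. *)
Lemma le_powR_sum (t a ka e La W p s : R) : 0 <= t -> t <= ka * a -> 0 < a ->
  0 < ka -> 0 < e -> 0 < La -> 0 < W -> 0 < p -> 0 < s ->
  t <= e * a + ka * a * (La * (e * a) `^ (- p) * (t `^ p * W) +
                         La `^ (- s) * W `^ (- s)).
Proof.
move=> t0 tk a0 ka0 e0 La0 W0 p0 s0.
have ea0 : 0 < e * a by rewrite mulr_gt0.
have ka0' : 0 < ka * a by rewrite mulr_gt0.
have [te|te] := leP t (e * a).
  rewrite (le_trans te)// lerDl mulr_ge0 ?(ltW ka0')//.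
  by rewrite addr_ge0// !mulr_ge0 ?powR_ge0 ?(ltW La0) ?(ltW W0).
suff H : 1 <= La * (e * a) `^ (- p) * (t `^ p * W) + La `^ (- s) * W `^ (- s).
  rewrite (le_trans tk)// ler_wpDl ?(ltW ea0)//.
  by rewrite ler_peMr// ltW.
have X0 : 0 < La * W by rewrite mulr_gt0.
rewrite -powRM ?(ltW La0) ?(ltW W0)//.
have h1 : La * W <= La * (e * a) `^ (- p) * (t `^ p * W).
  have k : 1 <= (e * a) `^ (- p) * t `^ p.
    rewrite powRN mulrC ler_pdivlMr ?powR_gt0// mul1r.
    exact: powR_le (ltW p0) (ltW ea0) (ltW te).
  rewrite -mulrA mulrA [leRHS](_ : _ = La * W * ((e * a) `^ (- p) * t `^ p)).
    by rewrite ler_peMr// ltW.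
  by ring.
have [X1|X1] := leP 1 (La * W).
  by rewrite (le_trans X1)// (le_trans h1)// lerDl powR_ge0.
have h2 : 1 <= (La * W) `^ (- s).
  rewrite powRN invf_ge1 ?powR_gt0//.
  by have := powR_le (ltW s0) (ltW X0) (ltW X1); rewrite powR1.
by rewrite (le_trans h2)// lerDr (le_trans _ h1)// ltW.
Qed.

(** The optimisation in La recovers the product i j^(q - 1) that Hoelder's inequality would give:
    the sum of a term growing with La and one decaying in La is used at a single well-chosen La. *)
Lemma optimize_scale (a r ka i j p q : R) : 0 < a -> 0 < r -> 0 < ka ->
  0 <= i -> 0 < j -> 0 < p -> 1 < q ->
  (forall La, 0 < La -> a <= 32 / r ^+ 2 * (256^-1 * a * (2 * r * (2 * r)) +
    ka * a * (La * (256^-1 * a) `^ (- p) * i + La `^ (- (q - 1)^-1) * j))) ->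
  a `^ p * (r ^+ 2) `^ q <= 256 `^ p * (128 * ka) `^ q * i * j `^ (q - 1).
Proof.
move=> a0 r0 ka0 i0 j0 p0 q1 H.
have q10 : 0 < q - 1 by lra.
have r20 : 0 < r ^+ 2 by rewrite exprn_gt0.
(* With La = X^(q - 1) the term with j equals a / 4. The choice of 1 / 256 makes the first term a /
   2, so the term with i must be at least a / 4. *)
pose X := 128 * ka * j / r ^+ 2.
have X0 : 0 < X by rewrite divr_gt0 ?mulr_gt0.
have := H (X `^ (q - 1)) (powR_gt0 _ X0).
rewrite -[(X `^ (q - 1)) `^ _]powRrM mulrN divff ?gt_eqF// powR_inv1 ?(ltW X0)//.
pose P := (256^-1 * a) `^ p.
have P0 : 0 < P by apply: powR_gt0; apply: mulr_gt0; [rewrite invr_gt0 ltr0n|].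
rewrite powRN -/P; set La := X `^ (q - 1).
have La0 : 0 < La by rewrite powR_gt0.
have -> : 32 / r ^+ 2 * (256^-1 * a * (2 * r * (2 * r)) +
    ka * a * (La / P * i + X^-1 * j)) =
    a / 2 + a / 4 + a * (32 * ka * La * i / (P * r ^+ 2)).
  by rewrite /X; field; rewrite !gt_eqF.
move=> k1.
have k2 : 1 / 4 <= 32 * ka * La * i / (P * r ^+ 2).
  by rewrite -(ler_pM2l a0); lra.
have k3 : P * r ^+ 2 <= 128 * ka * La * i.
  by move: k2; rewrite ler_pdivlMr ?mulr_gt0//; lra.
have LaE : La * (r ^+ 2) `^ (q - 1) = (128 * ka) `^ (q - 1) * j `^ (q - 1).
  rewrite /La -powRM ?(ltW X0) ?(ltW r20)// -[RHS]powRM ?(ltW j0)//; last by rewrite mulr_ge0// ltW.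
  by congr (_ `^ _); rewrite /X; field; rewrite gt_eqF.
have PE : a `^ p = 256 `^ p * P.
  rewrite /P -powRM ?ler0n; [|by []|by apply: mulr_ge0; rewrite ?invr_ge0 ?ler0n ?(ltW a0)].
  by congr (_ `^ _); field.
rewrite PE -(mulr_powRB1 (ltW r20) (_ : 0 < q)); last lra.
rewrite -(mulr_powRB1 (_ : 0 <= 128 * ka) (_ : 0 < q)); [|lra..].
set Y := (r ^+ 2) `^ (q - 1) in LaE *.
have k4 := ler_wpM2r (powR_ge0 _ _ : 0 <= Y) k3.
have -> : 256 `^ p * P * (r ^+ 2 * Y) = 256 `^ p * (P * r ^+ 2 * Y) by ring.
have -> : 256 `^ p * (128 * ka * (128 * ka) `^ (q - 1)) * i * j `^ (q - 1) =
    256 `^ p * (128 * ka * La * i * Y).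
  have -> : 128 * ka * La * i * Y = 128 * ka * i * (La * Y) by ring.
  by rewrite LaE; ring.
by rewrite ler_wpM2l ?powR_ge0.
Qed.

Lemma ge0_integral_affine (di : measure_display) (T : measurableType di)
  (mu : {measure set T -> \bar R})
  (D : set T) (A B : T -> R) (c0 c1 c2 : R) : measurable D ->
  measurable_fun D A -> measurable_fun D B -> (forall x, D x -> 0 <= A x) ->
  (forall x, D x -> 0 <= B x) -> 0 <= c0 -> 0 <= c1 -> 0 <= c2 ->
  (\int[mu]_(x in D) (c0 + (c1 * A x + c2 * B x))%:E =
   c0%:E * mu D + (c1%:E * \int[mu]_(x in D) (A x)%:E +
                   c2%:E * \int[mu]_(x in D) (B x)%:E))%E.
Proof.
move=> mD mA mB A0 B0 c00 c10 c20.
have mcA : measurable_fun D (fun x => (c1 * A x)%:E).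
  by apply/measurable_EFinP; exact: measurable_funM.
have mcB : measurable_fun D (fun x => (c2 * B x)%:E).
  by apply/measurable_EFinP; exact: measurable_funM.
under eq_integral do rewrite EFinD EFinD.
rewrite ge0_integralD//=; last 2 first.
- by move=> x Dx; rewrite adde_ge0// lee_fin mulr_ge0 ?A0 ?B0.
- exact: emeasurable_funD.
rewrite integral_cst// ge0_integralD//=; last 2 first.
- by move=> x Dx; rewrite lee_fin mulr_ge0 ?A0.
- by move=> x Dx; rewrite lee_fin mulr_ge0 ?B0.
under eq_integral do rewrite EFinM.
rewrite ge0_integralZl_EFin//=; last by apply/measurable_EFinP.
under [X in (_ + (_ + X))%E]eq_integral do rewrite EFinM.
by rewrite ge0_integralZl_EFin//=; apply/measurable_EFinP.
Qed.

Lemma measurable_powR_comp (di : measure_display) (T : measurableType di)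
  (D : set T) (g : T -> R) (k : R) :
  measurable_fun D g -> measurable_fun D (fun x => g x `^ k).
Proof.
move=> mg; apply: (@measurableT_comp _ _ _ _ _ _ (fun x : R => x `^ k) _ g) => //.
Qed.

Section OnDisc.
Variables (f F : R[i] -> R[i]).
Hypothesis fF : forall z, cabs z < 1 -> cdiff f z (F z).
Variables (v : R * R -> R).
Hypothesis mv : measurable_fun setT v.
Hypothesis v0 : forall z, 0 < v z.

(** The factor (25 / 4)^q comes from d >= 2/5 rho, and 2^p from a point where G is only at least
    half its supremum. The rest is the constant of [reverse_holder_center] with ka = 2 * 2^m, m = 2
    q / p, and r = d / 4, whence 2048 = 128 * 16. *)
Definition reverse_holder_constant p q : R :=
  (25 / 4) `^ q * (2 `^ p * (256 `^ p * (2048 * (2 * 2 `^ (2 * q / p))) `^ q)).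

Lemma reverse_holder_constant_gt0 p q : 0 < reverse_holder_constant p q.
Proof.
have h : 0 < 2 `^ (2 * q / p) :> R by apply: powR_gt0; rewrite ltr0n.
apply: mulr_gt0; first by apply: powR_gt0; apply: divr_gt0; rewrite ltr0n.
apply: mulr_gt0; first by apply: powR_gt0; rewrite ltr0n.
apply: mulr_gt0; apply: powR_gt0; first by rewrite ltr0n.
apply: mulr_gt0; first by rewrite ltr0n.
by apply: mulr_gt0 => //; rewrite ltr0n.
Qed.

(** The mean value inequality for F on the square, with [le_powR_sum] applied to the integrand at
    each point: the assumed bound of |F| by ka |F y| is what makes any p > 0 admissible. *)
Lemma reverse_holder_center (B : set (R * R)) p q (i j ka : R) y r : 0 < p -> 1 < q ->
  0 < j -> 0 <= i -> 0 < r -> cabs y + 2 * r < 1 -> 0 < ka ->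
  0 < cabs (F y) -> measurable B ->
  square y r `<=` B -> B `<=` cplx @^-1` unit_disc ->
  (forall z : R * R, square y r z -> cabs (F (cplx z)) <= ka * cabs (F y)) ->
  (\int[dA]_(z in B) (cabs (F (cplx z)) `^ p * v z)%:E <= i%:E)%E ->
  (\int[dA]_(z in B) (v z `^ (- (q - 1)^-1))%:E <= j%:E)%E ->
  cabs (F y) `^ p * (r ^+ 2) `^ q <= 256 `^ p * (128 * ka) `^ q * i * j `^ (q - 1).
Proof.
move=> p0 q1 j0 i0 r0 yr ka0 a0 mB QB BD Fka Ii Jj; apply: optimize_scale => // La La0.
set a := cabs (F y) in a0 Fka *; set s := (q - 1)^-1 in Jj *.
have s0 : 0 < s by rewrite invr_gt0; lra.
have mQ := measurable_square y r.
have mF : measurable_fun B (fun z => cabs (F (cplx z))).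
  apply: ccont_measurable_cabs => z /BD zD; apply: (derivative_ccont fF).
  by move: zD; rewrite /= unit_discE.
have mA : measurable_fun B (fun z => cabs (F (cplx z)) `^ p * v z).
  apply: measurable_funM; last exact: measurable_funTS.
  exact: (measurable_powR_comp p mF).
have mW : measurable_fun B (fun z => v z `^ (- s)).
  by apply: measurable_powR_comp; exact: measurable_funTS.
have Q1 : (\int[dA]_(z in square y r) (cabs (F (cplx z)) `^ p * v z)%:E <= i%:E)%E.
  apply: le_trans Ii; apply: ge0_subset_integral => //.
    by apply/measurable_EFinP.
  by move=> z _; rewrite lee_fin mulr_ge0 ?powR_ge0 ?ltW.
have Q2 : (\int[dA]_(z in square y r) (v z `^ (- s))%:E <= j%:E)%E.
  apply: le_trans Jj; apply: ge0_subset_integral => //.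
    by apply/measurable_EFinP.
  by move=> z _; rewrite lee_fin powR_ge0.
have := derivative_le_square_average fF r0 yr.
rewrite -/a; set T := (\int[dA]_(z in _) _)%E => aT.
pose c := 256^-1 * a.
have c0 : 0 < c by apply: mulr_gt0 => //; rewrite invr_gt0 ltr0n.
pose c1 := ka * a * (La * c `^ (- p)).
pose c2 := ka * a * La `^ (- s).
have c10 : 0 <= c1 by rewrite !mulr_ge0 ?powR_ge0 ?ltW.
have c20 : 0 <= c2 by rewrite !mulr_ge0 ?powR_ge0 ?ltW.
have TI : (T <= \int[dA]_(z in square y r)
    (c + (c1 * (cabs (F (cplx z)) `^ p * v z) + c2 * v z `^ (- s)))%:E)%E.
  apply: ge0_le_integral => //.
  - by move=> z _; rewrite lee_fin cabs_ge0.
  - by apply/measurable_EFinP; exact: measurable_funS mF.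
  - apply/measurable_EFinP; apply: measurable_funD => //.
    by apply: measurable_funD; apply: measurable_funM => //;
      [exact: measurable_funS mA|exact: measurable_funS mW].
  - move=> z zQ; rewrite lee_fin.
    have := @le_powR_sum (cabs (F (cplx z))) a ka 256^-1 La (v z) p s
       (cabs_ge0 _) (Fka _ zQ) a0 ka0 ltac:(lra) La0 (v0 z) p0 s0.
    rewrite -/c => /le_trans; apply; rewrite lerD2l mulrDr /c1 /c2 le_eqVlt.
    by apply/orP; left; apply/eqP; ring.
rewrite ge0_integral_affine// in TI; last 5 first.
- exact: measurable_funS mA.
- exact: measurable_funS mW.
- by move=> z _; rewrite mulr_ge0 ?powR_ge0 ?ltW.
- by move=> z _; rewrite powR_ge0.
- exact: ltW.
have c32 : 0 < 32 / r ^+ 2 by rewrite divr_gt0// exprn_gt0.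
have {}TI : (T <= (c * (2 * r * (2 * r)) + (c1 * i + c2 * j))%:E)%E.
  apply: (le_trans TI); rewrite !EFinD; apply: leeD.
    rewrite [X in (_ * X <= _)%E](_ : _ = (2 * r * (2 * r))%:E) -?EFinM//.
    by apply: dA_square; exact: ltW.
  by rewrite !EFinM; apply: leeD; apply: lee_wpmul2l; rewrite ?lee_fin.
rewrite -lee_fin (le_trans aT)//.
apply: (le_trans (lee_wpmul2l _ TI)); first by rewrite lee_fin ltW.
rewrite -EFinM lee_fin ler_pM2l// lerD2l mulrDr /c1 /c2 le_eqVlt.
by apply/orP; left; apply/eqP; rewrite /c; ring.
Qed.

(* Rather than at y itself, the inequality is proved at a point where
   |F| d^m is almost maximal, d being the distance to the complement of the disc:
   there |F| is controlled on a whole square by its value at the center. *)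
Lemma reverse_holder p q (i j : R) (x : R[i]) (rho : R) : 0 < p -> 1 < q -> 0 < j -> 0 <= i ->
  0 < rho -> cabs x + rho < 1 ->
  (\int[dA]_(z in cplx @^-1` disc x rho) (cabs (F (cplx z)) `^ p * v z)%:E <= i%:E)%E ->
  (\int[dA]_(z in cplx @^-1` disc x rho) (v z `^ (- (q - 1)^-1))%:E <= j%:E)%E ->
  forall y, cabs (y - x) <= 3 / 5 * rho ->
  cabs (F y) `^ p * (rho ^+ 2) `^ q <=
    reverse_holder_constant p q * i * j `^ (q - 1).
Proof.
move=> p0 q1 j0 i0 rho0 xr Ii Jj.
(* This exponent makes (d^m)^p = (d^2)^q, the power of the radius in the conclusion. *)
pose m := 2 * q / p.
have m0 : 0 < m by rewrite divr_gt0// mulr_gt0//; lra.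
pose d y := rho - cabs (y - x).
pose G y := cabs (F y) * d y `^ m.
have inD y : 0 < d y -> cabs y < 1 /\ cabs y <= cabs x + (rho - d y).
  rewrite /d => h; have := cabs_dist y x 0; rewrite !subr0; lra.
have [C [e [C0 e0 HC]]] := derivative_regular fF (ltac:(have := cabs_ge0 x; lra) :
  0 <= cabs x + rho) xr.
pose V := [set G y | y in [set y | 0 < d y]].
have V0 : V !=set0.
  by exists (G x); exists x => //=; rewrite /d subrr cabs0 subr0.
have Vub : has_ubound V.
  exists (C * rho `^ m) => _ [y /= dy <-].
  have [_ yx] := inD y dy.
  apply: ler_pM; rewrite ?cabs_ge0 ?powR_ge0//.
    by have [] := HC y ltac:(lra).
  by apply: powR_le; [exact: ltW|exact: ltW|rewrite /d gerBl cabs_ge0].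
pose S := sup V.
have GS y : 0 < d y -> G y <= S by move=> dy; apply: ub_le_sup => //; exists y.
pose K1 := 256 `^ p * (2048 * (2 * 2 `^ m)) `^ q.
have pm0 : 0 < 2 * 2 `^ m by apply: mulr_gt0; [|apply: powR_gt0]; rewrite ltr0n.
have K10 : 0 < K1.
  apply: mulr_gt0; apply: powR_gt0; first by rewrite ltr0n.
  by apply: mulr_gt0; first rewrite ltr0n.
have dm w : 0 <= w -> (w `^ m) `^ p = (w ^+ 2) `^ q.
  move=> w0; rewrite -powRrM /m divfK ?gt_eqF// powRrM.
  by rewrite powR_mulrn.
have main y : 0 < d y -> S <= 2 * G y -> 0 < G y ->
    G y `^ p <= K1 * i * j `^ (q - 1).
  move=> dy Sy Gy.
  have a0 : 0 < cabs (F y).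
    by move: Gy; rewrite /G pmulr_lgt0// powR_gt0.
  (* The square of half-side d y / 4 lies within d y / 2 of y, so d is at least d y / 2 on it.
     Almost maximality of G y then bounds |F| there by 2 * 2^m |F y|. *)
  pose r := d y / 4.
  have r0 : 0 < r by rewrite divr_gt0.
  have [y1 yx] := inD y dy.
  have ka0 := pm0.
  have dsq z : square y r z -> d y / 2 <= d (cplx z).
    move=> /squareP[h1 h2].
    have : cabs (cplx z - y) <= d y / 2.
      by apply: (le_trans (cabs_le_ReIm _)); rewrite -ReB -ImB /r in h1 h2 *; lra.
    by rewrite /d; have := cabs_dist (cplx z) y x; lra.
  have := @reverse_holder_center (cplx @^-1` disc x rho) p q i j (2 * 2 `^ m) y r
    p0 q1 j0 i0 r0 _ ka0 a0 (measurable_disc _ _) _ _ _ Ii Jj.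
  have h1 : cabs y + 2 * r < 1 by rewrite /r; lra.
  have h2 : square y r `<=` cplx @^-1` disc x rho.
    move=> z /dsq zd; have : 0 < d (cplx z) by lra.
    by rewrite subr_gt0.
  have h3 : cplx @^-1` disc x rho `<=` cplx @^-1` unit_disc.
    move=> z h; have {}h : cabs (cplx z - x) < rho := h.
    rewrite /= unit_discE.
    by have := cabs_dist (cplx z) x 0; rewrite !subr0; lra.
  have h4 z : square y r z -> cabs (F (cplx z)) <= 2 * 2 `^ m * cabs (F y).
    move=> /dsq zd; have dz : 0 < d (cplx z) by lra.
    have : cabs (F (cplx z)) * (d y / 2) `^ m <= 2 * G y.
      apply: le_trans Sy; apply: le_trans (GS _ dz).
      rewrite /G ler_wpM2l ?cabs_ge0//.
      apply: (powR_le (ltW m0) _ zd).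
      by apply: ltW; apply: divr_gt0 => //; rewrite ltr0n.
    have -> : (d y / 2) `^ m = d y `^ m / 2 `^ m.
      by rewrite powRM ?(ltW dy)// -powR_inv1// powRAC powR_inv1 ?powR_ge0.
    rewrite mulrA ler_pdivrMr ?powR_gt0// /G mulrA => k.
    rewrite -(ler_pM2r (powR_gt0 m dy)) (le_trans k)// le_eqVlt.
    by apply/orP; left; apply/eqP; ring.
  move=> /(_ h1 h2 h3 h4).
  have -> : (r ^+ 2) `^ q = (d y ^+ 2) `^ q / 16 `^ q.
    rewrite /r expr_div_n powRM ?sqr_ge0// ?invr_ge0 ?exprn_ge0//.
    rewrite -[(4 ^+ 2)^-1]powR_inv1 ?exprn_ge0// powRAC powR_inv1 ?powR_ge0//.
    by congr (_ / (_ `^ _)); ring.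
  rewrite mulrA ler_pdivrMr ?powR_gt0// => k.
  rewrite /G powRM ?cabs_ge0 ?powR_ge0// dm ?(ltW dy)//.
  apply: (le_trans k); rewrite /K1 le_eqVlt; apply/orP; left; apply/eqP.
  have -> : 2048 * (2 * 2 `^ m) = (128 * (2 * 2 `^ m)) * 16 by ring.
  have -> : (128 * (2 * 2 `^ m) * 16) `^ q = (128 * (2 * 2 `^ m)) `^ q * 16 `^ q.
    by apply: powRM; [apply: mulr_ge0; [rewrite ler0n|exact: ltW]|rewrite ler0n].
  ring.
move=> y yx.
have dy : 2 / 5 * rho <= d y by rewrite /d; lra.
have dy0 : 0 < d y by lra.
have rhs0 : 0 <= K1 * i * j `^ (q - 1).
  by apply: mulr_ge0; [apply: mulr_ge0; [exact: ltW|]|exact: powR_ge0].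
have Gy0 : 0 <= G y by rewrite mulr_ge0 ?cabs_ge0 ?powR_ge0.
have Sp : G y `^ p <= 2 `^ p * (K1 * i * j `^ (q - 1)).
  (* If S <= 0 then G y = 0. Otherwise S / 2 < S provides a point with G positive, as [main]
     requires. *)
  have [S0|S0] := leP S 0.
    have -> : G y = 0.
      by apply/eqP; rewrite eq_le Gy0 andbT (le_trans (GS _ dy0)).
    by rewrite powR0 ?gt_eqF//; apply: mulr_ge0; first exact: powR_ge0.
  have S2 : 0 < S / 2 by lra.
  have [_ [y' /= dy' <-] Sy'] := sup_adherent S2 (conj V0 Vub).
  rewrite -/S in Sy'.
  have k := main y' dy' ltac:(lra) ltac:(lra).
  apply: (@le_trans _ _ ((2 * G y') `^ p)).
    by apply: powR_le; [exact: ltW|exact: Gy0|have := GS _ dy0; lra].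
  rewrite powRM//; last lra.
  by rewrite ler_wpM2l ?powR_ge0.
have E : cabs (F y) `^ p * (rho ^+ 2) `^ q <= (25 / 4) `^ q * G y `^ p.
  rewrite /G powRM ?cabs_ge0 ?powR_ge0// dm ?(ltW dy0)// mulrCA ler_wpM2l ?powR_ge0//.
  rewrite -powRM ?sqr_ge0//; apply: powR_le; [lra|by rewrite mulr_ge0 ?sqr_ge0//; lra|].
  by have := ler_pM (ltac:(lra) : 0 <= 2 / 5 * rho) (ltac:(lra) : 0 <= 2 / 5 * rho) dy dy;
    rewrite !expr2; lra.
apply: (le_trans E).
have := ler_wpM2l (powR_ge0 (25 / 4) q) Sp.
move/le_trans; apply; rewrite /reverse_holder_constant /K1 /m le_eqVlt.
by apply/orP; left; apply/eqP; ring.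
Qed.

End OnDisc.
End ReverseHolder.

(** * Weights and the Bekolle-Bonami condition *)

Section BorelVersion.
Import HBNNSimple.
Context {R : realType}.

(* No measurability: the integral of a nonnegative function is a supremum over
   simple functions, which can be cut off outside the null set. *)
Lemma le_integral_off_null (N : set (R * R)) (g1 g2 : R * R -> \bar R) :
  measurable N -> dA N = 0%E -> (forall p, 0 <= g1 p)%E -> (forall p, 0 <= g2 p)%E ->
  (forall p, ~ N p -> g1 p <= g2 p)%E ->
  (\int[dA]_p g1 p <= \int[dA]_p g2 p)%E.
Proof.
move=> mN N0 g10 g20 g12.
rewrite ge0_integralTE// [leRHS]ge0_integralTE//.
apply: ge_ereal_sup => _ [h /= hg1 <-].
have mCN : measurable (~` N : set (measurableTypeR R * measurableTypeR R)).
  exact: measurableC.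
pose h' := proj_nnsfun h mCN.
have -> : sintegral dA h = sintegral dA h'.
  rewrite -!integralT_nnsfun; apply: ge0_ae_eq_integral => //.
  - by apply/measurable_EFinP.
  - by apply/measurable_EFinP.
  - by move=> p _; rewrite lee_fin.
  - by move=> p _; rewrite lee_fin.
  - exists N; split => // p; apply: contra_notP => Np _ /=.
    by rewrite /h' /= mindicE mem_set// mulr1.
apply: ereal_sup_ubound; exists h' => // p /=.
rewrite mindicE; case: (boolP (p \in ~` N)) => [|_].
  by rewrite inE mulr1 => Np; exact: le_trans (hg1 p) (g12 p Np).
by rewrite mulr0.
Qed.

Lemma eq_integral_off_null (D N : set (R * R)) (g1 g2 : R * R -> \bar R) :
  measurable N -> dA N = 0%E -> (forall p, D p -> 0 <= g1 p)%E ->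
  (forall p, D p -> 0 <= g2 p)%E ->
  (forall p, D p -> ~ N p -> g1 p = g2 p) ->
  (\int[dA]_(p in D) g1 p = \int[dA]_(p in D) g2 p)%E.
Proof.
move=> mN N0 g10 g20 g12; rewrite integral_mkcond [RHS]integral_mkcond.
have p0 (g : R * R -> \bar R) : (forall p, D p -> 0 <= g p)%E ->
    forall p, (0 <= (g \_ D) p)%E.
  by move=> g0 p; rewrite patchE; case: ifPn => //; rewrite inE; exact: g0.
apply/eqP; rewrite eq_le; apply/andP; split; apply: (le_integral_off_null mN N0);
  try (exact: p0); move=> p Np; rewrite !patchE; case: ifPn => //; rewrite inE => Dp.
all: by rewrite g12.
Qed.

(** For each rational k the superlevel set of w in the disc is Borel up to a null set. Removing
    these countably many null sets, and the one where w vanishes, leaves a Borel set on which w is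
    Borel and positive. *)
Lemma borel_version (w : R[i] -> R) : weight w ->
  exists v : R * R -> R, exists N : set (R * R),
    [/\ measurable_fun setT v, forall p, 0 < v p, measurable N, dA N = 0%E &
       forall p, unit_disc (cplx p) -> ~ N p -> v p = w (cplx p)].
Proof.
move=> [mw w0 [M [mM M0 wM]]].
have mD := @measurable_disc R 0 1; rewrite -/unit_disc in mD.
have step (k : rat) : exists AN : set (R * R) * set (R * R),
    [/\ measurable AN.1, measurable AN.2, dA AN.2 = 0%E &
      forall p, ~ AN.2 p -> (unit_disc (cplx p) /\ ratr k < w (cplx p)) <-> AN.1 p].
  have [A mA [B [B' [mB' B'0 BB']] E]] := mw `](ratr k), +oo[%classic (measurable_itv _).
  exists (A, B'); split => //= p Np; split.
    move=> [Dp kw].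
    have : (cplx @^-1` (unit_disc `&` w @^-1` `]ratr k, +oo[%classic)) p.
      by split => //=; rewrite in_itv /= andbT.
    by rewrite -E => -[//|/BB'].
  move=> Ap; have : (A `|` B) p by left.
  by rewrite E => -[Dp /=]; rewrite in_itv /= andbT.
have [AN HAN] := choice step.
pose N := M `|` \bigcup_k (AN k).2.
have mN : measurable N.
  apply: measurableU => //; apply: bigcupT_measurable_rat => k.
  by have [] := HAN k.
have N0 : dA N = 0%E.
  have : dA.-negligible N.
    apply: negligibleU; first (exists M; split; [exact: mM|exact: M0|by []]).
    (* The union over the rationals is reindexed by the natural numbers through [pickle]. *)
    rewrite (_ : \bigcup_k (AN k).2 = \bigcup_n
        (if unpickle n is Some k then (AN k).2 else set0)).
      apply: negligible_bigcup => n; case: (unpickle n) => [k|]; last exact: negligible_set0.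
      by have [_ m k0 _] := HAN k; exists (AN k).2; split; [exact: m|exact: k0|by []].
    apply/seteqP; split=> p [k _ kp]; last first.
      by case: (unpickle k) kp => // k' k'p; exists k'.
    by exists (pickle k); [exact: I|rewrite pickleK].
  by move/measure_negligible; apply.
pose E := (cplx @^-1` unit_disc) `\` N.
(* The value 1 off E makes v positive on the whole plane, so that negative powers of v never meet
   the value at 0. *)
pose v := (fun p => if p \in E then w (cplx p) else 1 : R).
have mE : measurable E by exact: measurableD.
exists v, N; split => //.
- move=> mT; apply: (measurability _ (RGenOInfty.measurableE R)) => //.
  move=> /= _ [_ [a ->] <-]; rewrite setTI preimage_itvoy.
  have -> : [set p | a < v p] = (E `&` \bigcup_k (if a < ratr k then (AN k).1 else set0))
     `|` (~` E `&` [set p | a < 1]).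
    apply/seteqP; split=> p.
      rewrite /= /v; case: ifPn; rewrite ?inE ?notin_setE => Ep av; last by right.
      left; split => //; case: (Ep) => Dp Np.
      have [k] := rat_in_itvoo av; rewrite in_itv /= => /andP[ak kw].
      exists k => //; rewrite ak; have [_ _ _ H] := HAN k.
      by apply/H; [move=> ?; apply: Np; right; exists k|split].
    case=> -[Ep]; last by rewrite /= /v memNset.
    move=> [k _]; case: ifPn => // ak Ak; rewrite /= /v mem_set//.
    case: (Ep) => Dp Np; have [_ _ _ H] := HAN k.
    have [|_ kw] := (H p _).2 Ak; last exact: lt_trans kw.
    by move=> ?; apply: Np; right; exists k.
  apply: measurableU; apply: measurableI => //.
  + apply: bigcupT_measurable_rat => k; case: ifP => // _.
    by have [] := HAN k.
  + exact: measurableC.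
  + by case: (a < 1) => /=; [rewrite set_true|rewrite set_false].
- move=> p; rewrite /v; case: ifPn => // /[!inE] -[Dp Np].
  apply: contrapT => wp; apply: Np; left; apply: wM => /= H.
  exact: wp (H Dp).
- by move=> p Dp Np; rewrite /v mem_set.
Qed.

End BorelVersion.

Section Weights.
Context {R : realType}.

Lemma measurable_unit_disc : measurable (cplx @^-1` (@unit_disc R)).
Proof. exact: measurable_disc. Qed.

Lemma square_sub_disc (c : R[i]) (rho r : R) : 2 * rho < r ->
  square c rho `<=` cplx @^-1` disc c r.
Proof.
move=> rr p /squareP[h1 h2]; rewrite /disc /=.
by apply: (le_lt_trans (cabs_le_ReIm _)); rewrite -ReB -ImB; lra.
Qed.

Lemma integral_gt0 (v : R * R -> R) (E : set (R * R)) (c : R[i]) (rho : R) :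
  measurable_fun setT v -> (forall p, 0 < v p) -> measurable E -> 0 < rho ->
  square c rho `<=` E -> (0 < \int[dA]_(p in E) (v p)%:E)%E.
Proof.
move=> mv v0 mE rho0 sE.
have msq := measurable_square c rho.
have mv' D : measurable_fun D (EFin \o v).
  by apply/measurable_EFinP; exact: measurable_funTS.
apply: (@lt_le_trans _ _ (\int[dA]_(p in square c rho) (v p)%:E)%E); last first.
  apply: ge0_subset_integral => //; first exact: mv'.
  by move=> p _; rewrite lee_fin ltW.
rewrite lt_neqAle; apply/andP; split; last first.
  by apply: integral_ge0 => p _; rewrite lee_fin ltW.
apply/eqP => /esym I0.
have : (\int[dA]_(p in square c rho) `|(v p)%:E| = 0)%E.
  rewrite -I0; apply: eq_integral => p _.
  by rewrite gee0_abs// lee_fin ltW.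
have := @ae_eq_integral_abs _ _ _ dA (square c rho) msq (EFin \o v) (mv' _).
move=> [h _] /h [N [mN N0 sN]].
have : (dA (square c rho) <= dA N)%E.
  apply: le_measure; rewrite ?inE//.
  apply: subset_trans sN => p Sp /= /(_ Sp) [] /eqP.
  by rewrite gt_eqF.
by rewrite (dA_square _ (ltW rho0)) [leRHS]N0 lee_fin leNgt !mulr_gt0.
Qed.

Lemma area_disc (c : R[i]) (r : R) : 0 < r ->
  exists2 A : R, dA (cplx @^-1` disc c r) = A%:E & 0 < A <= 4 * r ^+ 2.
Proof.
move=> r0.
have md := measurable_disc c r.
have h1 : (dA (cplx @^-1` disc c r) <= (2 * r * (2 * r))%:E)%E.
  rewrite -(dA_square c (ltW r0)); apply: le_measure; rewrite ?inE//.
    exact: measurable_square.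
  move=> p; rewrite /= /disc /= => h; apply/squareP; rewrite ReB ImB.
  by split; apply: le_trans (ltW h); [exact: Re_le_cabs|exact: Im_le_cabs].
have h2 : ((2 * (r / 4) * (2 * (r / 4)))%:E <= dA (cplx @^-1` disc c r))%E.
  rewrite -(dA_square c (_ : 0 <= r / 4)); last lra.
  apply: le_measure; rewrite ?inE//; first exact: measurable_square.
  by apply: square_sub_disc; lra.
case: (dA _) h1 h2 => [A| |//]; rewrite ?lee_fin => h1 h2; last by [].
exists A => //; apply/andP; split; last by rewrite expr2; lra.
by apply: lt_le_trans h2; apply: mulr_gt0; lra.
Qed.

(** The condition for the Borel version of the weight, restricted to open discs that contain a point
    of the circle. *)
Definition bekolle_bonami_bound (v : R * R -> R) (q Cb : R) : Prop :=
  forall (c : R[i]) (r : R), 0 < r ->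
  (exists e, disc c r e /\ cabs e = 1) ->
  (((dA (cplx @^-1` disc c r))^-1 *
     \int[dA]_(z in cplx @^-1` (disc c r `&` unit_disc)) (v z)%:E) *
   ((dA (cplx @^-1` disc c r))^-1 *
     \int[dA]_(z in cplx @^-1` (disc c r `&` unit_disc))
        (v z `^ (- (q - 1)^-1))%:E) `^ (q - 1) <= Cb%:E)%E.

Section BekolleBonami.
Variables (v : R * R -> R) (q Cb : R).
Hypothesis mv : measurable_fun setT v.
Hypothesis v0 : forall p, 0 < v p.
Hypothesis q1 : 1 < q.
Hypothesis bb : bekolle_bonami_bound v q Cb.

(** Both integrals are positive because the intersection contains a square about c, so neither can
    be infinite without making the product infinite. The two averages contribute the area to the
    power q, which is at most (4 r^2)^q. *)
Lemma bekolle_bonami_real (c : R[i]) (r : R) : cabs c < 1 -> 0 < r ->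
  (exists e, disc c r e /\ cabs e = 1) ->
  exists W J : R, [/\ 0 < W, 0 < J,
    (\int[dA]_(z in cplx @^-1` (disc c r `&` unit_disc)) (v z)%:E = W%:E)%E,
    (\int[dA]_(z in cplx @^-1` (disc c r `&` unit_disc))
        (v z `^ (- (q - 1)^-1))%:E = J%:E)%E &
    W * J `^ (q - 1) <= Cb * (4 * r ^+ 2) `^ q].
Proof.
move=> c1 r0 he; have := @bb c r r0 he.
have [A -> /andP[A0 Ar]] := area_disc c r0.
have mE : measurable (cplx @^-1` (disc c r `&` unit_disc)).
  apply: measurableI; [exact: measurable_disc|exact: measurable_unit_disc].
pose rho := Num.min (r / 4) ((1 - cabs c) / 4).
have rho0 : 0 < rho by rewrite lt_min; apply/andP; split; lra.
have rho1 : rho <= r / 4 by rewrite ge_min lexx.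
have rho2 : rho <= (1 - cabs c) / 4 by rewrite ge_min lexx orbT.
have sE : square c rho `<=` cplx @^-1` (disc c r `&` unit_disc).
  move=> p Sp; split; first by apply: square_sub_disc Sp; lra.
  rewrite unit_discE; have /squareP[h1 h2] := Sp.
  by have := square_in_disc h1 h2; lra.
have X0 := integral_gt0 mv v0 mE rho0 sE.
have Y0 : (0 < \int[dA]_(z in cplx @^-1` (disc c r `&` unit_disc))
        (v z `^ (- (q - 1)^-1))%:E)%E.
  apply: integral_gt0 mE rho0 sE; first exact: measurable_powR_comp.
  by move=> p; rewrite powR_gt0.
move: (\int[dA]_(z in _) (v z)%:E)%E X0 => X X0.
move: (\int[dA]_(z in _) _)%E Y0 => Y Y0.
rewrite inver gt_eqF//.
have iA0 : 0 < A^-1 by rewrite invr_gt0.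
have q10 : 0 < q - 1 by rewrite subr_gt0.
case: Y Y0 => [J| |//] Y0; last first.
  rewrite gt0_muley ?lte_fin// poweRyr ?gt_eqF// gt0_muley ?leye_eq//.
  by rewrite mule_gt0// lte_fin.
case: X X0 => [W| |//] X0; last first.
  rewrite gt0_muley ?lte_fin// gt0_mulye ?leye_eq//.
  by rewrite poweR_gt0// mule_gt0// lte_fin.
rewrite !lte_fin in X0 Y0.
rewrite -(EFinM A^-1 W) -(EFinM A^-1 J) poweR_EFin -EFinM lee_fin => H.
exists W, J; split => //.
have q0 : 0 < q by lra.
have AqE : A * A `^ (q - 1) = A `^ q := mulr_powRB1 (ltW A0) q0.
apply: (@le_trans _ _ (Cb * A `^ q)); last first.
  rewrite ler_wpM2l//.
    apply: le_trans H; apply: mulr_ge0; last exact: powR_ge0.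
    by apply: mulr_ge0; exact: ltW.
  by apply: powR_le; [lra|exact: ltW|].
have AP : 0 < A `^ (q - 1) by rewrite powR_gt0.
have AA : 0 < A * A `^ (q - 1) by rewrite mulr_gt0.
rewrite -AqE -ler_pdivrMr//; apply: le_trans H; rewrite le_eqVlt; apply/orP; left; apply/eqP.
rewrite powRM; [|exact: ltW..].
have -> : A^-1 `^ (q - 1) = (A `^ (q - 1))^-1.
  by rewrite -(powR_inv1 (ltW A0)) powRAC powR_inv1 ?powR_ge0.
by field; rewrite !gt_eqF.
Qed.

(** The disc of radius 2 about 0 reaches the circle and contains the unit disc. *)
Lemma weight_integrable_disc : (\int[dA]_(z in cplx @^-1` unit_disc) (v z)%:E < +oo)%E.
Proof.
have c1 : cabs (0 : R[i]) < 1 by rewrite cabs0.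
have he : exists e, disc (0 : R[i]) 2 e /\ cabs e = 1.
  exists 1; split; last exact: cabs1.
  have : cabs (1 - 0 : R[i]) < 2 by rewrite subr0 cabs1 ltr1n.
  by [].
have [W [J [_ _ H _ _]]] := bekolle_bonami_real c1 (ltr0Sn R 1) he.
rewrite (_ : cplx @^-1` unit_disc = cplx @^-1` (disc 0 2 `&` unit_disc)) ?H ?ltry//.
apply/seteqP; split=> p; last by case.
by move=> h; split => //; move: h; rewrite /= /disc /= => /lt_trans; apply; rewrite ltr1n.
Qed.

End BekolleBonami.
End Weights.

(** * Increments along a radius *)

Section PowerInequalities.
Context {R : realType}.

Lemma powRD_le (p a b : R) : 0 < p -> 0 <= a -> 0 <= b ->
  (a + b) `^ p <= 2 `^ p * (a `^ p + b `^ p).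
Proof.
move=> p0 a0 b0; wlog ab : a b a0 b0 / a <= b.
  move=> H; have [/H|/ltW/H] := leP a b; first exact.
  by rewrite addrC [b `^ p + _]addrC; exact.
apply: (@le_trans _ _ ((2 * b) `^ p)).
  by apply: powR_le; [exact: ltW|exact: addr_ge0|lra].
rewrite powRM ?ler0n// ler_wpM2l ?powR_ge0//.
by rewrite lerDr powR_ge0.
Qed.

(** Let k satisfy (1 + k)^p = 1 + eta. Either b <= k a, and the first term suffices, or a < b / k,
    and the second does. *)
Lemma powRD_le_eps (p eta : R) : 0 < p -> 0 < eta ->
  exists2 C : R, 0 < C & forall a b, 0 <= a -> 0 <= b ->
    (a + b) `^ p <= (1 + eta) * a `^ p + C * b `^ p.
Proof.
move=> p0 eta0.
pose k := (1 + eta) `^ p^-1 - 1.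
have e1 : 1 < 1 + eta by rewrite ltrDl.
have k0 : 0 < k.
  have := @gt0_ltr_powR _ p^-1 _ 1 (1 + eta).
  rewrite invr_gt0 => /(_ p0); rewrite !nnegrE ler01 => /(_ isT _ e1).
  rewrite powR1 /k subr_gt0; apply; exact: ltW (lt_trans ltr01 e1).
have kE : (1 + k) `^ p = 1 + eta.
  rewrite /k addrC subrK -powRrM mulVf ?gt_eqF// powRr1//.
  exact: ltW (lt_trans ltr01 e1).
have C0 : 0 < k^-1 + 1 by rewrite addr_gt0// invr_gt0.
exists ((k^-1 + 1) `^ p); first by rewrite powR_gt0.
move=> a b a0 b0; have [bk|bk] := leP b (k * a).
  apply: (@le_trans _ _ (((1 + k) * a) `^ p)).
    by apply: powR_le; [exact: ltW|exact: addr_ge0|lra].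
  rewrite powRM//; last by rewrite addr_ge0// ltW.
  by rewrite kE lerDl mulr_ge0 ?powR_ge0.
apply: (@le_trans _ _ (((k^-1 + 1) * b) `^ p)).
  apply: powR_le; [exact: ltW|exact: addr_ge0|].
  by rewrite mulrDl mul1r lerD2r mulrC ler_pdivlMr// mulrC ltW.
rewrite powRM ?(ltW C0)// lerDr mulr_ge0 ?powR_ge0//.
exact: ltW (lt_trans ltr01 e1).
Qed.

End PowerInequalities.

Section LocalStep.
Context {R : realType}.
Variables (v : R * R -> R) (p q Cb : R).
Hypothesis mv : measurable_fun setT v.
Hypothesis v0 : forall z, 0 < v z.
Hypothesis p0 : 0 < p.
Hypothesis q1 : 1 < q.
Hypothesis Cb0 : 0 < Cb.
Hypothesis bb : bekolle_bonami_bound v q Cb.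

Section Increment.
Variables (f F : R[i] -> R[i]).
Hypothesis fF : forall z, cabs z < 1 -> cdiff f z (F z).

Definition oscillation (z : R[i]) : R := cabs (f z - f 0).
Definition scaled_derivative (z : R[i]) : R := (1 - cabs z) * cabs (F z).
(** The midpoint of the segment of the radius e between 1 - t and 1 - t / 2, that is, of one dyadic
    level when t is a power of 1/2. Its distance to the circle is 3 t / 4, so the disc of radius 2 t
    about it contains e. *)
Definition whitney_center (e : R[i]) (t : R) : R[i] := (1 - 3 / 4 * t)%:C * e.

Section Whitney.
Variables (e : R[i]) (t W J : R).
Hypothesis e1 : cabs e = 1.
Hypothesis t0 : 0 < t.
Hypothesis t1 : t <= 1.
Local Notation x := (whitney_center e t).
Hypothesis W0 : 0 < W.
Hypothesis J0 : 0 < J.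
Hypothesis HW :
  (\int[dA]_(z in cplx @^-1` (disc x (2 * t) `&` unit_disc)) (v z)%:E = W%:E)%E.
Hypothesis HJ : (\int[dA]_(z in cplx @^-1` (disc x (2 * t) `&` unit_disc))
        (v z `^ (- (q - 1)^-1))%:E = J%:E)%E.
Hypothesis WJ : W * J `^ (q - 1) <= Cb * (4 * (2 * t) ^+ 2) `^ q.

Lemma cabs_whitney_center : cabs x = 1 - 3 / 4 * t.
Proof.
have t0' := t0; have t1' := t1.
by rewrite /whitney_center cabsM e1 mulr1 cabs_real ger0_norm//; lra. Qed.

Lemma whitney_sub rho : rho <= 5 / 8 * t ->
  cplx @^-1` disc x rho `<=` cplx @^-1` (disc x (2 * t) `&` unit_disc).
Proof.
have t0' := t0; have t1' := t1.
move=> rt z h; have {}h : cabs (cplx z - x) < rho := h.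
split; first by have : cabs (cplx z - x) < 2 * t by lra.
rewrite unit_discE; have := cabs_dist (cplx z) x 0; rewrite !subr0.
by rewrite cabs_whitney_center; lra.
Qed.

Lemma whitney_weight_le (g : R * R -> R) rho : rho <= 5 / 8 * t ->
  measurable_fun setT g -> (forall z, 0 < g z) ->
  (\int[dA]_(z in cplx @^-1` disc x rho) (g z)%:E <=
   \int[dA]_(z in cplx @^-1` (disc x (2 * t) `&` unit_disc)) (g z)%:E)%E.
Proof.
have t0' := t0; have t1' := t1.
move=> rt mg g0; apply: ge0_subset_integral => //.
- exact: measurable_disc.
- by apply: measurableI; [exact: measurable_disc|exact: measurable_unit_disc].
- by apply/measurable_EFinP; exact: measurable_funTS.
- by move=> z _; rewrite lee_fin ltW.
- exact: whitney_sub.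
Qed.

(* The Bekolle-Bonami inequality turns a bound by the product i J^(q-1) into a
   bound by i / W. *)
Lemma whitney_exchange (rho a i K : R) : 0 < rho -> 0 <= a -> 0 <= i -> 0 <= K ->
  a * ((rho * t) ^+ 2) `^ q <= K * i * J `^ (q - 1) ->
  a * W <= K * Cb * (16 / rho ^+ 2) `^ q * i.
Proof.
have t0' := t0; have t1' := t1.
move=> rho0 a0 i0 K0 H.
have T0 : 0 < (t ^+ 2) `^ q by rewrite powR_gt0// exprn_gt0.
have r20 : 0 < rho ^+ 2 by rewrite exprn_gt0.
have t20 : 0 <= t ^+ 2 by rewrite exprn_ge0// ltW.
have P0 : 0 < (rho ^+ 2) `^ q by rewrite powR_gt0.
rewrite exprMn powRM ?(ltW r20)// in H.
have E : (4 * (2 * t) ^+ 2) `^ q = (16 / rho ^+ 2) `^ q * (rho ^+ 2) `^ q * (t ^+ 2) `^ q.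
  have c0 : 0 <= 16 / rho ^+ 2 by apply: divr_ge0; [rewrite ler0n|exact: ltW].
  have c1 := mulr_ge0 c0 (ltW r20).
  rewrite -(powRM _ c0 (ltW r20)) -(powRM _ c1 t20).
  by congr (_ `^ _); field; rewrite gt_eqF.
rewrite -(ler_pM2r (mulr_gt0 P0 T0)).
have h1 := ler_wpM2r (ltW W0) H.
have h2 := ler_wpM2l (mulr_ge0 K0 i0) WJ.
rewrite E in h2.
have -> : a * W * ((rho ^+ 2) `^ q * (t ^+ 2) `^ q) =
  a * ((rho ^+ 2) `^ q * (t ^+ 2) `^ q) * W by ring.
apply: (le_trans h1).
have -> : K * i * J `^ (q - 1) * W = K * i * (W * J `^ (q - 1)) by ring.
apply: (le_trans h2); rewrite le_eqVlt; apply/orP; left; apply/eqP.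
ring.
Qed.

Definition derivative_constant : R :=
  reverse_holder_constant p q * Cb * (16 / (5 / 8) ^+ 2) `^ q * 8 `^ p.

Definition doubling_constant : R :=
  reverse_holder_constant 1 q * Cb * (16 / (1 / 4) ^+ 2) `^ q.

(** The reverse Hoelder inequality on the disc of radius 5/8 t holds within 3/5 * 5/8 t = 3/8 t of
    the center. On that disc 1 - |z| > t / 8, so passing from |F| to the scaled derivative costs (8
    / t)^p. *)
Lemma whitney_derivative (U : R) : 0 <= U ->
  (\int[dA]_(z in cplx @^-1` disc x (5 / 8 * t))
     (scaled_derivative (cplx z) `^ p * v z)%:E <= U%:E)%E ->
  forall y, cabs (y - x) <= 3 / 8 * t ->
  (t * cabs (F y)) `^ p * W <= derivative_constant * U.
Proof.
have t0' := t0; have t1' := t1.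
move=> U0 HU y yx.
have rho0 : 0 < 5 / 8 * t by lra.
pose i := (8 / t) `^ p * U.
have i0 : 0 <= i by rewrite mulr_ge0 ?powR_ge0.
have inD z : cabs (z - x) < 5 / 8 * t -> t / 8 < 1 - cabs z /\ cabs z < 1.
  move=> h; have := cabs_dist z x 0; rewrite !subr0 cabs_whitney_center; lra.
have md := measurable_disc x (5 / 8 * t).
have mF : measurable_fun (cplx @^-1` disc x (5 / 8 * t)) (fun z => cabs (F (cplx z))).
  apply: ccont_measurable_cabs => z h; apply: (derivative_ccont fF).
  by have [] := inD _ h.
have mu : measurable_fun (cplx @^-1` disc x (5 / 8 * t))
    (fun z => scaled_derivative (cplx z) `^ p * v z).
  apply: measurable_funM; last exact: measurable_funTS.
  apply: measurable_powR_comp; apply: measurable_funM => //.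
  apply: measurable_funB => //; apply: (@ccont_measurable_cabs _ _ (fun z => z)) => z _.
  exact: (@ccont_id _ (cplx z)).
have mFp : measurable_fun (cplx @^-1` disc x (5 / 8 * t))
    (fun z => cabs (F (cplx z)) `^ p * v z).
  by apply: measurable_funM; [exact: measurable_powR_comp|exact: measurable_funTS].
have t80 : 0 < 8 / t by rewrite divr_gt0// ltr0n.
have Hi : (\int[dA]_(z in cplx @^-1` disc x (5 / 8 * t))
     (cabs (F (cplx z)) `^ p * v z)%:E <= i%:E)%E.
  apply: (@le_trans _ _ (\int[dA]_(z in cplx @^-1` disc x (5 / 8 * t))
     (((8 / t) `^ p)%:E * (scaled_derivative (cplx z) `^ p * v z)%:E))%E).
    apply: ge0_le_integral => //.
    - by move=> z _; rewrite lee_fin mulr_ge0 ?powR_ge0// ltW.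
    - exact/measurable_EFinP.
    - by apply: measurable_funeM; exact/measurable_EFinP.
    - move=> z /inD [h1 h2]; rewrite -EFinM lee_fin mulrA ler_wpM2r ?(ltW (v0 z))//.
      rewrite -powRM ?(ltW t80)//; last by rewrite mulr_ge0 ?cabs_ge0//; lra.
      apply: powR_le; [exact: ltW|exact: cabs_ge0|].
      rewrite /scaled_derivative mulrA ler_peMl ?cabs_ge0//.
      by rewrite mulrAC ler_pdivlMr// mul1r; lra.
  rewrite ge0_integralZl_EFin//=; last 3 first.
  - by move=> z _; rewrite lee_fin mulr_ge0 ?powR_ge0// ltW.
  - exact/measurable_EFinP.
  - exact: powR_ge0.
  by rewrite /i EFinM; apply: lee_wpmul2l => //; rewrite lee_fin powR_ge0.
have HJ' : (\int[dA]_(z in cplx @^-1` disc x (5 / 8 * t))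
    (v z `^ (- (q - 1)^-1))%:E <= J%:E)%E.
  rewrite -HJ; apply: whitney_weight_le => //; first exact: measurable_powR_comp.
  by move=> z; rewrite powR_gt0.
have xr : cabs x + 5 / 8 * t < 1 by rewrite cabs_whitney_center; lra.
have := reverse_holder fF mv v0 p0 q1 J0 i0 rho0 xr Hi HJ' (y := y).
have yx' : cabs (y - x) <= 3 / 5 * (5 / 8 * t) by lra.
move=> /(_ yx').
move/(whitney_exchange _ (powR_ge0 _ _) i0 (ltW (reverse_holder_constant_gt0 p q))).
have r580 : 0 < 5 / 8 :> R by lra.
move=> /(_ r580) H.
have tp0 : 0 <= t `^ p by exact: powR_ge0.
rewrite powRM ?cabs_ge0 ?(ltW t0)//.
have h := ler_wpM2l tp0 H; rewrite -mulrA; apply: (le_trans h).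
have tE : t `^ p * (8 / t) `^ p = 8 `^ p.
  rewrite -powRM ?(ltW t0) ?(ltW t80)//; congr (_ `^ _).
  by field; rewrite gt_eqF.
rewrite /derivative_constant /i -tE le_eqVlt; apply/orP; left; apply/eqP.
by move: (reverse_holder_constant p q) => ?; ring.
Qed.

(** The reverse Hoelder inequality for f(z) = z, F = 1 and exponent 1 in place of p, evaluated at
    the center: the small concentric disc carries a fixed share of the weight. *)
Lemma whitney_doubling (b : R) : 0 <= b ->
  (\int[dA]_(z in cplx @^-1` disc x (1 / 4 * t)) (v z)%:E <= b%:E)%E ->
  W <= doubling_constant * b.
Proof.
have t0' := t0; have t1' := t1.
move=> b0 Hb.
have rho0 : 0 < 1 / 4 * t by lra.
have HJ' : (\int[dA]_(z in cplx @^-1` disc x (1 / 4 * t))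
    (v z `^ (- (q - 1)^-1))%:E <= J%:E)%E.
  rewrite -HJ; apply: whitney_weight_le; [lra|exact: measurable_powR_comp|].
  by move=> z; rewrite powR_gt0.
have xr : cabs x + 1 / 4 * t < 1 by rewrite cabs_whitney_center; lra.
have idF z : cabs z < 1 -> cdiff (fun z : R[i] => z) z 1 by move=> _; exact: cdiff_id.
have Hb' : (\int[dA]_(z in cplx @^-1` disc x (1 / 4 * t))
    (cabs (1 : R[i]) `^ 1 * v z)%:E <= b%:E)%E.
  by apply: le_trans Hb; under eq_integral do rewrite cabs1 powR1 mul1r.
have := reverse_holder idF mv v0 ltr01 q1 J0 b0 rho0 xr Hb' HJ' (y := x).
rewrite subrr cabs0 cabs1 => /(_ _).
have h : 0 <= 3 / 5 * (1 / 4 * t) by lra.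
move=> /(_ h) /(whitney_exchange _ (powR_ge0 _ _) b0
  (ltW (reverse_holder_constant_gt0 1 q))).
have r140 : 0 < 1 / 4 :> R by lra.
by move=> /(_ r140); rewrite powR1 mul1r.
Qed.

(** The segment from y' to y stays in the disc, where |F| <= A / t, and has length at most t. *)
Lemma whitney_oscillation (A : R) (y y' : R[i]) :
  (forall z, cabs (z - x) <= 3 / 8 * t -> t * cabs (F z) <= A) ->
  cabs (y - x) <= 3 / 8 * t -> cabs (y' - x) <= 3 / 8 * t ->
  oscillation y <= oscillation y' + 2 * A.
Proof.
have t0' := t0; have t1' := t1.
move=> HA yx y'x.
have A0 : 0 <= A by apply: le_trans (HA y yx); rewrite mulr_ge0 ?cabs_ge0// ltW.
have seg (s : R) : 0 <= s <= 1 -> cabs (y' + s%:C * (y - y') - x) <= 3 / 8 * t.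
  move=> s01; have -> : y' + s%:C * (y - y') - x =
      s%:C * (y - x) + (1 - s)%:C * (y' - x) by rewrite rmorphB/=; ring.
  apply: (le_trans (cabsD _ _)); rewrite !cabsM !cabs_real.
  rewrite !ger0_norm; try lra.
  have := ler_wpM2l (_ : 0 <= s) yx; have := ler_wpM2l (_ : 0 <= 1 - s) y'x; lra.
have := @mean_value_inequality _ f F y' y (A / t) _.
have H (s : R) : 0 <= s <= 1 -> cdiff f (y' + s%:C * (y - y')) (F (y' + s%:C * (y - y'))) /\
    cabs (F (y' + s%:C * (y - y'))) <= A / t.
  move=> /seg h; split; last by rewrite ler_pdivlMr// mulrC; exact: HA.
  apply: fF; have := cabs_dist (y' + s%:C * (y - y')) x 0.
  by rewrite !subr0 cabs_whitney_center; lra.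
move=> /(_ H) k.
have yy : cabs (y - y') <= t by have := cabs_dist y x y'; rewrite (cabsB x y'); lra.
have : 2 * (A / t) * cabs (y - y') <= 2 * A.
  have -> : 2 * (A / t) * cabs (y - y') = 2 * A * (cabs (y - y') / t) by ring.
  rewrite ler_piMr//; first lra.
  by rewrite ler_pdivrMr// mul1r.
have := cabs_dist (f y) (f y') (f 0); rewrite /oscillation; lra.
Qed.

End Whitney.

Lemma doubling_constant_gt0 : 0 < doubling_constant.
Proof.
apply: mulr_gt0; last first.
  by apply: powR_gt0; apply: divr_gt0; [rewrite ltr0n|apply: exprn_gt0; lra].
by apply: mulr_gt0 => //; exact: reverse_holder_constant_gt0.
Qed.

Lemma derivative_constant_gt0 : 0 < derivative_constant.
Proof.
apply: mulr_gt0; last by apply: powR_gt0; rewrite ltr0n.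
apply: mulr_gt0; last first.
  by apply: powR_gt0; apply: divr_gt0; [rewrite ltr0n|apply: exprn_gt0; lra].
by apply: mulr_gt0 => //; exact: reverse_holder_constant_gt0.
Qed.

(** The power of a sum produces an excess eta |h(z0)|^p at the inner end z0 of the level. On the
    disc of radius t / 4 the function |h| varies by at most 2 A, so |h(z0)|^p is at most a constant
    times the weighted mean of |h|^p there plus A^p; doubling puts W in place of the weight of the
    small disc. *)
Lemma local_increment (eta Ce : R) : 0 < eta ->
  (forall a b, 0 <= a -> 0 <= b ->
     (a + b) `^ p <= (1 + eta) * a `^ p + Ce * b `^ p) ->
  forall (e : R[i]) (t U Phi : R), cabs e = 1 -> 0 < t ->
  t <= 1 -> 0 <= U -> 0 <= Phi ->
  (\int[dA]_(z in cplx @^-1` disc (whitney_center e t) (5 / 8 * t))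
     (scaled_derivative (cplx z) `^ p * v z)%:E <= U%:E)%E ->
  (\int[dA]_(z in cplx @^-1` disc (whitney_center e t) (1 / 4 * t))
     (oscillation (cplx z) `^ p * v z)%:E <= Phi%:E)%E ->
  exists2 W : R, 0 < W /\
    (\int[dA]_(z in cplx @^-1` (disc (whitney_center e t) (2 * t) `&` unit_disc))
       (v z)%:E = W%:E)%E &
  forall s, 1 - t <= s <= 1 - t / 2 ->
    oscillation (s%:C * e) `^ p <= oscillation ((1 - t)%:C * e) `^ p +
      W^-1 * (eta * (doubling_constant * 2 `^ p) * Phi +
        (eta * (doubling_constant * 2 `^ p) * (2 `^ p * derivative_constant) +
         Ce * (2 `^ p * derivative_constant)) * U).
Proof.
move=> eta0 HCe.
have [K2 K2E] : exists K, K = doubling_constant by exists doubling_constant.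
have [K1 K1E] : exists K, K = derivative_constant by exists derivative_constant.
have D0 : 0 < K2 by rewrite K2E; exact: doubling_constant_gt0.
have K10 : 0 < K1 by rewrite K1E; exact: derivative_constant_gt0.
have tp0 : 0 < 2 `^ p :> R by rewrite powR_gt0.
rewrite -K1E -K2E.
move=> e t U Phi e1 t0 t1 U0 Phi0 HU HPhi.
have xc := cabs_whitney_center e1 t0 t1.
set x := whitney_center e t in xc HU HPhi *.
have on_ray s : 1 - t <= s <= 1 - t / 2 -> cabs (s%:C * e - x) <= 1 / 4 * t.
  move=> sP; rewrite /x /whitney_center -mulrBl -rmorphB/= cabsM e1 mulr1 cabs_real.
  by rewrite ler_norml; lra.
have he : exists e', disc x (2 * t) e' /\ cabs e' = 1.
  exists e; split => //; have : cabs (e - x) < 2 * t; last by [].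
  have -> : e - x = (3 / 4 * t)%:C * e.
    rewrite /x /whitney_center -{1}[e]mul1r -mulrBl; congr (_ * e).
    by rewrite rmorphB/= rmorph1; ring.
  by rewrite cabsM e1 mulr1 cabs_real ger0_norm; lra.
have x1 : cabs x < 1 by rewrite xc; lra.
have t20 : 0 < 2 * t by lra.
have [W [J [W0 J0 HW HJ WJ]]] := bekolle_bonami_real mv v0 q1 bb x1 t20 he.
exists W => // s sP.
(* The choice gives A^p W = K1 U, so [whitney_derivative] says that t |F| <= A near x. *)
pose A := (K1 * U / W) `^ p^-1.
have KUW : 0 <= K1 * U / W by rewrite divr_ge0 ?(ltW W0)// mulr_ge0// ltW.
have A0 : 0 <= A by exact: powR_ge0.
have AE : A `^ p * W = K1 * U.
  by rewrite /A -powRrM mulVf ?gt_eqF// powRr1// divfK// gt_eqF.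
have HA z : cabs (z - x) <= 3 / 8 * t -> t * cabs (F z) <= A.
  move=> zx; have h := whitney_derivative e1 t0 t1 W0 J0 HJ WJ U0 HU zx.
  rewrite -K1E in h.
  have tz : 0 <= t * cabs (F z) by rewrite mulr_ge0 ?cabs_ge0// ltW.
  have {}h : (t * cabs (F z)) `^ p <= K1 * U / W by rewrite ler_pdivlMr.
  have := powR_le (_ : 0 <= p^-1) (powR_ge0 _ _) h.
  rewrite -powRrM divff ?gt_eqF// powRr1// /A; apply.
  by rewrite invr_ge0 ltW.
have osc0 z : 0 <= oscillation z by exact: cabs_ge0.
have A20 : 0 <= 2 * A by lra.
have z0x := on_ray (1 - t) ltac:(lra).
set z0 := (1 - t)%:C * e in z0x *.
have step1 : oscillation (s%:C * e) `^ p <=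
    (1 + eta) * oscillation z0 `^ p + Ce * (2 * A) `^ p.
  apply: le_trans (HCe _ _ (osc0 _) A20).
  apply: powR_le; [exact: ltW|exact: osc0|].
  by apply: (whitney_oscillation e1 t0 t1 HA); have := on_ray s sP; lra.
have mf : measurable_fun (cplx @^-1` disc x (1 / 4 * t)) (fun z => oscillation (cplx z)).
  apply: (@ccont_measurable_cabs _ _ (fun z => f z - f 0)) => z h.
  apply: ccontB; last exact: ccont_cst.
  apply: cdiff_ccont; apply: fF; have {}h : cabs (cplx z - x) < 1 / 4 * t := h.
  by have := cabs_dist (cplx z) x 0; rewrite !subr0 xc; lra.
have md := measurable_disc x (1 / 4 * t).
have mvd : measurable_fun (cplx @^-1` disc x (1 / 4 * t)) v by exact: measurable_funTS.
have bW : (\int[dA]_(z in cplx @^-1` disc x (1 / 4 * t)) (v z)%:E <= W%:E)%E.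
  by rewrite -HW; apply: whitney_weight_le => //; lra.
have [b b0 Hb] : exists2 b : R, 0 <= b &
    (\int[dA]_(z in cplx @^-1` disc x (1 / 4 * t)) (v z)%:E = b%:E)%E.
  have I0 : (0 <= \int[dA]_(z in cplx @^-1` disc x (1 / 4 * t)) (v z)%:E)%E.
    by apply: integral_ge0 => z _; rewrite lee_fin ltW.
  have Ifin : (\int[dA]_(z in cplx @^-1` disc x (1 / 4 * t)) (v z)%:E)%E \is a fin_num.
    by rewrite ge0_fin_numE// (le_lt_trans bW)// ltry.
  exists (fine (\int[dA]_(z in cplx @^-1` disc x (1 / 4 * t)) (v z)%:E)%E).
    exact: fine_ge0.
  by rewrite fineK.
rewrite Hb lee_fin in bW.
have Wb : W <= K2 * b.
  by rewrite K2E; apply: (whitney_doubling e1 t0 t1 W0 J0 HJ WJ b0); rewrite Hb.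
(* The inequality |h(z0)|^p <= 2^p (|h(z)|^p + (2 A)^p) is integrated against v over the disc of
   radius t / 4, of weight b. *)
have avg : oscillation z0 `^ p * b <= 2 `^ p * (Phi + (2 * A) `^ p * b).
  rewrite -lee_fin EFinM -Hb.
  apply: (@le_trans _ _ (\int[dA]_(z in cplx @^-1` disc x (1 / 4 * t))
     (0 + (2 `^ p * (oscillation (cplx z) `^ p * v z) +
        2 `^ p * (2 * A) `^ p * v z))%:E)%E).
    rewrite -ge0_integralZl_EFin//; last 3 first.
    - by move=> z _; rewrite lee_fin ltW.
    - exact/measurable_EFinP.
    - exact: powR_ge0.
    apply: ge0_le_integral => //.
    - by move=> z _; rewrite -EFinM lee_fin mulr_ge0 ?powR_ge0// ltW.
    - by apply: measurable_funeM; exact/measurable_EFinP.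
    - apply/measurable_EFinP; apply: measurable_funD => //.
      apply: measurable_funD; apply: measurable_funM => //.
      by apply: measurable_funM => //; exact: measurable_powR_comp.
    - move=> z h; have {}h : cabs (cplx z - x) < 1 / 4 * t := h.
      rewrite -EFinM lee_fin add0r mulrA -mulrDl ler_wpM2r ?(ltW (v0 z))//.
      rewrite -mulrDr; apply: le_trans (powRD_le p0 (osc0 _) A20).
      apply: powR_le; [exact: ltW|exact: osc0|].
      by apply: (whitney_oscillation e1 t0 t1 HA); lra.
  rewrite ge0_integral_affine//; last 4 first.
  - by apply: measurable_funM => //; exact: measurable_powR_comp.
  - by move=> z _; rewrite mulr_ge0 ?powR_ge0// ltW.
  - by move=> z _; exact: ltW.
  - by rewrite mulr_ge0 ?powR_ge0// ltW.
  rewrite mul0e add0e Hb mulrDr EFinD mulrA; apply: leeD; last by rewrite -EFinM.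
  by rewrite EFinM; apply: lee_wpmul2l => //; rewrite lee_fin ltW.
have AE2 : (2 * A) `^ p * W = 2 `^ p * (K1 * U).
  by rewrite powRM ?ler0n// -mulrA AE.
have z0W : oscillation z0 `^ p * W <= K2 * 2 `^ p * (Phi + 2 `^ p * (K1 * U)).
  have h1 := ler_wpM2l (powR_ge0 (oscillation z0) p) Wb.
  apply: (le_trans h1); rewrite mulrCA -mulrA ler_wpM2l ?(ltW D0)//.
  apply: (le_trans avg); rewrite ler_wpM2l ?(ltW tp0)// lerD2l -AE2.
  by rewrite ler_wpM2l ?powR_ge0.
apply: (le_trans step1).
rewrite mulrDl mul1r -addrA lerD2l [W^-1 * _]mulrC ler_pdivlMr// mulrDl.
have h1 := ler_wpM2l (ltW eta0) z0W.
have -> : Ce * (2 * A) `^ p * W = Ce * (2 `^ p * (K1 * U)) by rewrite -mulrA AE2.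
rewrite [leLHS]mulrA in h1; apply: (le_trans (lerD h1 (lexx _))).
rewrite le_eqVlt; apply/orP; left; apply/eqP.
ring.
Qed.

End Increment.

(** The order of the quantifiers matters: K3 is fixed before eta, so eta K3 can be made as small as
    the absorption demands, and neither constant depends on f, e or t. *)
Lemma local_step : exists2 K3 : R, 0 < K3 & forall eta, 0 < eta ->
  exists2 Ke : R, 0 < Ke & forall f F : R[i] -> R[i],
  (forall z, cabs z < 1 -> cdiff f z (F z)) ->
  forall (e : R[i]) (t U Phi : R), cabs e = 1 -> 0 < t ->
  t <= 1 -> 0 <= U -> 0 <= Phi ->
  (\int[dA]_(z in cplx @^-1` disc (whitney_center e t) (5 / 8 * t))
     (scaled_derivative F (cplx z) `^ p * v z)%:E <= U%:E)%E ->
  (\int[dA]_(z in cplx @^-1` disc (whitney_center e t) (1 / 4 * t))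
     (oscillation f (cplx z) `^ p * v z)%:E <= Phi%:E)%E ->
  exists2 W : R, 0 < W /\
    (\int[dA]_(z in cplx @^-1` (disc (whitney_center e t) (2 * t) `&` unit_disc))
       (v z)%:E = W%:E)%E &
  forall s, 1 - t <= s <= 1 - t / 2 ->
    oscillation f (s%:C * e) `^ p <= oscillation f ((1 - t)%:C * e) `^ p +
      W^-1 * (eta * K3 * Phi + Ke * U).
Proof.
have D0 := doubling_constant_gt0; have K10 := derivative_constant_gt0.
have tp0 : 0 < 2 `^ p :> R by rewrite powR_gt0.
exists (doubling_constant * 2 `^ p); first exact: mulr_gt0.
move=> eta eta0; have [Ce Ce0 HCe] := powRD_le_eps p0 eta0.
exists (eta * (doubling_constant * 2 `^ p) * (2 `^ p * derivative_constant) +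
         Ce * (2 `^ p * derivative_constant)).
  apply: addr_gt0; last by apply: mulr_gt0 => //; exact: mulr_gt0.
  by apply: mulr_gt0; apply: mulr_gt0 => //; exact: mulr_gt0.
move=> f F fF; exact: (local_increment fF eta0 HCe).
Qed.

End LocalStep.

(** * Summation over the dyadic levels *)

Section PlaneMeasure.
Context {R : realType}.
Local Notation mu := (@lebesgue_measure R).
(* [dA] is not recognised as a sigma-finite measure, which Tonelli's theorem on
   pairs of points of the plane requires. *)
Definition plane_measure : set (measurableTypeR R * measurableTypeR R)%type -> \bar R :=
  @dA R.

HB.instance Definition _ := Measure.copy plane_measure (mu \x mu)%E.

Lemma plane_measure_sigma_finite : sigma_finite setT plane_measure.
Proof.
exists (fun n => square 0 n%:R).
  apply/seteqP; split=> // p _.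
  pose n := Num.bound (Num.max `|p.1| `|p.2|).
  have : Num.max `|p.1| `|p.2| < n%:R.
    by apply: archi_boundP; rewrite le_max normr_ge0.
  rewrite gt_max => /andP[h1 h2].
  by exists n => //; apply/squareP; rewrite /= !subr0; split; exact: ltW.
move=> n; split; first exact: measurable_square.
by rewrite /plane_measure (dA_square _ (ler0n _ _)) ltry.
Qed.

HB.instance Definition _ := Measure_isSigmaFinite.Build _ _ _ plane_measure
  plane_measure_sigma_finite.

Lemma dA_tonelli (k : (R * R) * (R * R) -> \bar R) : measurable_fun setT k ->
  (forall z, 0 <= k z)%E ->
  (\int[dA]_z \int[dA]_w k (z, w) = \int[dA]_w \int[dA]_z k (z, w))%E.
Proof.
move=> mk k0.
exact: (@fubini_tonelli _ _ _ _ R plane_measure plane_measure k mk k0).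
Qed.

Lemma measurable_dA_integral (k : (R * R) * (R * R) -> \bar R) : measurable_fun setT k ->
  (forall z, 0 <= k z)%E -> measurable_fun setT (fun z => \int[dA]_w k (z, w))%E.
Proof.
move=> mk k0.
exact: (@measurable_fun_fubini_tonelli_F _ _ _ _ R plane_measure k mk k0).
Qed.

Lemma measurable_dA_integral2 (k : (R * R) * (R * R) -> \bar R) : measurable_fun setT k ->
  (forall z, 0 <= k z)%E -> measurable_fun setT (fun w => \int[dA]_z k (z, w))%E.
Proof.
move=> mk k0.
exact: (@measurable_fun_fubini_tonelli_G _ _ _ _ R plane_measure k mk k0).
Qed.

Lemma measurable_near (c : R) :
  measurable [set zw : (R * R) * (R * R) | cabs (cplx zw.1 - cplx zw.2) < c].
Proof.
have mc : measurable_fun setT (fun zw : (R * R) * (R * R) => cabs (cplx zw.1 - cplx zw.2)).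
  apply: (measurable_cabs (F := fun zw => cplx zw.1 - cplx zw.2)).
    have -> : (fun x : (R * R) * (R * R) => complex.Re (cplx x.1 - cplx x.2)) =
      (fun x => x.1.1 - x.2.1) by apply/funext => -[[? ?] [? ?]].
    apply: measurable_funB.
      apply: (measurableT_comp (measurable_fst)); exact: measurable_fst.
    apply: (measurableT_comp (measurable_fst)); exact: measurable_snd.
  have -> : (fun x : (R * R) * (R * R) => complex.Im (cplx x.1 - cplx x.2)) =
    (fun x => x.1.2 - x.2.2) by apply/funext => -[[? ?] [? ?]].
  apply: measurable_funB.
    apply: (measurableT_comp (measurable_snd)); exact: measurable_fst.
  apply: (measurableT_comp (measurable_snd)); exact: measurable_snd.
have := mc measurableT `]-oo, c[%classic (measurable_itv _).
rewrite setTI; congr (measurable _); apply/seteqP; split=> p /=; by rewrite in_itv.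
Qed.
End PlaneMeasure.

Section Carleson.
Context {R : realType}.
Local Notation D := (cplx @^-1` (@unit_disc R)).
Variable v : R * R -> R.
Hypothesis mv : measurable_fun setT v.
Hypothesis v0 : forall z, 0 < v z.
Hypothesis vfin : (\int[dA]_(z in D) (v z)%:E < +oo)%E.

Definition near_pair (c : R) : set ((R * R) * (R * R)) :=
  [set zw | cabs (cplx zw.1 - cplx zw.2) < c].

(** The shell swept out by the discs of radius 5/8 t about the Whitney centers of level t: the
    distance to the circle ranges over 3/4 t - 5/8 t = t / 8 to 3/4 t + 5/8 t = 11/8 t. *)
Definition layer (t : R) : set (R * R) :=
  [set w | t / 8 < 1 - cabs (cplx w) /\ 1 - cabs (cplx w) < 11 / 8 * t].

Definition disc_weight : R * R -> R := v \_ D.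

Definition near_weight (c : R) (w : R * R) : \bar R :=
  (\int[dA]_z (disc_weight z * \1_(near_pair c) (z, w))%:E)%E.

Lemma disc_weight_ge0 z : 0 <= disc_weight z.
Proof. by rewrite /disc_weight patchE; case: ifP => // _; exact: ltW. Qed.

Lemma measurable_disc_weight : measurable_fun setT disc_weight.
Proof.
apply/(measurable_restrictT _ _).1; first exact: measurable_unit_disc.
exact: measurable_funTS.
Qed.

Lemma measurable_near_indic c : measurable_fun setT (\1_(near_pair c) : _ -> R).
Proof. by apply: measurable_indic; exact: measurable_near. Qed.

Lemma measurable_near_kernel c : measurable_fun setT
  (fun zw : (R * R) * (R * R) => (disc_weight zw.1 * \1_(near_pair c) zw)%:E).
Proof.
apply/measurable_EFinP; apply: measurable_funM.
  by apply: (measurableT_comp measurable_disc_weight); exact: measurable_fst.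
exact: measurable_near_indic.
Qed.

Lemma near_weightE c w : near_weight c w =
  (\int[dA]_(z in cplx @^-1` (disc (cplx w) c `&` unit_disc)) (v z)%:E)%E.
Proof.
rewrite [RHS]integral_mkcond; apply: eq_integral => z _.
rewrite /disc_weight !patchE indicE /=.
have [zD|zD] := boolP (z \in D); last first.
  rewrite mul0r memNset// => -[_ h]; move: zD; rewrite notin_setE; exact.
have [zn|zn] := boolP ((z, w) \in near_pair c).
  rewrite mulr1 mem_set//; split; first by move: zn; rewrite inE.
  by move: zD; rewrite inE.
rewrite mulr0 memNset// => -[h _]; move: zn; rewrite notin_setE; exact.
Qed.

Lemma near_weight_fin c w : near_weight c w \is a fin_num.
Proof.
rewrite near_weightE ge0_fin_numE.
  apply: le_lt_trans vfin; apply: ge0_subset_integral => //.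
  - by apply: measurableI; [exact: measurable_disc|exact: measurable_unit_disc].
  - exact: measurable_unit_disc.
  - by apply/measurable_EFinP; exact: measurable_funTS.
  - by move=> z _; rewrite lee_fin ltW.
  - by move=> z [].
by apply: integral_ge0 => z _; rewrite lee_fin ltW.
Qed.

Lemma near_weight_ge0 c w : (0 <= near_weight c w)%E.
Proof.
by apply: integral_ge0 => z _; rewrite lee_fin mulr_ge0 ?disc_weight_ge0.
Qed.

Lemma measurable_near_weight c : measurable_fun setT (fun w => fine (near_weight c w)).
Proof.
apply: (measurableT_comp (fine_measurable measurableT)).
apply: (measurable_dA_integral2 (k := fun zw => (disc_weight zw.1 * \1_(near_pair c) zw)%:E)).
  exact: measurable_near_kernel.
by move=> zw; rewrite lee_fin mulr_ge0 ?disc_weight_ge0.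
Qed.

Variable G : R * R -> R.
Hypothesis mG : measurable_fun setT G.
Hypothesis G0 : forall w, 0 <= G w.

(** The radius 11/8 t = 3/4 t + 5/8 t bounds the distance from w in a Whitney disc of level t to any
    z further out on the same radius. The normalising weight is that of a disc about w, not about
    the Whitney center, which depends on z: only so does integration in z give mass at most one.
    Writing the inverse as a power lets [measurable_powR_comp] apply. *)
Definition carleson_kernel (t : R) (zw : (R * R) * (R * R)) : R :=
  (\1_(layer t) zw.2 * G zw.2 * fine (near_weight (11 / 8 * t) zw.2) `^ (- 1)) *
  \1_(near_pair (11 / 8 * t)) zw.

Lemma carleson_kernel_ge0 t zw : 0 <= carleson_kernel t zw.
Proof. by rewrite !mulr_ge0 ?powR_ge0. Qed.

Lemma measurable_layer t : measurable (layer t).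
Proof.
have mc : measurable_fun setT (fun w : R * R => 1 - cabs (cplx w)).
  apply: measurable_funB => //.
  apply: (@ccont_measurable_cabs _ _ (fun z => z)) => z _.
  exact: (@ccont_id _ (cplx z)).
have := mc measurableT `](t / 8), (11 / 8 * t)[%classic (measurable_itv _).
rewrite setTI; congr (measurable _); apply/seteqP; split=> w /=; rewrite in_itv /=.
  by move=> /andP.
by move=> [? ?]; apply/andP.
Qed.

Lemma measurable_layer_part t : measurable_fun setT
  (fun w => \1_(layer t) w * G w * fine (near_weight (11 / 8 * t) w) `^ (- 1)).
Proof.
apply: measurable_funM; first apply: measurable_funM => //.
  by apply: measurable_indic; exact: measurable_layer.
by apply: measurable_powR_comp; exact: measurable_near_weight.
Qed.

Lemma measurable_carleson_kernel t : measurable_fun setT (carleson_kernel t).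
Proof.
apply: measurable_funM; last exact: measurable_near_indic.
by apply: (measurableT_comp (measurable_layer_part t)); exact: measurable_snd.
Qed.

Lemma measurable_carleson_integral t : measurable_fun setT
  (fun z => \int[dA]_w (carleson_kernel t (z, w))%:E)%E.
Proof.
apply: (measurable_dA_integral (k := EFin \o carleson_kernel t)).
  by apply/measurable_EFinP; exact: measurable_carleson_kernel.
by move=> zw; rewrite lee_fin carleson_kernel_ge0.
Qed.

(* The kernel has mass at most one against the weight, since the normalising
   factor is the weight of the disc seen from the second variable. *)
Lemma carleson_embedding t :
  (\int[dA]_z ((disc_weight z)%:E * \int[dA]_w (carleson_kernel t (z, w))%:E) <=
   \int[dA]_w (\1_(layer t) w * G w)%:E)%E.
Proof.
have mk := measurable_carleson_kernel t.
have mk2 z : measurable_fun setT (fun w => (carleson_kernel t (z, w))%:E).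
  by apply/measurable_EFinP; exact: measurableT_comp.
under eq_integral => z _.
  rewrite -ge0_integralZl_EFin//; last 3 first.
  - by move=> w _; rewrite lee_fin carleson_kernel_ge0.
  - exact: mk2.
  - exact: disc_weight_ge0.
  over.
pose wk zw := ((disc_weight zw.1)%:E * (carleson_kernel t zw)%:E)%E.
rewrite (dA_tonelli (k := wk)); last 2 first.
- apply: emeasurable_funM; apply/measurable_EFinP => //.
  by apply: (measurableT_comp measurable_disc_weight); exact: measurable_fst.
- by move=> zw; rewrite mule_ge0// lee_fin ?disc_weight_ge0 ?carleson_kernel_ge0.
apply: ge0_le_integral => //.
- move=> w _; apply: integral_ge0 => z _.
  by rewrite mule_ge0// lee_fin ?disc_weight_ge0 ?carleson_kernel_ge0.
- apply: (measurable_dA_integral2 (k := wk)).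
    apply: emeasurable_funM; apply/measurable_EFinP => //.
    by apply: (measurableT_comp measurable_disc_weight); exact: measurable_fst.
  by move=> zw; rewrite mule_ge0// lee_fin ?disc_weight_ge0 ?carleson_kernel_ge0.
- apply/measurable_EFinP; apply: measurable_funM => //.
  by apply: measurable_indic; exact: measurable_layer.
move=> w _.
set a := \1_(layer t) w * G w.
have a0 : 0 <= a by rewrite mulr_ge0.
set V := near_weight (11 / 8 * t) w.
have -> : (\int[dA]_z ((disc_weight z)%:E * (carleson_kernel t (z, w))%:E) =
    (a * fine V `^ (- 1))%:E * V)%E.
  rewrite /V /near_weight -ge0_integralZl_EFin//; last 3 first.
  - by move=> z _; rewrite lee_fin mulr_ge0 ?disc_weight_ge0.
  - exact: (measurableT_comp (measurable_near_kernel _) (pair2_measurable w)).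
  - by rewrite mulr_ge0 ?powR_ge0.
  apply: eq_integral => z _; rewrite -!EFinM; congr (_%:E).
  rewrite /carleson_kernel /= -/V -/a.
  by move: (fine _ `^ _) => k; ring.
have Vf : V \is a fin_num := near_weight_fin _ _.
rewrite -[X in (_ * X <= _)%E](fineK Vf) -EFinM lee_fin -mulrA ler_piMr//.
have V0 : 0 <= fine V by rewrite fine_ge0// near_weight_ge0.
rewrite powR_inv1//; have [->|Vn0] := eqVneq (fine V) 0; first by rewrite mulr0.
by rewrite mulVf.
Qed.

End Carleson.

Section Layers.
Context {R : realType}.

Lemma sum_window (i N : nat) : (\sum_(j < N) (i <= j < i + 4) <= 4)%N.
Proof.
suff -> : (\sum_(j < N) (i <= j < i + 4) = minn N (i + 4) - i)%N.
  by rewrite leq_subLR geq_minr.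
elim: N => [|N IH]; first by rewrite big_ord0 min0n.
rewrite big_ord_recr /= IH.
have [Ni|iN] := ltnP N i.
  have sub0 n : (n <= i)%N -> (minn n (i + 4) - i = 0)%N.
    by move=> ni; apply/eqP; rewrite subn_eq0 geq_min ni.
  by rewrite !sub0// ltnW.
have [N4|N4] /= := ltnP N (i + 4).
  by rewrite addn1 (minn_idPl N4) subSn.
by rewrite addn0 (minn_idPr (leqW N4)).
Qed.

(** If w lies in layers j <= k, then 2^-j / 8 < 11/8 * 2^-k, so 2^(k - j) < 11 < 16 and k < j + 4.
    All layers containing w thus have indices in a window of four. *)
Lemma layers_overlap (w : R * R) (N : nat) :
  \sum_(j < N) (\1_(layer ((2^-1 : R) ^+ j)) w : R) <= 4.
Proof.
pose b j : bool := w \in layer ((2^-1 : R) ^+ j).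
have -> : \sum_(j < N) (\1_(layer ((2^-1 : R) ^+ j)) w : R) = (\sum_(j < N) b j)%N%:R.
  by rewrite natr_sum; apply: eq_bigr => j _; rewrite indicE.
rewrite ler_nat.
have far j k : b j -> b k -> (j <= k)%N -> (k < j + 4)%N.
  rewrite /b !inE => -[h1 h2] [h3 h4] jk; rewrite ltnNge; apply/negP => jk4.
  have : (2^-1 : R) ^+ k <= (2^-1) ^+ j * (2^-1) ^+ 4.
    by rewrite -exprD; apply: ler_wiXn2l => //; lra.
  have -> : (2^-1 : R) ^+ 4 = 1 / 16 by rewrite exprVn -natrX div1r.
  by lra.
have [/existsP[j0 bj0]|nb] := boolP [exists j : 'I_N, b j].
  have ex : exists n, b n by exists j0.
  have [i bi imin] := ex_minnP ex.
  apply: leq_trans (sum_window i N); apply: leq_sum => j _.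
  case bj: (b j) => //.
  have ij := imin _ bj; have := far _ _ bi bj ij.
  by rewrite ij => ->.
rewrite big1// => j _; apply/eqP; rewrite eqb0; apply: contra nb => bj.
by apply/existsP; exists j.
Qed.

End Layers.

Section Absorption.
Context {R : realType}.
Local Notation D := (cplx @^-1` (@unit_disc R)).
Variables (v : R * R -> R) (p q Cb : R).
Hypothesis mv : measurable_fun setT v.
Hypothesis v0 : forall z, 0 < v z.
Hypothesis p0 : 0 < p.
Hypothesis q1 : 1 < q.
Hypothesis Cb0 : 0 < Cb.
Hypothesis bb : bekolle_bonami_bound v q Cb.

Local Notation truncated_disc N :=
  (cplx @^-1` (disc 0 (1 - (2^-1 : R) ^+ N))).

Section Potential.
Variables (f F : R[i] -> R[i]).
Hypothesis fF : forall z, cabs z < 1 -> cdiff f z (F z).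

Local Notation derivative_density :=
  (fun z : R * R => scaled_derivative F (cplx z) `^ p * v z).
Local Notation oscillation_density :=
  (fun z : R * R => oscillation f (cplx z) `^ p * v z).

Lemma truncated_disc_sub N : truncated_disc N `<=` D.
Proof.
move=> z h; have {}h : cabs (cplx z - 0) < 1 - (2^-1) ^+ N := h.
rewrite subr0 in h; rewrite /= unit_discE; apply: lt_le_trans h _.
by rewrite gerBl exprn_ge0// invr_ge0 ler0n.
Qed.

Lemma measurable_derivative_density : measurable_fun D derivative_density.
Proof.
apply: measurable_funM; last exact: measurable_funTS.
apply: measurable_powR_comp; apply: measurable_funM.
  apply: measurable_funB => //; apply: (@ccont_measurable_cabs _ _ (fun z => z)) => z _.
  exact: (@ccont_id _ (cplx z)).
apply: ccont_measurable_cabs => z; rewrite /= unit_discE => z1.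
exact: (derivative_ccont fF).
Qed.

Lemma measurable_oscillation_density : measurable_fun D oscillation_density.
Proof.
apply: measurable_funM; last exact: measurable_funTS.
apply: measurable_powR_comp.
apply: (@ccont_measurable_cabs _ _ (fun z => f z - f 0)) => z.
rewrite /= unit_discE => /fF /cdiff_ccont cf.
by apply: ccontB => //; exact: ccont_cst.
Qed.

Lemma derivative_density_ge0 z : 0 <= derivative_density z.
Proof. by rewrite mulr_ge0 ?powR_ge0// ltW. Qed.

Lemma oscillation_density_ge0 z : 0 <= oscillation_density z.
Proof. by rewrite mulr_ge0 ?powR_ge0// ltW. Qed.

(** On the smaller disc f is bounded, and the weight is integrable on the whole disc. The finiteness
    makes the final subtraction legitimate. *)
Lemma truncated_finite N :
  (\int[dA]_(z in truncated_disc N) (oscillation_density z)%:E < +oo)%E.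
Proof.
have h2 : 0 < (2^-1 : R) ^+ N by rewrite exprn_gt0// invr_gt0 ltr0n.
have r1 : 1 - (2^-1 : R) ^+ N < 1 by lra.
have [M M0 HM] := bounded_on_disc fF r1.
have fin := weight_integrable_disc mv v0 q1 bb.
have sub := @truncated_disc_sub N.
have md : measurable (truncated_disc N) := measurable_disc _ _.
have mvE A : measurable_fun A (EFin \o v).
  by apply/measurable_EFinP; exact: measurable_funTS.
apply: (@le_lt_trans _ _ (\int[dA]_(z in truncated_disc N) (((2 * M) `^ p)%:E * (v z)%:E))%E).
  apply: ge0_le_integral => //.
  - by move=> z _; rewrite lee_fin oscillation_density_ge0.
  - apply/measurable_EFinP; apply: measurable_funS measurable_oscillation_density => //.
    exact: measurable_unit_disc.
  - by apply: measurable_funeM; exact: mvE.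
  - move=> z zN; rewrite -EFinM lee_fin ler_wpM2r ?(ltW (v0 z))//.
    have {}zN : cabs (cplx z - 0) < 1 - (2^-1) ^+ N := zN.
    rewrite subr0 in zN.
    apply: powR_le; [exact: ltW|exact: cabs_ge0|].
    have h0 : 0 <= 1 - (2^-1 : R) ^+ N by have := cabs_ge0 (cplx z); lra.
    have k1 := HM _ (ltW zN).
    have k2 : cabs (f 0) <= M by apply: HM; rewrite cabs0.
    rewrite /oscillation; apply: (le_trans (cabsD _ _)); rewrite cabsN; lra.
rewrite ge0_integralZl_EFin//; last 3 first.
- by move=> z _; rewrite lee_fin ltW.
- exact: mvE.
- exact: powR_ge0.
apply: lte_mul_pinfty => //; first by rewrite lee_fin powR_ge0.
apply: le_lt_trans fin; apply: ge0_subset_integral => //.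
- exact: measurable_unit_disc.
- exact: mvE.
- by move=> z _; rewrite lee_fin ltW.
Qed.

Lemma dyadic_level (N : nat) (s : R) : 0 <= s -> s < 1 - (2^-1) ^+ N ->
  exists2 n, (n < N)%N & 1 - (2^-1) ^+ n <= s < 1 - (2^-1) ^+ n.+1.
Proof.
move=> s0; elim: N => [|N IH]; first by rewrite expr0 subrr ltNge s0.
move=> sN; have [/IH [n nN h]|h] := ltP s (1 - (2^-1) ^+ N).
  by exists n => //; exact: ltnW.
by exists N => //; rewrite h.
Qed.

(* The increments are telescoped along the radius through z; the term with [eta]
   is absorbed in [truncated_bound]. *)
Lemma oscillation_le_potential (eta K3 Ke : R) (N : nat) (I1 : R) :
  0 < eta -> 0 < K3 -> 0 < Ke ->
  (forall (e : R[i]) (t U Phi : R), cabs e = 1 -> 0 < t ->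
  t <= 1 -> 0 <= U -> 0 <= Phi ->
  (\int[dA]_(z in cplx @^-1` disc (whitney_center e t) (5 / 8 * t))
     (derivative_density z)%:E <= U%:E)%E ->
  (\int[dA]_(z in cplx @^-1` disc (whitney_center e t) (1 / 4 * t))
     (oscillation_density z)%:E <= Phi%:E)%E ->
  exists2 W : R, 0 < W /\
    (\int[dA]_(z in cplx @^-1` (disc (whitney_center e t) (2 * t) `&` unit_disc))
       (v z)%:E = W%:E)%E &
  forall s, 1 - t <= s <= 1 - t / 2 ->
    oscillation f (s%:C * e) `^ p <= oscillation f ((1 - t)%:C * e) `^ p +
      W^-1 * (eta * K3 * Phi + Ke * U)) ->
  (\int[dA]_(z in D) (derivative_density z)%:E = I1%:E)%E ->
  forall z, truncated_disc N z ->
  ((oscillation f (cplx z) `^ p)%:E <= \sum_(j < N) \int[dA]_w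
     (carleson_kernel v (fun w => Ke * (derivative_density \_ D) w +
        eta * K3 * (oscillation_density \_ (truncated_disc N)) w)
        ((2^-1 : R) ^+ j) (z, w))%:E)%E.
Proof.
move=> eta0 K30 Ke0 step HI z zN.
set G := (fun w => _ + _).
have vfin := weight_integrable_disc mv v0 q1 bb.
have mD := @measurable_unit_disc R.
have sub := @truncated_disc_sub N.
have mN : measurable (truncated_disc N) := measurable_disc _ _.
have h2 j : 0 < (2^-1 : R) ^+ j by rewrite exprn_gt0// invr_gt0 ltr0n.
have mg1 : measurable_fun setT (derivative_density \_ D).
  by apply/(measurable_restrictT _ _).1 => //; exact: measurable_derivative_density.
have mg2 : measurable_fun setT (oscillation_density \_ (truncated_disc N)).
  apply/(measurable_restrictT _ _).1 => //.
  by apply: measurable_funS measurable_oscillation_density => //; exact: measurable_unit_disc.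
have g10 w : 0 <= (derivative_density \_ D) w.
  by rewrite patchE; case: ifP => // _; exact: derivative_density_ge0.
have g20 w : 0 <= (oscillation_density \_ (truncated_disc N)) w.
  by rewrite patchE; case: ifP => // _; exact: oscillation_density_ge0.
have eK0 : 0 <= eta * K3 by apply: ltW; exact: mulr_gt0.
have mG : measurable_fun setT G.
  by apply: measurable_funD; apply: measurable_funM.
have G0 w : 0 <= G w by rewrite /G addr_ge0// mulr_ge0// ltW.
pose H j := (\int[dA]_w (carleson_kernel v G ((2^-1 : R) ^+ j) (z, w))%:E)%E.
have H0 j : (0 <= H j)%E.
  by apply: integral_ge0 => w _; rewrite lee_fin carleson_kernel_ge0.
rewrite (_ : (\sum_(j < N) _)%E = (\sum_(j < N) H j)%E)//.
(* The center determines no radius, but there the oscillation vanishes. *)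
have [z0|z0] := eqVneq (cplx z) 0.
  rewrite /oscillation z0 subrr cabs0 powR0 ?gt_eqF//.
  by apply: sume_ge0 => j _.
have {}zN : cabs (cplx z) < 1 - (2^-1) ^+ N.
  have h : cabs (cplx z - 0) < 1 - (2^-1) ^+ N := zN.
  by rewrite subr0 in h.
set s := cabs (cplx z) in zN.
have s0 : 0 < s by rewrite cabs_gt0.
pose e := (s^-1)%:C * cplx z.
have e1 : cabs e = 1.
  by rewrite /e cabsM cabs_real ger0_norm ?invr_ge0 ?(ltW s0)// mulVf ?gt_eqF.
have ze : cplx z = s%:C * e.
  by rewrite /e mulrA -rmorphM/= mulfV ?gt_eqF// rmorph1 mul1r.
(* One level of the radius through z. The point z only has to lie beyond the inner circle of level
   j, possibly many levels further out, since the increment of level j counts for all such z. *)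
have incr j tau : (j < N)%N -> 1 - (2^-1) ^+ j <= s ->
    1 - (2^-1) ^+ j <= tau <= 1 - (2^-1) ^+ j.+1 ->
    ((oscillation f (tau%:C * e) `^ p)%:E <=
      (oscillation f ((1 - (2^-1) ^+ j)%:C * e) `^ p)%:E + H j)%E.
  move=> jN js; rewrite exprSr; set t := (2^-1) ^+ j in js *.
  have t0 : 0 < t by exact: h2.
  have t1 : t <= 1 by rewrite exprn_ile1// ?invr_ge0 ?ler0n// invf_le1 ?ltr0n// ler1n.
  move=> tauP.
  set x := whitney_center e t.
  have xc : cabs x = 1 - 3 / 4 * t := cabs_whitney_center e1 t0 t1.
  have tN : (2^-1) ^+ N <= t / 2.
    by rewrite /t -exprSr ler_wiXn2l ?invr_ge0 ?ler0n// invf_le1 ?ltr0n// ler1n.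
  have dD rho : rho <= 5 / 8 * t -> cplx @^-1` disc x rho `<=` D.
    move=> rr w h; have {}h : cabs (cplx w - x) < rho := h.
    rewrite /= unit_discE; have := cabs_dist (cplx w) x 0; rewrite !subr0 xc; lra.
  (* On this disc |w| < 1 - t / 2, and j < N gives 2^-N <= t / 2: the mean of |h|^p is taken inside
     the truncated disc, which is why G may be truncated. *)
  have dN : cplx @^-1` disc x (1 / 4 * t) `<=` truncated_disc N.
    move=> w h; have {}h : cabs (cplx w - x) < 1 / 4 * t := h.
    have : cabs (cplx w - 0) < 1 - (2^-1) ^+ N; last by [].
    by have := cabs_dist (cplx w) x 0; rewrite !subr0 xc; lra.
  have md rho : measurable (cplx @^-1` disc x rho) := measurable_disc _ _.
  have mgD (E : set (R * R)) : measurable E -> E `<=` D ->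
      measurable_fun E (EFin \o derivative_density).
    move=> mE ED; apply/measurable_EFinP.
    by apply: measurable_funS measurable_derivative_density.
  have moD (E : set (R * R)) : measurable E -> E `<=` D ->
      measurable_fun E (EFin \o oscillation_density).
    move=> mE ED; apply/measurable_EFinP.
    by apply: measurable_funS measurable_oscillation_density.
  have [U U0 HU] : exists2 U : R, 0 <= U &
      (\int[dA]_(w in cplx @^-1` disc x (5 / 8 * t)) (derivative_density w)%:E = U%:E)%E.
    exists (fine (\int[dA]_(w in cplx @^-1` disc x (5 / 8 * t)) (derivative_density w)%:E)%E).
      by apply/fine_ge0/integral_ge0 => w _; rewrite lee_fin derivative_density_ge0.
    rewrite fineK// ge0_fin_numE; last first.
      by apply: integral_ge0 => w _; rewrite lee_fin derivative_density_ge0.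
    apply: (@le_lt_trans _ _ I1%:E); last exact: ltry.
    rewrite -HI; apply: ge0_subset_integral => //.
    - exact: md.
    - exact: (mgD _ mD (fun _ h => h)).
    - by move=> w _; rewrite lee_fin derivative_density_ge0.
    - exact: dD.
  have [Phi Phi0 HPhi] : exists2 Phi : R, 0 <= Phi &
      (\int[dA]_(w in cplx @^-1` disc x (1 / 4 * t)) (oscillation_density w)%:E = Phi%:E)%E.
    exists (fine (\int[dA]_(w in cplx @^-1` disc x (1 / 4 * t)) (oscillation_density w)%:E)%E).
      by apply/fine_ge0/integral_ge0 => w _; rewrite lee_fin oscillation_density_ge0.
    rewrite fineK// ge0_fin_numE; last first.
      by apply: integral_ge0 => w _; rewrite lee_fin oscillation_density_ge0.
    apply: le_lt_trans (truncated_finite N); apply: ge0_subset_integral => //.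
    - exact: md.
    - exact: (moD _ mN sub).
    - by move=> w _; rewrite lee_fin oscillation_density_ge0.
  have [W [W0 HW] incW] := step e t U Phi e1 t0 t1 U0 Phi0
    (ltac:(by rewrite HU)) (ltac:(by rewrite HPhi)).
  have {}incW := incW tau ltac:(lra).
  apply: (@le_trans _ _ ((oscillation f ((1 - t)%:C * e) `^ p)%:E +
     (W^-1 * (eta * K3 * Phi + Ke * U))%:E)%E); first by rewrite -EFinD lee_fin.
  apply: leeD => //.
  have iW0 : 0 < W^-1 by rewrite invr_gt0.
  have mker : measurable_fun setT
      (EFin \o (fun w : R * R => carleson_kernel v G t (z, w))).
    apply/measurable_EFinP.
    exact: (measurableT_comp (measurable_carleson_kernel mv v0 mG t) (pair1_measurable z)).
  have mAff (a b : R) (E : set (R * R)) : measurable_fun E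
      (EFin \o (fun w => 0 + (a * (derivative_density \_ D) w +
         b * (oscillation_density \_ (truncated_disc N)) w))).
    apply/measurable_EFinP; apply: measurable_funTS; apply: measurable_funD => //.
    by apply: measurable_funD; apply: measurable_funM.
  (* The increment is at most the integral of G / W over the disc of radius 5/8 t about x; on that
     disc G / W is then bounded pointwise by the kernel. *)
  apply: (@le_trans _ _ (\int[dA]_(w in cplx @^-1` disc x (5 / 8 * t))
     (0 + (W^-1 * Ke * (derivative_density \_ D) w +
        W^-1 * (eta * K3) * (oscillation_density \_ (truncated_disc N)) w))%:E)%E).
    rewrite ge0_integral_affine//; last 5 first.
    - exact: md.
    - exact: measurable_funTS.
    - exact: measurable_funTS.
    - by rewrite mulr_ge0// ltW.
    - by rewrite mulr_ge0// ltW.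
    rewrite mul0e add0e mulrDr addrC EFinD; apply: leeD.
      rewrite mulrA EFinM; apply: lee_wpmul2l; first by rewrite lee_fin mulr_ge0// ltW.
      rewrite -HU le_eqVlt; apply/orP; left; apply/eqP; apply: eq_integral => w.
      rewrite inE => wd; rewrite patchE mem_set//.
      by apply: dD wd.
    rewrite mulrA EFinM; apply: lee_wpmul2l; first by rewrite lee_fin mulr_ge0// ltW.
    rewrite -HPhi; apply: (@le_trans _ _ (\int[dA]_(w in cplx @^-1` disc x (1 / 4 * t))
       ((oscillation_density \_ (truncated_disc N)) w)%:E)%E).
      rewrite le_eqVlt; apply/orP; left; apply/eqP; apply: eq_integral => w.
      rewrite inE => wd; rewrite patchE mem_set//.
      exact: dN.
    apply: ge0_subset_integral.
    - exact: md.
    - exact: md.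
    - by apply/measurable_EFinP; exact: measurable_funTS.
    - by move=> w _; rewrite lee_fin g20.
    - move=> w wd; have {}wd : cabs (cplx w - x) < 1 / 4 * t := wd.
      by have : cabs (cplx w - x) < 5 / 8 * t by lra.
  rewrite integral_mkcond /H; apply: ge0_le_integral => //.
  - move=> w _; rewrite patchE; case: ifP => // _.
    by rewrite lee_fin add0r addr_ge0// !mulr_ge0// ltW.
  - apply/(measurable_restrictT _ _).1 => //; first exact: md.
    exact: (mAff (W^-1 * Ke) (W^-1 * (eta * K3))).
  move=> w _; rewrite patchE; case: ifPn => [|_]; last first.
    by rewrite lee_fin carleson_kernel_ge0.
  rewrite inE => wd; have {}wd : cabs (cplx w - x) < 5 / 8 * t := wd.
  have wx := cabs_dist (cplx w) x 0; have xw := cabs_dist x (cplx w) 0.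
  rewrite !subr0 xc in wx xw; rewrite (cabsB x) in xw.
  have zx : cabs (cplx z - x) <= 3 / 4 * t.
    have -> : cplx z - x = (s - (1 - 3 / 4 * t))%:C * e.
      by rewrite ze /x /whitney_center -mulrBl -rmorphB.
    rewrite cabsM e1 mulr1 cabs_real.
    have s1 : s < 1 by have := h2 N; lra.
    by rewrite ler_norml; lra.
  have zw : cabs (cplx z - cplx w) < 11 / 8 * t.
    by have := cabs_dist (cplx z) x (cplx w); rewrite (cabsB x); lra.
  have wl : layer t w by split; lra.
  rewrite /carleson_kernel !indicE !mem_set//= mul1r mulr1.
  set V := fine _.
  (* Since |w - x| < 5/8 t and 5/8 + 11/8 = 2, the disc about w lies in the disc of radius 2 t about
     x. This is why W was taken on radius 2 t. *)
  have VW : V <= W.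
    rewrite -lee_fin (fineK (near_weight_fin mv v0 vfin _ _)) near_weightE//.
    rewrite -HW; apply: ge0_subset_integral => //.
    - by apply: measurableI => //; exact: measurable_disc.
    - by apply: measurableI => //; exact: measurable_disc.
    - by apply/measurable_EFinP; exact: measurable_funTS.
    - by move=> w' _; rewrite lee_fin ltW.
    - move=> w' [h1 h2']; split => //; have {}h1 : cabs (cplx w' - cplx w) < 11 / 8 * t := h1.
      have : cabs (cplx w' - x) < 2 * t; last by [].
      by have := cabs_dist (cplx w') (cplx w) x; lra.
  (* Positivity is needed to invert V <= W: at V = 0 the kernel would vanish. *)
  have V0 : 0 < V.
    rewrite -lte_fin (fineK (near_weight_fin mv v0 vfin _ _)) near_weightE//.
    pose rho := t / 32.
    have rho0 : 0 < rho by rewrite /rho; lra.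
    apply: (integral_gt0 mv v0 _ rho0 (c := cplx w)).
      by apply: measurableI => //; exact: measurable_disc.
    have sd : 2 * rho < 11 / 8 * t by rewrite /rho; lra.
    move=> w' sw; split; first exact: (square_sub_disc sd sw).
    rewrite unit_discE; have /squareP[k1 k2] := sw.
    have k := @square_in_disc _ (cplx w) (cplx w') rho k1 k2.
    have [l1 _] := wl; rewrite /rho in k; lra.
  rewrite lee_fin add0r powR_inv1 ?(ltW V0)// [leRHS]mulrC.
  have -> : W^-1 * Ke * (derivative_density \_ D) w +
    W^-1 * (eta * K3) * (oscillation_density \_ (truncated_disc N)) w = W^-1 * G w.
    by rewrite /G; ring.
  by rewrite ler_wpM2r// lef_pV2// posrE.
(* Telescoping starts at level 0, whose inner point is the center, where the oscillation is 0. *)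
have chain n : (n <= N)%N -> 1 - (2^-1) ^+ n <= s ->
    ((oscillation f ((1 - (2^-1) ^+ n)%:C * e) `^ p)%:E <= \sum_(j < n) H j)%E.
  elim: n => [|n IH] nN ns.
    rewrite big_ord0 expr0 subrr rmorph0 mul0r /oscillation subrr cabs0 powR0 ?gt_eqF//.
  rewrite big_ord_recr /=.
  have nn : (2^-1 : R) ^+ n.+1 <= (2^-1) ^+ n by rewrite exprSr; have := h2 n; lra.
  have ns' : 1 - (2^-1) ^+ n <= s by lra.
  apply: (le_trans (incr n (1 - (2^-1) ^+ n.+1) nN ns' _)); first by lra.
  by apply: leeD => //; apply: IH => //; exact: ltnW.
have [n nN /andP[n1 n2]] := dyadic_level (ltW s0) zN.
have := incr n s nN n1 ltac:(lra); rewrite -ze => /le_trans; apply.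
apply: (le_trans (leeD (chain n (ltnW nN) n1) (lexx _))).
have -> : (\sum_(j < n) H j + H n = \sum_(j < n.+1) H j)%E by rewrite big_ord_recr.
rewrite -2!(big_mkord xpredT H) (big_cat_nat (n := n.+1) _ nN)//=.
by apply: leeDl; exact: sume_ge0.
Qed.

Lemma truncated_bound (eta K3 Ke : R) (I1 : R) (N : nat) : eta = (8 * K3)^-1 ->
  0 < eta -> 0 < K3 -> 0 < Ke ->
  (forall (e : R[i]) (t U Phi : R), cabs e = 1 -> 0 < t ->
  t <= 1 -> 0 <= U -> 0 <= Phi ->
  (\int[dA]_(z in cplx @^-1` disc (whitney_center e t) (5 / 8 * t))
     (derivative_density z)%:E <= U%:E)%E ->
  (\int[dA]_(z in cplx @^-1` disc (whitney_center e t) (1 / 4 * t))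
     (oscillation_density z)%:E <= Phi%:E)%E ->
  exists2 W : R, 0 < W /\
    (\int[dA]_(z in cplx @^-1` (disc (whitney_center e t) (2 * t) `&` unit_disc))
       (v z)%:E = W%:E)%E &
  forall s, 1 - t <= s <= 1 - t / 2 ->
    oscillation f (s%:C * e) `^ p <= oscillation f ((1 - t)%:C * e) `^ p +
      W^-1 * (eta * K3 * Phi + Ke * U)) ->
  (\int[dA]_(z in D) (derivative_density z)%:E = I1%:E)%E ->
  (\int[dA]_(z in truncated_disc N) (oscillation_density z)%:E <= (8 * Ke * I1)%:E)%E.
Proof.
move=> etaE eta0 K30 Ke0 step HI.
have pot := oscillation_le_potential (N := N) eta0 K30 Ke0 step HI.
set G := (fun w => _ + _) in pot.
have vfin := weight_integrable_disc mv v0 q1 bb.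
have mD := @measurable_unit_disc R.
have sub := @truncated_disc_sub N.
have mN : measurable (truncated_disc N) := measurable_disc _ _.
have mg1 : measurable_fun setT (derivative_density \_ D).
  by apply/(measurable_restrictT _ _).1 => //; exact: measurable_derivative_density.
have mgN : measurable_fun (truncated_disc N) oscillation_density.
  by apply: measurable_funS measurable_oscillation_density.
have mg2 : measurable_fun setT (oscillation_density \_ (truncated_disc N)).
  exact/(measurable_restrictT _ _).1.
have g10 w : 0 <= (derivative_density \_ D) w.
  by rewrite patchE; case: ifP => // _; exact: derivative_density_ge0.
have g20 w : 0 <= (oscillation_density \_ (truncated_disc N)) w.
  by rewrite patchE; case: ifP => // _; exact: oscillation_density_ge0.
have eK0 : 0 <= eta * K3 by apply: ltW; exact: mulr_gt0.
have mG : measurable_fun setT G.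
  by apply: measurable_funD; apply: measurable_funM.
have G0 w : 0 <= G w by rewrite /G addr_ge0// mulr_ge0// ltW.
set X := (\int[dA]_(z in truncated_disc N) _)%E.
have X0 : (0 <= X)%E.
  by apply: integral_ge0 => z _; rewrite lee_fin oscillation_density_ge0.
have Xfin : X \is a fin_num by rewrite ge0_fin_numE// truncated_finite.
have IG : (\int[dA]_w (G w)%:E = (Ke * I1 + eta * K3 * fine X)%:E)%E.
  transitivity (\int[dA]_w (0 + (Ke * (derivative_density \_ D) w +
     eta * K3 * (oscillation_density \_ (truncated_disc N)) w))%:E)%E.
    by apply: eq_integral => w _; rewrite add0r.
  rewrite ge0_integral_affine//; last exact: ltW.
  rewrite mul0e add0e EFinD !EFinM fineK// -HI; congr (_ * _ + _ * _)%E.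
    by rewrite [RHS]integral_mkcond; apply: eq_integral => w _; rewrite !patchE; case: ifP.
  by rewrite /X [RHS]integral_mkcond; apply: eq_integral => w _; rewrite !patchE; case: ifP.
pose H j z := ((disc_weight v z)%:E *
  \int[dA]_w (carleson_kernel v G ((2^-1 : R) ^+ j) (z, w))%:E)%E.
have H0 j z : (0 <= H j z)%E.
  rewrite mule_ge0// ?lee_fin ?disc_weight_ge0//.
  by apply: integral_ge0 => w _; rewrite lee_fin carleson_kernel_ge0.
have mH j : measurable_fun setT (H j).
  apply: emeasurable_funM.
    by apply/measurable_EFinP; exact: measurable_disc_weight.
  exact: measurable_carleson_integral.
have mS : measurable_fun setT (fun z : R * R => \sum_(j < N) H j z)%E.
  by apply: emeasurable_sum => j; exact: mH.
pose L j w := (\1_(layer ((2^-1 : R) ^+ j)) w * G w)%:E.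
(* The potential bound is integrated against the weight, and [carleson_embedding] removes the kernel
   of each level, leaving G on the layer. *)
have XL : (X <= \sum_(j < N) \int[dA]_w L j w)%E.
  apply: (@le_trans _ _ (\int[dA]_z (\sum_(j < N) H j z))%E).
    rewrite /X integral_mkcond; apply: ge0_le_integral => //.
    - move=> z _; rewrite patchE; case: ifP => // _.
      by rewrite lee_fin oscillation_density_ge0.
    - by apply/(measurable_restrictT _ _).1 => //; exact/measurable_EFinP.
    - move=> z _; rewrite patchE; case: ifPn => [|_]; last by apply: sume_ge0 => j _.
      rewrite inE => zN.
      have -> : (\sum_(j < N) H j z)%E = ((disc_weight v z)%:E * \sum_(j < N)
        \int[dA]_w (carleson_kernel v G ((2^-1 : R) ^+ j) (z, w))%:E)%E.
        rewrite ge0_sume_distrr// => j _.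
        by apply: integral_ge0 => w _; rewrite lee_fin carleson_kernel_ge0.
      rewrite /disc_weight patchE mem_set; last exact: sub.
      rewrite mulrC EFinM; apply: lee_wpmul2l; last exact: pot.
      by rewrite lee_fin ltW.
  rewrite ge0_integral_sum//; last by move=> j; exact: mH.
  by apply: lee_sum => j _; exact: carleson_embedding.
have LG : (\sum_(j < N) \int[dA]_w L j w <= 4%:E * \int[dA]_w (G w)%:E)%E.
  have mL j : measurable_fun setT (L j).
    apply/measurable_EFinP; apply: measurable_funM => //.
    by apply: measurable_indic; exact: measurable_layer.
  have L0 j w : (0 <= L j w)%E by rewrite lee_fin mulr_ge0.
  have mSL : measurable_fun setT (fun w : R * R => \sum_(j < N) L j w)%E.
    by apply: emeasurable_sum => j; exact: mL.
  rewrite -ge0_integral_sum//; last by move=> j; exact: mL.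
  rewrite -ge0_integralZl_EFin//; last 2 first.
  - by move=> w _; rewrite lee_fin.
  - exact/measurable_EFinP.
  apply: ge0_le_integral => //.
  - by move=> w _; apply: sume_ge0 => j _.
  - by apply: measurable_funeM; exact/measurable_EFinP.
  - move=> w _; rewrite /L sumEFin -mulr_suml -EFinM lee_fin ler_wpM2r//.
    exact: layers_overlap.
(* With eta K3 = 1/8 this reads X <= 4 Ke I1 + X / 2, and X is finite. *)
have := le_trans XL LG; rewrite IG -(fineK Xfin) -EFinM !lee_fin.
have -> : eta * K3 = 8^-1.
  by rewrite etaE; field; rewrite gt_eqF.
by lra.
Qed.

End Potential.

Lemma truncated_estimate : exists2 C : R, 0 < C & forall f F : R[i] -> R[i],
  (forall z, cabs z < 1 -> cdiff f z (F z)) -> forall (I1 : R) (N : nat),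
  (\int[dA]_(z in D) (scaled_derivative F (cplx z) `^ p * v z)%:E = I1%:E)%E ->
  (\int[dA]_(z in truncated_disc N) (oscillation f (cplx z) `^ p * v z)%:E <=
    (C * I1)%:E)%E.
Proof.
have [K3 K30 HK3] := local_step mv v0 p0 q1 Cb0 bb.
have eta0 : 0 < (8 * K3)^-1 by rewrite invr_gt0 mulr_gt0.
have [Ke Ke0 step] := HK3 _ eta0.
exists (8 * Ke); first by rewrite mulr_gt0.
move=> f F fF I1 N; apply: (truncated_bound fF N erefl eta0 K30 Ke0).
exact: step.
Qed.

End Absorption.

(** * Exhaustion of the disc and conclusion *)

Section DiscEstimate.
Context {R : realType}.
Local Notation D := (cplx @^-1` (@unit_disc R)).
Variables (v : R * R -> R) (p q Cb : R).
Hypothesis mv : measurable_fun setT v.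
Hypothesis v0 : forall z, 0 < v z.
Hypothesis p0 : 0 < p.
Hypothesis q1 : 1 < q.
Hypothesis Cb0 : 0 < Cb.
Hypothesis bb : bekolle_bonami_bound v q Cb.

Lemma unit_disc_exhaustion :
  D = \bigcup_N (cplx @^-1` (disc 0 (1 - (2^-1 : R) ^+ N))).
Proof.
apply/seteqP; split=> z /=; last by move=> [N _ zN]; exact: truncated_disc_sub zN.
rewrite unit_discE => z1.
have z10 : 0 < 1 - cabs (cplx z) by rewrite subr_gt0.
have [N _ HN] := near_infty_natSinv_expn_lt (PosNum z10).
exists N => //.
have h : (2^-1) ^+ N < 1 - cabs (cplx z) by rewrite exprVn -div1r; exact: HN N (leqnn N).
have : cabs (cplx z - 0) < 1 - (2^-1) ^+ N; last by [].
by rewrite subr0; lra.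
Qed.

(** The constant of [truncated_estimate] does not depend on N, so monotone convergence along the
    exhausting discs applies; if the right-hand side is infinite the bound is trivial because C >
    0. *)
Lemma disc_estimate : exists2 C : R, 0 < C & forall f F : R[i] -> R[i],
  (forall z, cabs z < 1 -> cdiff f z (F z)) ->
  (\int[dA]_(z in D) (oscillation f (cplx z) `^ p * v z)%:E <=
    C%:E * \int[dA]_(z in D) (scaled_derivative F (cplx z) `^ p * v z)%:E)%E.
Proof.
have [C C0 HC] := truncated_estimate mv v0 p0 q1 Cb0 bb.
exists C => // f F fF.
set I := (\int[dA]_(z in D) (scaled_derivative _ _ `^ p * _)%:E)%E.
have I0 : (0 <= I)%E.
  by apply: integral_ge0 => z _; rewrite lee_fin mulr_ge0 ?powR_ge0// ltW.
have [->|Ifin] := eqVneq I +oo%E; first by rewrite gt0_muley ?lte_fin// leey.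
have {}Ifin : I \is a fin_num by rewrite ge0_fin_numE// ltey.
have {}HC N := HC f F fF (fine I) N (esym (fineK Ifin)).
rewrite EFinM fineK// in HC.
pose E N : set (R * R) := cplx @^-1` (disc 0 (1 - (2^-1 : R) ^+ N)).
have mE N : measurable (E N) := measurable_disc _ _.
have E_mono : nondecreasing_seq E.
  apply/nondecreasing_seqP => N; rewrite subsetEset => z h.
  have {}h : cabs (cplx z - 0) < 1 - (2^-1) ^+ N := h.
  have : cabs (cplx z - 0) < 1 - (2^-1) ^+ N.+1; last by [].
  apply: lt_le_trans h _; rewrite lerB// exprS ger_pMl ?exprn_gt0// ?invr_gt0 ?ltr0n//.
  by rewrite invf_le1 ?ltr0n// ler1n.
have mosc N : measurable_fun (E N)
    (EFin \o (fun z : R * R => oscillation f (cplx z) `^ p * v z)).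
  apply/measurable_EFinP.
  have m0 := measurable_oscillation_density p mv fF.
  apply: measurable_funS m0 => //.
    exact: measurable_unit_disc.
  exact: truncated_disc_sub.
have osc0 N z : E N z -> (0 <= (oscillation f (cplx z) `^ p * v z)%:E)%E.
  by move=> _; rewrite lee_fin mulr_ge0 ?powR_ge0// ltW.
have lim := ge0_nondecreasing_set_cvg_integral (mu := dA) E_mono mE mosc osc0.
rewrite unit_disc_exhaustion.
apply: (cvge_to_le lim); exact: nearW.
Qed.

End DiscEstimate.

Theorem theorem3p1 (R : realType) (p : R) (w : R[i] -> R) :
  0 < p ->
  weight w ->
  (exists2 q : R, 1 < q & bekolle_bonami q w) ->
  bounded_operator (weighted_Lp_norm p w) primitive_operator.
Proof.
move=> p0 hw [q q1 [Cb Cb0 hbb]].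
have [v [N [mv v0 mN N0 vw]]] := borel_version hw.
have [_ w0 _] := hw.
(* The Borel version v agrees with w on the disc off a null set, which leaves both integrals
   unchanged; an open disc containing a point of the circle is one of those in the hypothesis on
   w. *)
have bb : bekolle_bonami_bound v q Cb.
  move=> c r r0 [e [er e1]].
  have ce : (closure (disc c r) `&` unit_circle !=set0)%classic.
    by exists e; split => //; exact: subset_closure.
  have E1 : (\int[dA]_(z in cplx @^-1` (disc c r `&` unit_disc)) (v z)%:E =
      area_integral (disc c r `&` unit_disc) w)%E.
    apply: (eq_integral_off_null mN N0).
    - by move=> z _; rewrite lee_fin ltW.
    - by move=> z [_ zD]; rewrite lee_fin w0.
    - by move=> z [_ zD] Nz; rewrite vw.
  have E2 : (\int[dA]_(z in cplx @^-1` (disc c r `&` unit_disc))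
        (v z `^ (- (q - 1)^-1))%:E =
      area_integral (disc c r `&` unit_disc) (fun z => w z `^ (- (q - 1)^-1))%R)%E.
    apply: (eq_integral_off_null mN N0).
    - by move=> z _; rewrite lee_fin powR_ge0.
    - by move=> z _; rewrite lee_fin powR_ge0.
    - by move=> z [_ zD] Nz; rewrite vw.
  by rewrite E1 E2; exact: hbb.
have [C C0 HC] := disc_estimate mv v0 p0 q1 Cb0 bb.
move=> d d0; have Cp0 : 0 < C `^ p^-1 by rewrite powR_gt0.
exists (d / C `^ p^-1); first exact: divr_gt0.
move=> g h [f [fan gE hE]] gd.
have fF z : cabs z < 1 -> cdiff f z (derive1 f z).
  by rewrite -unit_discE => zD; apply: derivable_cdiff; exact: fan.
have {}HC := HC f _ fF.
have gI : area_integral unit_disc (fun z => cabs (g z) `^ p * w z) =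
    (\int[dA]_(z in cplx @^-1` unit_disc)
       (scaled_derivative (derive1 f) (cplx z) `^ p * v z)%:E)%E.
  apply: (eq_integral_off_null mN N0).
  - by move=> z zD; rewrite lee_fin mulr_ge0 ?powR_ge0// w0.
  - by move=> z zD; rewrite lee_fin mulr_ge0 ?powR_ge0// ltW.
  - move=> z zD Nz; rewrite vw// gE// cabsM cabs_real /delta_b ger0_norm//.
    by move: zD; rewrite /= unit_discE => zD; rewrite subr_ge0 ltW.
have hI : area_integral unit_disc (fun z => cabs (h z) `^ p * w z) =
    (\int[dA]_(z in cplx @^-1` unit_disc) (oscillation f (cplx z) `^ p * v z)%:E)%E.
  apply: (eq_integral_off_null mN N0).
  - by move=> z zD; rewrite lee_fin mulr_ge0 ?powR_ge0// w0.
  - by move=> z zD; rewrite lee_fin mulr_ge0 ?powR_ge0// ltW.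
  - by move=> z zD Nz; rewrite vw// hE.
rewrite /weighted_Lp_norm hI; rewrite /weighted_Lp_norm gI in gd.
set I := (\int[dA]_(z in _) _)%E in gd HC.
have I0 : (0 <= I)%E.
  by apply: integral_ge0 => z _; rewrite lee_fin mulr_ge0 ?powR_ge0// ltW.
apply: (@le_trans _ _ ((C%:E * I) `^ p^-1)%E).
  apply: gt0_ler_poweR HC; first by rewrite invr_ge0 ltW.
  - rewrite in_itv/= leey andbT; apply: integral_ge0 => z _.
    by rewrite lee_fin mulr_ge0 ?powR_ge0// ltW.
  - by rewrite in_itv/= leey andbT mule_ge0// lee_fin ltW.
rewrite poweRM// ?lee_fin ?(ltW C0)// poweR_EFin.
apply: (le_trans (lee_wpmul2l _ gd)); first by rewrite lee_fin ltW.
by rewrite -EFinM lee_fin mulrC divfK// gt_eqF.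
Qed.
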